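(* Let $f\colon\mathbb R\to\mathbb R$ be a function in the Zygmund class $\Lambda_*(\mathbb R)$. Then the graph welding $\varphi$ associated with $f$ belongs to $\mathrm{QS}(\mathbb R)$.
   Context: Zygmund class: $f\in\Lambda_*(\mathbb R)$ means that $f\colon\mathbb R\to\mathbb R$ is continuous and $\sup_{x\in\mathbb R,\,h\ne0}\frac{|f(x+h)+f(x-h)-2f(x)|}{|h|}<\infty$. Graph welding: let $\mathbb H$ and $\mathbb H^*$ be the upper and lower half-planes. For a continuous $f\colon\mathbb R\to\mathbb R$ let $F(x)=x+if(x)$ and let $\Gamma=F(\mathbb R)$ be the graph of $f$, so that $\Gamma\cup\{\infty\}$ is a Jordan curve in the Riemann sphere. Fix one of the two sides: either $\Omega$ is the domain above $\Gamma$ and $U=\mathbb H$, or $\Omega$ is the domain below $\Gamma$ and $U=\mathbb H^*$. Let $G\colon U\to\Omega$ be a conformal (biholomorphic) mapping with $G(\infty)=\infty$, meaning $G(z)\to\infty$ as $z\to\infty$. By Carathéodory's theorem $G$ extends to a homeomorphism of the closures, and its boundary values give a homeomorphism $G|_{\mathbb R}\colon\mathbb R\to\Gamma$. The graph welding associated with $f$ is the increasing homeomorphism $\varphi=G^{-1}\circ F\colon\mathbb R\to\mathbb R$. The statement is asserted for either choice of side and any such $G$. $\mathrm{QS}(\mathbb R)$ is the set of quasisymmetric homeomorphisms: increasing homeomorphisms $h\colon\mathbb R\to\mathbb R$ for which there is $M\ge1$ with $\frac1M\le\frac{h(x+t)-h(x)}{h(x)-h(x-t)}\le M$ for all $x\in\mathbb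 R$, $t>0$. *)

(* Defs.v *)
From Stdlib Require Export Reals ClassicalEpsilon.
From Coquelicot Require Export Coquelicot.
Open Scope R_scope.

Definition zygmund (f : R -> R) : Prop :=
  (forall x, continuous f x) /\
  exists M : R, forall x h, h <> 0 ->
    Rabs (f (x + h) + f (x - h) - 2 * f x) / Rabs h <= M.

Definition increasing_homeo (h : R -> R) : Prop :=
  (forall x y, x < y -> h x < h y) /\
  (forall x, continuous h x) /\
  exists k : R -> R,
    (forall y, continuous k y) /\
    (forall x, k (h x) = x) /\ (forall y, h (k y) = y).

Definition quasisymmetric (h : R -> R) : Prop :=
  increasing_homeo h /\
  exists M : R, 1 <= M /\
    forall x t, 0 < t ->
      1 / M <= (h (x + t) - h x) / (h x - h (x - t)) <= M.

Inductive side : Set := above | below.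

Definition half_plane (s : side) (z : C) : Prop :=
  match s with above => 0 < Im z | below => Im z < 0 end.

Definition graph_param (f : R -> R) (x : R) : C := (x, f x).

Definition graph_domain (f : R -> R) (s : side) (z : C) : Prop :=
  match s with above => f (Re z) < Im z | below => Im z < f (Re z) end.

(* Complex differentiability: the scalar field of [ex_derive] is
   [C_AbsRing]. *)
Definition holomorphic_on (U : C -> Prop) (G : C -> C) : Prop :=
  forall z, U z -> @ex_derive C_AbsRing C_NormedModule G z.

(* Maps are total functions on [C]; only the values of [G] on [U] matter. *)
Definition conformal (U V : C -> Prop) (G : C -> C) : Prop :=
  holomorphic_on U G /\ (forall z, U z -> V (G z)) /\
  exists H : C -> C,
    holomorphic_on V H /\ (forall w, V w -> U (H w)) /\
    (forall z, U z -> H (G z) = z) /\ (forall w, V w -> G (H w) = w).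

Definition fixes_infinity (U : C -> Prop) (G : C -> C) : Prop :=
  forall K : R, exists N : R, forall z, U z -> N < Cmod z -> K < Cmod (G z).

(* Extension of [G] from [U] to the closure of [U] by limits from within [U].
   The value is unspecified where the limit does not exist; by Caratheodory's
   theorem this never happens for the maps used below. *)
Definition closure_extension (U : C -> Prop) (G : C -> C) (z : C) : C :=
  epsilon (inhabits (RtoC 0))
    (fun w => filterlim G (within U (locally z)) (locally w)).

(* [graph_welding f s G x] is the point [t] of the real line that the extension
   of [G] sends to [graph_param f x], so that this is the composition of
   [graph_param f] with the inverse of the boundary map of [G]. *)
Definition graph_welding (f : R -> R) (s : side) (G : C -> C) (x : R) : R :=
  epsilon (inhabits 0)
    (fun t => closure_extension (half_plane s) G (RtoC t) = graph_param f x).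

(* Main.v *)
Require Import Defs.
From Stdlib Require Import Lra Lia List Classical Ranalysis5 FunctionalExtensionality.
Import ListNotations.
Open Scope R_scope.

(** The graph of a Zygmund function [f] is a quasicircle: over each interval [f]
    stays within a constant times its length of the chord ([zyg_chord]).
    Conformal maps of a half-plane onto a domain bounded by a quasicircle have
    quasisymmetric boundary values, and the proof below is the classical one by
    the length-area method, arranged so that it uses no complex integration.

    Length-area. Let [psi] be a cutoff that rises from [0] on a disc of radius
    [R0] to [1] outside the disc of radius [Lam * R0], linearly in the logarithm
    of the distance to the centre. Its Dirichlet integral is of order
    [1 / ln Lam], and so is that of [psi] composed with an injective conformal
    map [G]; hence in any rectangle of bounded shape the composition has small
    oscillation on some vertical segment. The integral is replaced by a sum over
    a tiling. [G] is only known to be differentiable at each point, so the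
    tiles are chosen by Cousin's lemma to be small compared with the scale at
    which [G] is nearly affine at one of their points. The image of such a tile
    then contains a disc of comparable size; these discs are disjoint because
    [G] is injective, and a packing estimate bounds the sum ([log_cutoff],
    [vertical_line_small_osc]).

    Crosscuts. Three such segments form a crosscut around any real point, at any
    scale, whose image does not meet both the small and the large disc
    ([crosscut]). As the region above the graph is linearly locally connected
    ([joined_inside], [joined_outside]), a crosscut with image in the large disc
    encloses a set with image in a comparable disc, and one with image outside
    the small disc cannot separate two points mapped close to its centre. This
    yields boundedness of [G] on bounded sets and the limits of [G] on the real
    axis ([graph_map_bounded], [boundary_limit]), which are points
    [graph_param f (tau t)] of the graph.

    The map [tau]. If [tau] took a value twice, then it would be constant in
    between, since one could otherwise follow the graph out of the image of a
    crosscut, and the length-area estimate excludes intervals of constancy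
    ([boundary_map_injective]). That [tau] increases is a winding number
    argument: [(G z - G i) / (z - i)] has a continuous argument
    ([boundary_map_orientation]).

    Quasisymmetry. Let [phi] be the inverse of [tau], that is, the welding. If
    [phi x - phi (x - t)] were much larger than [phi (x + K t) - phi x], then a
    crosscut around [phi x] would have one foot mapped over [(x - t, x)] and the
    other beyond [x + K t]. For large [K] the distances of these image points
    from [graph_param f x] have a ratio greater than [Lam], because the slope of
    a chord of [f] changes by at most a constant when the scale is halved
    ([graph_param_scales]); this contradicts [crosscut]. The resulting one-sided
    estimates, and their mirror images, chain to quasisymmetry
    ([chained_doubling]). The region below the graph is reflected to the region
    above the graph of [- f]. *)

(** * Sums over lists and areas *)

Fixpoint lsum {A : Type} (g : A -> R) (l : list A) : R :=
  match l with nil => 0 | a :: l' => g a + lsum g l' end.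

Lemma lsum_app {A} (g : A -> R) l1 l2 :
  lsum g (l1 ++ l2) = lsum g l1 + lsum g l2.
Proof. induction l1 as [|a l1 IH]; simpl; [ring | rewrite IH; ring]. Qed.

Lemma lsum_le {A} (g1 g2 : A -> R) l :
  (forall a, In a l -> g1 a <= g2 a) -> lsum g1 l <= lsum g2 l.
Proof.
induction l as [|a l IH]; simpl; intros H; [lra |].
apply Rplus_le_compat; [apply H; now left | apply IH; intros b Hb; apply H; now right].
Qed.

Lemma lsum_ext {A} (g1 g2 : A -> R) l :
  (forall a, In a l -> g1 a = g2 a) -> lsum g1 l = lsum g2 l.
Proof.
intros H; apply Rle_antisym; apply lsum_le; intros a Ha; rewrite H; auto; lra.
Qed.

Lemma lsum_nonneg {A} (g : A -> R) l :
  (forall a, In a l -> 0 <= g a) -> 0 <= lsum g l.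
Proof.
induction l as [|a l IH]; simpl; intros H; [lra |].
apply Rplus_le_le_0_compat; [apply H; now left | apply IH; intros b Hb; apply H; now right].
Qed.

Lemma lsum_plus {A} (g1 g2 : A -> R) l :
  lsum (fun a => g1 a + g2 a) l = lsum g1 l + lsum g2 l.
Proof. induction l as [|a l IH]; simpl; [ring | rewrite IH; ring]. Qed.

Lemma lsum_scal {A} c (g : A -> R) l :
  lsum (fun a => c * g a) l = c * lsum g l.
Proof. induction l as [|a l IH]; simpl; [ring | rewrite IH; ring]. Qed.

Lemma lsum_filter_le {A} (p : A -> bool) (g : A -> R) l :
  (forall a, In a l -> 0 <= g a) -> lsum g (filter p l) <= lsum g l.
Proof.
induction l as [|a l IH]; simpl; intros H; [lra |].
assert (0 <= g a) by (apply H; now left).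
assert (lsum g (filter p l) <= lsum g l) by (apply IH; intros; apply H; now right).
destruct (p a); simpl; lra.
Qed.

Lemma lsum_filter {A} (p : A -> bool) (g : A -> R) l :
  lsum g (filter p l) = lsum (fun a => if p a then g a else 0) l.
Proof.
induction l as [|a l IH]; simpl; [ring |].
destruct (p a); simpl; rewrite IH; ring.
Qed.

Definition ind (a b x : R) : R :=
  if Rle_dec a x then if Rle_dec x b then 1 else 0 else 0.

Lemma ind_bounds a b x : 0 <= ind a b x <= 1.
Proof. unfold ind; destruct (Rle_dec a x); [destruct (Rle_dec x b)|]; lra. Qed.

Lemma ind_in a b x : a <= x <= b -> ind a b x = 1.
Proof. unfold ind; intros; destruct (Rle_dec a x); [destruct (Rle_dec x b)|]; lra. Qed.

Lemma ind_out a b x : x < a \/ b < x -> ind a b x = 0.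
Proof. unfold ind; intros; destruct (Rle_dec a x); [destruct (Rle_dec x b)|]; lra. Qed.

Lemma is_RInt_ind A B a b :
  A <= a -> a <= b -> b <= B -> is_RInt (ind a b) A B (b - a).
Proof.
intros H1 H2 H3.
assert (I1 : is_RInt (ind a b) A a (scal (a - A) 0)).
{ apply is_RInt_ext with (fun _ => 0); [|apply @is_RInt_const].
  intros x; rewrite Rmin_left, Rmax_right by lra; intros Hx.
  symmetry; apply ind_out; lra. }
assert (I2 : is_RInt (ind a b) a b (scal (b - a) 1)).
{ apply is_RInt_ext with (fun _ => 1); [|apply @is_RInt_const].
  intros x; rewrite Rmin_left, Rmax_right by lra; intros Hx.
  symmetry; apply ind_in; lra. }
assert (I3 : is_RInt (ind a b) b B (scal (B - b) 0)).
{ apply is_RInt_ext with (fun _ => 0); [|apply @is_RInt_const].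
  intros x; rewrite Rmin_left, Rmax_right by lra; intros Hx.
  symmetry; apply ind_out; lra. }
pose proof (is_RInt_Chasles _ _ _ _ _ _ (is_RInt_Chasles _ _ _ _ _ _ I1 I2) I3) as I.
replace (b - a) with (plus (plus (scal (a - A) 0) (scal (b - a) 1)) (scal (B - b) 0)); auto.
unfold plus, scal; simpl; unfold mult; simpl; ring.
Qed.

Lemma is_RInt_lsum {T} (F : T -> R -> R) (I : T -> R) A B l :
  (forall c, In c l -> is_RInt (F c) A B (I c)) ->
  is_RInt (fun x => lsum (fun c => F c x) l) A B (lsum I l).
Proof.
induction l as [|c l IH]; simpl; intros H.
- assert (E : is_RInt (fun _ => 0) A B (scal (B - A) 0)) by apply @is_RInt_const.
  replace (scal (B - A) 0) with 0 in E; [exact E |].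
  unfold scal; simpl; unfold mult; simpl; ring.
- apply @is_RInt_plus; [apply H; now left | apply IH; intros; apply H; now right].
Qed.

(** Disjoint squares inside a big square have total area at most its area.
    Disjointness enters only through the inequality [sum of indicators <= 1],
    which is integrated first in [y], then in [x]. *)
Lemma disjoint_squares_area {T} (u v r : T -> R) (l : list T) (a b S : R) :
  0 <= S ->
  (forall c, In c l -> 0 <= r c /\
     a - S <= u c - r c /\ u c + r c <= a + S /\
     b - S <= v c - r c /\ v c + r c <= b + S) ->
  (forall x y, lsum (fun c => ind (u c - r c) (u c + r c) x *
                              ind (v c - r c) (v c + r c) y) l <= 1) ->
  lsum (fun c => r c ^ 2) l <= S ^ 2.
Proof.
intros HS Hin Hdisj.
assert (Hrow : forall x,
  lsum (fun c => ind (u c - r c) (u c + r c) x * (2 * r c)) l <= 2 * S).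
{ intros x.
  replace (2 * S) with (scal ((b + S) - (b - S)) 1)
    by (unfold scal; simpl; unfold mult; simpl; ring).
  apply (is_RInt_le
    (fun y => lsum (fun c => ind (u c - r c) (u c + r c) x *
                             ind (v c - r c) (v c + r c) y) l)
    (fun _ => 1) (b - S) (b + S)); [lra | | apply @is_RInt_const | intros; apply Hdisj].
  apply is_RInt_lsum; intros c Hc; destruct (Hin c Hc) as (H0 & H1 & H2 & H3 & H4).
  apply @is_RInt_scal.
  replace (2 * r c) with ((v c + r c) - (v c - r c)) by ring.
  apply is_RInt_ind; lra. }
assert (H4 : lsum (fun c => 4 * r c ^ 2) l <= 4 * S ^ 2).
{ replace (4 * S ^ 2) with (scal ((a + S) - (a - S)) (2 * S))
    by (unfold scal; simpl; unfold mult; simpl; ring).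
  apply (is_RInt_le
    (fun x => lsum (fun c => (2 * r c) * ind (u c - r c) (u c + r c) x) l)
    (fun _ => 2 * S) (a - S) (a + S)); [lra | | apply @is_RInt_const |].
  - apply is_RInt_lsum; intros c Hc; destruct (Hin c Hc) as (H0 & H1 & H2 & H3 & H4).
    replace (4 * r c ^ 2) with (scal (2 * r c) ((u c + r c) - (u c - r c)))
      by (unfold scal; simpl; unfold mult; simpl; ring).
    apply @is_RInt_scal, is_RInt_ind; lra.
  - intros x _; eapply Rle_trans; [|apply (Hrow x)].
    apply lsum_le; intros; lra. }
rewrite lsum_scal in H4; lra.
Qed.

(** * Packings of discs and logarithmic cutoffs *)

Lemma Cmod_lt_sq (x y r : R) : 0 < r -> x ^ 2 + y ^ 2 < r ^ 2 -> Cmod (x, y) < r.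
Proof.
intros Hr H; unfold Cmod; simpl fst; simpl snd.
rewrite <- (sqrt_pow2 r) by lra. apply sqrt_lt_1; nra.
Qed.

Lemma Re_le_Cmod (z : C) : Rabs (fst z) <= Cmod z.
Proof. eapply Rle_trans; [apply Rmax_l | apply Rmax_Cmod]. Qed.

Lemma Im_le_Cmod (z : C) : Rabs (snd z) <= Cmod z.
Proof. eapply Rle_trans; [apply Rmax_r | apply Rmax_Cmod]. Qed.

Lemma Cmod_le_sum (z : C) : Cmod z <= Rabs (fst z) + Rabs (snd z).
Proof.
destruct z as [x y]; simpl.
replace (x, y) with (Cplus (x, 0) (0, y)) by (unfold Cplus; simpl; f_equal; ring).
eapply Rle_trans; [apply Cmod_triangle |].
apply Rplus_le_compat; unfold Cmod; simpl fst; simpl snd;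
  rewrite <- sqrt_Rsqr_abs; apply Req_le; f_equal; unfold Rsqr; ring.
Qed.

Lemma Cmod_sub_triangle (a b c : C) : Cmod (a - c) <= Cmod (a - b) + Cmod (b - c).
Proof.
replace (a - c)%C with ((a - b) + (b - c))%C by ring. apply Cmod_triangle.
Qed.

Lemma Cmod_sub_sym (a b : C) : Cmod (a - b) = Cmod (b - a).
Proof. replace (a - b)%C with (- (b - a))%C by ring. apply Cmod_opp. Qed.

Definition disjoint_discs {T : Type} (w : T -> C) (r : T -> R) (l : list T) : Prop :=
  forall u : C,
    lsum (fun c => if Rlt_dec (Cmod (u - w c)) (r c) then 1 else 0) l <= 1.

Lemma disjoint_discs_filter {T} (w : T -> C) r l p :
  disjoint_discs w r l -> disjoint_discs w r (filter p l).
Proof.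
intros H u; eapply Rle_trans; [apply lsum_filter_le | apply H].
intros a _; destruct (Rlt_dec _ _); lra.
Qed.

Lemma disjoint_discs_area {T} (w : T -> C) r (l : list T) (p : C) S :
  0 <= S -> disjoint_discs w r l ->
  (forall c, In c l -> 0 < r c /\ Cmod (w c - p) + r c <= S) ->
  lsum (fun c => r c ^ 2) l <= 4 * S ^ 2.
Proof.
intros HS Hd Hin.
enough (lsum (fun c => (r c / 2) ^ 2) l <= S ^ 2) as H.
{ rewrite (lsum_ext _ (fun c => / 4 * r c ^ 2)) in H by (intros; field).
  rewrite lsum_scal in H; lra. }
apply (disjoint_squares_area (fun c => fst (w c)) (fun c => snd (w c))
         (fun c => r c / 2) l (fst p) (snd p) S HS).
- intros c Hc; destruct (Hin c Hc) as [H0 H1].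
  pose proof (Re_le_Cmod (w c - p)); pose proof (Im_le_Cmod (w c - p)).
  simpl in *.
  assert (Rabs (fst (w c) + - fst p) <= S - r c) as A2%Rabs_le_between by lra.
  assert (Rabs (snd (w c) + - snd p) <= S - r c) as A3%Rabs_le_between by lra.
  repeat split; lra.
- intros x y; eapply Rle_trans; [| apply (Hd (x, y))].
  apply lsum_le; intros c Hc; destruct (Hin c Hc) as [H0 _].
  pose proof (ind_bounds (fst (w c) - r c / 2) (fst (w c) + r c / 2) x).
  pose proof (ind_bounds (snd (w c) - r c / 2) (snd (w c) + r c / 2) y).
  destruct (Rlt_dec _ _) as [_ | Hn]; [nra |].
  destruct (Rlt_dec x (fst (w c) - r c / 2)); [rewrite ind_out by lra; lra |].
  destruct (Rlt_dec (fst (w c) + r c / 2) x); [rewrite ind_out by lra; lra |].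
  destruct (Rlt_dec y (snd (w c) - r c / 2)); [rewrite (ind_out _ _ y) by lra; lra |].
  destruct (Rlt_dec (snd (w c) + r c / 2) y); [rewrite (ind_out _ _ y) by lra; lra |].
  contradict Hn; unfold Cminus, Cplus, Copp; simpl.
  apply Cmod_lt_sq; nra.
Qed.

(** The weight [(r / |w - p|) ^ 2] has bounded sum over a shell
    [D <= |w - p| < 2 D], whatever [D]: area over square of radius. *)
Lemma shell_weight {T} (w : T -> C) r (l : list T) (p : C) D :
  0 < D -> disjoint_discs w r l ->
  (forall c, In c l -> 0 < r c <= D) ->
  lsum (fun c => if Rle_dec D (Cmod (w c - p)) then
                 if Rlt_dec (Cmod (w c - p)) (2 * D) then
                   (r c / Cmod (w c - p)) ^ 2 else 0 else 0) l <= 36.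
Proof.
intros HD Hd Hr.
set (sh := fun c => if Rle_dec D (Cmod (w c - p)) then
                 if Rlt_dec (Cmod (w c - p)) (2 * D) then true else false else false).
assert (H : lsum (fun c => r c ^ 2) (filter sh l) <= 4 * (3 * D) ^ 2).
{ apply (disjoint_discs_area w r _ p); [lra | now apply disjoint_discs_filter |].
  intros c [Hc Hs]%filter_In; destruct (Hr c Hc); split; [easy |].
  unfold sh in Hs; destruct (Rle_dec _ _); [destruct (Rlt_dec _ _)|]; try easy; lra. }
rewrite lsum_filter in H.
apply Rle_trans with (/ D ^ 2 * (4 * (3 * D) ^ 2)); [| right; field; lra].
eapply Rle_trans; [| apply Rmult_le_compat_l; [| apply H]];
  [| apply Rlt_le, Rinv_0_lt_compat; nra].
rewrite <- lsum_scal; apply lsum_le; intros c Hc; destruct (Hr c Hc); unfold sh.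
destruct (Rle_dec _ _) as [h1|]; [destruct (Rlt_dec _ _) as [h2|]|]; try lra.
unfold Rdiv; rewrite Rpow_mult_distr, Rmult_comm.
apply Rmult_le_compat_r; [nra |].
rewrite pow_inv. apply Rinv_le_contravar; [nra | apply pow_incr; lra].
Qed.

Lemma shells_weight {T} (w : T -> C) r (l : list T) (p : C) D n :
  0 < D -> disjoint_discs w r l ->
  (forall c, In c l -> 0 < r c <= D) ->
  lsum (fun c => if Rle_dec D (Cmod (w c - p)) then
                 if Rlt_dec (Cmod (w c - p)) (2 ^ n * D) then
                   (r c / Cmod (w c - p)) ^ 2 else 0 else 0) l <= 36 * INR n.
Proof.
intros HD Hd Hr; induction n as [|n IH].
- simpl; rewrite (lsum_ext _ (fun c => 0 * 0)), lsum_scal; [lra |].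
  intros c _; destruct (Rle_dec _ _); [destruct (Rlt_dec _ _)|]; lra.
- assert (1 <= 2 ^ n) by (apply pow_R1_Rle; lra).
  assert (Hs := shell_weight w r l p (2 ^ n * D) ltac:(nra) Hd).
  assert (forall c, In c l -> 0 < r c <= 2 ^ n * D) as Hr'.
  { intros c Hc; destruct (Hr c Hc); nra. }
  specialize (Hs Hr'); rewrite S_INR.
  eapply Rle_trans; [| apply Rle_trans with (1 := Rplus_le_compat _ _ _ _ IH Hs); lra].
  rewrite <- lsum_plus; apply lsum_le; intros c _.
  assert (0 <= (r c / Cmod (w c - p)) ^ 2) by apply pow2_ge_0.
  simpl (2 ^ S n).
  repeat (match goal with
    | |- context [Rle_dec ?a ?b] => destruct (Rle_dec a b)
    | |- context [Rlt_dec ?a ?b] => destruct (Rlt_dec a b) end); lra.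
Qed.

(** A discrete stand-in for [Dirichlet integral of psi <= e]: over disjoint
    small discs, the sum of squared oscillations on the 60 times larger discs
    is at most [e]. *)
Definition small_energy (psi : C -> R) (e : R) : Prop :=
  exists eta, 0 < eta /\ exists o : C -> R -> R,
    (forall w r, 0 < r <= eta -> 0 <= o w r /\
       forall u u', Cmod (u - w) <= 60 * r -> Cmod (u' - w) <= 60 * r ->
         Rabs (psi u - psi u') <= o w r) /\
    (forall (T : Type) (w : T -> C) (r : T -> R) (l : list T),
       (forall c, In c l -> 0 < r c <= eta) -> disjoint_discs w r l ->
       lsum (fun c => o (w c) (r c) ^ 2) l <= e).

Lemma ln_lipschitz m u v : 0 < m -> m <= u -> m <= v ->
  Rabs (ln u - ln v) <= Rabs (u - v) / m.
Proof.
assert (W : forall u v, 0 < m -> m <= v -> v <= u ->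
  Rabs (ln u - ln v) <= Rabs (u - v) / m).
{ clear; intros u v Hm Hv Hu.
  assert (ln v <= ln u) by (apply ln_le; lra).
  rewrite !Rabs_pos_eq by lra.
  rewrite <- ln_div by lra.
  assert (0 < u / v) by (apply Rdiv_lt_0_compat; lra).
  apply Rle_trans with (u / v - 1).
  - rewrite <- (ln_exp (u / v - 1)); apply ln_le; [easy |].
    pose proof (exp_ineq1_le (u / v - 1)); lra.
  - replace (u / v - 1) with ((u - v) / v) by (field; lra).
    apply Rmult_le_compat_l; [lra | apply Rinv_le_contravar; lra]. }
intros Hm Hu Hv; destruct (Rle_dec v u) as [h | h]; [apply W; lra |].
rewrite Rabs_minus_sym, (Rabs_minus_sym u); apply W; lra.
Qed.

Definition clamp (a b u : R) : R := Rmin (Rmax u a) b.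

Lemma clamp_bounds a b u : a <= b -> a <= clamp a b u <= b.
Proof. intros; unfold clamp, Rmin, Rmax; repeat destruct (Rle_dec _ _); lra. Qed.

Lemma clamp_low a b u : a <= b -> u <= a -> clamp a b u = a.
Proof. intros; unfold clamp, Rmin, Rmax; repeat destruct (Rle_dec _ _); lra. Qed.

Lemma clamp_high a b u : a <= b -> b <= u -> clamp a b u = b.
Proof. intros; unfold clamp, Rmin, Rmax; repeat destruct (Rle_dec _ _); lra. Qed.

Lemma clamp_ge a b u m : a <= b -> m <= u -> m <= b -> m <= clamp a b u.
Proof. intros; unfold clamp, Rmin, Rmax; repeat destruct (Rle_dec _ _); lra. Qed.

Lemma clamp_lipschitz a b u v : a <= b ->
  Rabs (clamp a b u - clamp a b v) <= Rabs (u - v).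
Proof.
intros; unfold clamp, Rmin, Rmax; repeat destruct (Rle_dec _ _);
  unfold Rabs; repeat destruct (Rcase_abs _); lra.
Qed.

Lemma Cmod_dist_lipschitz (u u' p : C) :
  Rabs (Cmod (u - p) - Cmod (u' - p)) <= Cmod (u - u').
Proof.
pose proof (Cmod_sub_triangle u u' p); pose proof (Cmod_sub_triangle u' u p).
rewrite (Cmod_sub_sym u' u) in *; apply Rabs_le; lra.
Qed.

(** Logarithmic cutoffs cost arbitrarily little energy: between radii [R0] and
    [2 ^ n R0] the slope of [log_2 |w - p| / n] is [1 / n] of that of
    [log_2 |w - p|], and the [n] dyadic shells in between contribute equally,
    so the energy is of order [n / n ^ 2]. *)
Lemma log_cutoff (e : R) : 0 < e ->
  exists Lam, 1 < Lam /\ forall (p : C) R0, 0 < R0 ->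
    exists psi : C -> R,
      (forall w, Cmod (w - p) <= R0 -> psi w = 0) /\
      (forall w, Lam * R0 <= Cmod (w - p) -> psi w = 1) /\
      (exists L, 0 < L /\ forall u v, Rabs (psi u - psi v) <= L * Cmod (u - v)) /\
      small_energy psi e.
Proof.
intros He.
set (K := 57600 * 4 * 36 * 3).
destruct (nfloor_ex (K / e)) as [n0 [_ Hn0]].
{ apply Rlt_le, Rdiv_lt_0_compat; unfold K; lra. }
set (n := S n0).
assert (Hn : K / e < INR n) by (unfold n; rewrite S_INR; lra).
assert (Hn1 : 1 <= INR n) by (apply (le_INR 1); unfold n; lia).
assert (HKe : K < INR n * e).
{ apply Rmult_lt_compat_r with (r := e) in Hn; [|lra].
  replace (K / e * e) with K in Hn by (field; lra). lra. }
assert (Hln2 : / 2 < ln 2) by apply ln_lt_2.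
exists (2 ^ n); split; [apply Rlt_pow_R1; [lra | unfold n; lia] |].
intros p R0 HR0.
assert (Hpow : 2 <= 2 ^ n).
{ unfold n; simpl; pose proof (pow_R1_Rle 2 n0); lra. }
set (B := 2 ^ n * R0).
assert (HB : 2 * R0 <= B) by (unfold B; nra).
set (N := INR n * ln 2).
assert (HN : INR n / 2 <= N) by (unfold N; nra).
set (psi := fun w : C => (ln (clamp R0 B (Cmod (w - p))) - ln R0) / N).
assert (Hlip : forall m u v, 0 < m -> m <= B ->
   (m <= R0 \/ m <= Cmod (u - p) /\ m <= Cmod (v - p)) ->
   Rabs (psi u - psi v) <= Cmod (u - v) / m / N).
{ intros m u v Hm HmB Hmu; unfold psi.
  set (a := clamp R0 B (Cmod (u - p))); set (b := clamp R0 B (Cmod (v - p))).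
  replace ((ln a - ln R0) / N - (ln b - ln R0) / N) with ((ln a - ln b) / N)
    by (field; lra).
  unfold Rdiv; rewrite Rabs_mult, (Rabs_pos_eq (/ N))
    by (apply Rlt_le, Rinv_0_lt_compat; lra).
  apply Rmult_le_compat_r; [apply Rlt_le, Rinv_0_lt_compat; lra |].
  apply Rle_trans with (Rabs (a - b) / m).
  - apply ln_lipschitz; [easy | |];
      (destruct Hmu as [Hmu | [Hmu1 Hmu2]];
       [apply Rle_trans with R0; [easy | apply clamp_bounds; lra]
       | apply clamp_ge; lra]).
  - apply Rmult_le_compat_r; [apply Rlt_le, Rinv_0_lt_compat; lra |].
    eapply Rle_trans; [apply clamp_lipschitz; lra | apply Cmod_dist_lipschitz]. }
exists psi; repeat split.
- intros w Hw; unfold psi; rewrite clamp_low by lra; field; lra.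
- intros w Hw; unfold psi; rewrite clamp_high by (fold B in Hw; lra).
  unfold B; rewrite ln_mult, ln_pow by (try apply pow_lt; lra).
  unfold N; field; lra.
- exists (/ (R0 * N)); split; [apply Rinv_0_lt_compat; nra |].
  intros u v; eapply Rle_trans; [apply (Hlip R0); [lra | lra | left; lra] |].
  right; field; lra.
- exists (R0 / 240); split; [lra |].
  exists (fun w r => if Rle_dec (R0 / 2) (Cmod (w - p)) then
     if Rlt_dec (Cmod (w - p)) (2 ^ S (S n) * (R0 / 2)) then
       240 / N * (r / Cmod (w - p)) else 0 else 0).
  assert (HB' : 2 ^ S (S n) * (R0 / 2) = 2 * B) by (unfold B; simpl; field).
  split.
  + intros w r [Hr0 Hr].
    set (d := Cmod (w - p)).
    assert (Hd : forall u, Cmod (u - w) <= 60 * r -> Rabs (Cmod (u - p) - d) <= R0 / 4).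
    { intros u Hu; eapply Rle_trans; [apply Cmod_dist_lipschitz | lra]. }
    destruct (Rle_dec (R0 / 2) d) as [h1 | h1].
    * destruct (Rlt_dec d (2 ^ S (S n) * (R0 / 2))) as [h2 | h2]; rewrite HB' in h2.
      -- split.
         { apply Rmult_le_pos; apply Rlt_le, Rdiv_lt_0_compat; lra. }
         intros u u' Hu Hu'.
         pose proof (Hd u Hu) as E1%Rabs_le_between.
         pose proof (Hd u' Hu') as E2%Rabs_le_between.
         eapply Rle_trans; [apply (Hlip (d / 2)); [lra | lra | right; lra] |].
         assert (Cmod (u - u') <= 120 * r).
         { pose proof (Cmod_sub_triangle u w u'); rewrite (Cmod_sub_sym w u') in *; lra. }
         replace (240 / N * (r / d)) with (120 * r * (/ (d / 2) * / N)) by (field; lra).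
         unfold Rdiv at 1 2; rewrite Rmult_assoc; apply Rmult_le_compat_r; [|easy].
         apply Rmult_le_pos; apply Rlt_le, Rinv_0_lt_compat; lra.
      -- split; [lra |]; intros u u' Hu Hu'.
         pose proof (Hd u Hu) as E1%Rabs_le_between.
         pose proof (Hd u' Hu') as E2%Rabs_le_between.
         unfold psi; rewrite !clamp_high by lra.
         rewrite Rminus_diag, Rabs_R0; lra.
    * split; [lra |]; intros u u' Hu Hu'.
      pose proof (Hd u Hu) as E1%Rabs_le_between.
      pose proof (Hd u' Hu') as E2%Rabs_le_between.
      unfold psi; rewrite !clamp_low by lra.
      rewrite Rminus_diag, Rabs_R0; lra.
  + intros T w r l Hr Hd.
    eapply Rle_trans with ((240 / N) ^ 2 * (36 * INR (S (S n)))).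
    * eapply Rle_trans; [| apply Rmult_le_compat_l; [apply pow2_ge_0 |
        apply (shells_weight w r l p (R0 / 2) (S (S n)) ltac:(lra) Hd)]].
      -- rewrite <- lsum_scal; apply lsum_le; intros c _.
         destruct (Rle_dec _ _); [destruct (Rlt_dec _ _)|]; right; ring.
      -- intros c Hc; destruct (Hr c Hc); lra.
    * rewrite !S_INR.
      assert (INR n * INR n / 4 <= N * N) by nra.
      apply Rmult_le_reg_r with (N * N); [nra |].
      replace ((240 / N) ^ 2 * (36 * (INR n + 1 + 1)) * (N * N))
        with (57600 * 36 * (INR n + 2)) by (field; lra).
      apply Rle_trans with (e * (INR n * INR n / 4)); [| nra].
      unfold K in HKe. nra.
Qed.

(** * Tilings adapted to a gauge *)

Definition in_tile (x0 y0 s x y : R) : Prop :=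
  x0 <= x <= x0 + s /\ y0 <= y <= y0 + 4 * s.

Lemma nested_common_point (a b : nat -> R) :
  (forall n, a n <= a (S n)) -> (forall n, b (S n) <= b n) ->
  (forall n, a n <= b n) -> exists x, forall n, a n <= x <= b n.
Proof.
intros Ha Hb Hab.
assert (Ha' : forall n k, a n <= a (n + k)%nat).
{ intros n k; induction k; [rewrite Nat.add_0_r; lra |].
  rewrite Nat.add_succ_r; eapply Rle_trans; [apply IHk | apply Ha]. }
assert (Hb' : forall n k, b (n + k)%nat <= b n).
{ intros n k; induction k; [rewrite Nat.add_0_r; lra |].
  rewrite Nat.add_succ_r; eapply Rle_trans; [apply Hb | apply IHk]. }
assert (H : forall n m, a n <= b m).
{ intros n m; apply Rle_trans with (a (n + m)%nat); [apply Ha' |].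
  eapply Rle_trans; [apply Hab |]; rewrite Nat.add_comm; apply Hb'. }
destruct (completeness (fun x => exists n, x = a n)) as [x [Hx1 Hx2]].
- exists (b 0%nat); intros x [n ->]; apply H.
- exists (a 0%nat), 0%nat; easy.
- exists x; intros n; split; [apply Hx1; now exists n |].
  apply Hx2; intros y [m ->]; apply H.
Qed.

(** Cousin's lemma for repeated quadrisection: a property of tiles that passes
    from the four quarters to the whole, and holds for all tiles that are small
    compared with one of their points, holds for every tile. *)
Lemma cousin_tiles (P : R -> R -> R -> Prop) x0 y0 s0 :
  0 < s0 ->
  (forall x y s, 0 < s -> P x y (s / 2) -> P (x + s / 2) y (s / 2) ->
     P x (y + 2 * s) (s / 2) -> P (x + s / 2) (y + 2 * s) (s / 2) -> P x y s) ->
  (forall x y, in_tile x0 y0 s0 x y -> exists delta, 0 < delta /\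
     forall x' y' s, 0 < s <= delta -> in_tile x' y' s x y -> P x' y' s) ->
  P x0 y0 s0.
Proof.
intros Hs0 Hsub Hfine; apply NNPP; intros Hbad.
set (bad := fun t : R * R * R => 0 < snd t /\ ~ P (fst (fst t)) (snd (fst t)) (snd t)).
set (child := fun t t' : R * R * R =>
  snd t' = snd t / 2 /\
  fst (fst t) <= fst (fst t') <= fst (fst t) + snd t / 2 /\
  snd (fst t) <= snd (fst t') <= snd (fst t) + 2 * snd t).
assert (Hstep : forall t : {t | bad t}, {t' : {t | bad t} | child (proj1_sig t) (proj1_sig t')}).
{ intros [[[x y] s] Ht]; apply constructive_indefinite_description.
  destruct Ht as [Hs Hn]; simpl in Hs, Hn.
  assert (E : exists x' y', x <= x' <= x + s / 2 /\ y <= y' <= y + 2 * s /\ ~ P x' y' (s / 2)).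
  { apply NNPP; intros HE; apply Hn; apply Hsub; auto; apply NNPP; intros Hq; apply HE;
      [exists x, y | exists (x + s / 2), y | exists x, (y + 2 * s)
      | exists (x + s / 2), (y + 2 * s)]; repeat split; auto; lra. }
  destruct E as (x' & y' & Hx & Hy & Hq).
  assert (Hb : bad (x', y', s / 2)) by (split; simpl; [lra | easy]).
  exists (exist _ (x', y', s / 2) Hb); unfold child; simpl; lra. }
assert (H0 : bad (x0, y0, s0)) by (split; simpl; auto).
set (T := nat_rect (fun _ => {t | bad t}) (exist _ (x0, y0, s0) H0)
            (fun _ t => proj1_sig (Hstep t))).
set (X := fun n => fst (fst (proj1_sig (T n)))).
set (Y := fun n => snd (fst (proj1_sig (T n)))).
set (Sz := fun n => snd (proj1_sig (T n))).
assert (HT : forall n, child (proj1_sig (T n)) (proj1_sig (T (S n)))).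
{ intros n; simpl; apply (proj2_sig (Hstep (T n))). }
assert (Hpos : forall n, 0 < Sz n) by (intros n; apply (proj2_sig (T n))).
assert (HbadT : forall n, ~ P (X n) (Y n) (Sz n)) by (intros n; apply (proj2_sig (T n))).
assert (HSz : forall n, Sz n = s0 / 2 ^ n).
{ induction n as [|n IH]; [simpl; unfold Sz; simpl; field |].
  destruct (HT n) as [E _]; fold (Sz n) (Sz (S n)) in E; rewrite E, IH; simpl; field.
  apply pow_nonzero; lra. }
destruct (nested_common_point X (fun n => X n + Sz n)) as [x Hx].
{ intros n; apply (HT n). }
{ intros n; destruct (HT n) as (E & E1 & _); fold (Sz n) (Sz (S n)) (X n) (X (S n)) in *; lra. }
{ intros n; specialize (Hpos n); lra. }
destruct (nested_common_point Y (fun n => Y n + 4 * Sz n)) as [y Hy].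
{ intros n; apply (HT n). }
{ intros n; destruct (HT n) as (E & _ & E1); fold (Sz n) (Sz (S n)) (Y n) (Y (S n)) in *; lra. }
{ intros n; specialize (Hpos n); lra. }
destruct (Hfine x y) as (delta & Hd & HP).
{ split; [apply (Hx 0%nat) | apply (Hy 0%nat)]. }
destruct (pow_lt_1_zero (/ 2)) with (y := delta / s0) as [N HN].
{ rewrite Rabs_pos_eq; lra. }
{ apply Rdiv_lt_0_compat; lra. }
apply (HbadT N), HP; [split; [apply Hpos |] | split; [apply Hx | apply Hy]].
specialize (HN N (Nat.le_refl _)).
rewrite HSz; rewrite Rabs_pos_eq in HN by (apply pow_le; lra).
rewrite pow_inv in HN.
apply Rmult_lt_compat_r with (r := s0) in HN; [|lra].
replace (delta / s0 * s0) with delta in HN by (field; lra).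
unfold Rdiv; lra.
Qed.

(** * The length-area argument *)

(** [h] is round at a point when the images of small tiles around it are round
    up to a fixed factor: each contains a disc, and lies in the disc with the
    same centre and 60 times the radius. This is all that the length-area
    argument needs from conformality. The tile need not be centred at the
    point, so that the gauge tilings above can be used. *)
Definition round_at (h : R -> R -> C) (x y : R) : Prop :=
  forall eta, 0 < eta -> exists delta, 0 < delta /\
    forall x0 y0 s, 0 < s <= delta -> in_tile x0 y0 s x y ->
    exists (w : C) (r : R), 0 < r <= eta /\
      (forall x' y', in_tile x0 y0 s x' y' -> Cmod (h x' y' - w) <= 60 * r) /\
      (forall u, Cmod (u - w) < r ->
         exists x' y', x0 < x' < x0 + s /\ y0 < y' < y0 + 4 * s /\ h x' y' = u).

Record cell : Type := Cell { cx : R; cy : R; cs : R; cw : C; cr : R }.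

Definition iind (x0 y0 s x y : R) : R :=
  if Rlt_dec x0 x then if Rlt_dec x (x0 + s) then
  if Rlt_dec y0 y then if Rlt_dec y (y0 + 4 * s) then 1 else 0 else 0 else 0 else 0.

(** The invariant carried through the subdivision. The second clause is
    disjointness of the cells, in the form that survives concatenation of lists;
    the last one bounds the oscillation of [psi] along a vertical segment by the
    contributions of the cells that it crosses, and is what gets integrated over
    [x] in the length-area argument. *)
Definition tiling (h : R -> R -> C) (psi : C -> R) (o : C -> R -> R) (eta : R)
    (x0 y0 s : R) (l : list cell) : Prop :=
  (forall c, In c l -> 0 < cr c <= eta /\ x0 <= cx c /\ cx c + cs c <= x0 + s /\ 0 < cs c /\
     forall u, Cmod (u - cw c) < cr c ->
       exists x y, x0 < x < x0 + s /\ y0 < y < y0 + 4 * s /\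
                   iind (cx c) (cy c) (cs c) x y = 1 /\ h x y = u) /\
  (forall x y, lsum (fun c => iind (cx c) (cy c) (cs c) x y) l <= iind x0 y0 s x y) /\
  lsum (fun c => cs c ^ 2) l = s ^ 2 /\
  (forall x y y', x0 <= x <= x0 + s -> y0 <= y <= y0 + 4 * s -> y0 <= y' <= y0 + 4 * s ->
     Rabs (psi (h x y) - psi (h x y')) <=
     lsum (fun c => o (cw c) (cr c) * ind (cx c) (cx c + cs c) x) l).

Lemma iind_bounds x0 y0 s x y : 0 <= iind x0 y0 s x y <= 1.
Proof. unfold iind; repeat destruct (Rlt_dec _ _); lra. Qed.

Lemma iind_quarters x0 y0 s x y : 0 < s ->
  iind x0 y0 (s / 2) x y + (iind (x0 + s / 2) y0 (s / 2) x y +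
  (iind x0 (y0 + 2 * s) (s / 2) x y + iind (x0 + s / 2) (y0 + 2 * s) (s / 2) x y))
  <= iind x0 y0 s x y.
Proof. intros; unfold iind; repeat destruct (Rlt_dec _ _); lra. Qed.

Lemma tiling_quarters h psi o eta x0 y0 s l1 l2 l3 l4 :
  0 < s -> (forall w r, 0 < r <= eta -> 0 <= o w r) ->
  tiling h psi o eta x0 y0 (s / 2) l1 ->
  tiling h psi o eta (x0 + s / 2) y0 (s / 2) l2 ->
  tiling h psi o eta x0 (y0 + 2 * s) (s / 2) l3 ->
  tiling h psi o eta (x0 + s / 2) (y0 + 2 * s) (s / 2) l4 ->
  tiling h psi o eta x0 y0 s (l1 ++ l2 ++ l3 ++ l4).
Proof.
intros Hs Ho (A1 & B1 & C1 & D1) (A2 & B2 & C2 & D2) (A3 & B3 & C3 & D3) (A4 & B4 & C4 & D4).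
split; [| split; [| split]].
- intros c H; rewrite !in_app_iff in H.
  destruct H as [H | [H | [H | H]]];
  [apply A1 in H | apply A2 in H | apply A3 in H | apply A4 in H];
  destruct H as ((H1 & H2) & H3 & H4 & H5 & H6);
  (do 4 (split; [lra |]));
  intros u Hu; destruct (H6 u Hu) as (x & y & Hx & Hy & Hi & E);
  exists x, y; repeat split; auto; lra.
- intros x y; rewrite !lsum_app; eapply Rle_trans; [| now apply iind_quarters].
  repeat apply Rplus_le_compat; auto.
- rewrite !lsum_app, C1, C2, C3, C4; field.
- assert (N : forall x l, (forall c, In c l -> 0 < cr c <= eta) ->
    0 <= lsum (fun c => o (cw c) (cr c) * ind (cx c) (cx c + cs c) x) l).
  { intros x l Hl; apply lsum_nonneg; intros c Hc; apply Rmult_le_pos;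
      [now apply Ho, Hl | apply ind_bounds]. }
  assert (P1 : forall x, 0 <= lsum (fun c => o (cw c) (cr c) * ind (cx c) (cx c + cs c) x) l1)
    by (intros; apply N; intros; now apply A1).
  assert (P2 : forall x, 0 <= lsum (fun c => o (cw c) (cr c) * ind (cx c) (cx c + cs c) x) l2)
    by (intros; apply N; intros; now apply A2).
  assert (P3 : forall x, 0 <= lsum (fun c => o (cw c) (cr c) * ind (cx c) (cx c + cs c) x) l3)
    by (intros; apply N; intros; now apply A3).
  assert (P4 : forall x, 0 <= lsum (fun c => o (cw c) (cr c) * ind (cx c) (cx c + cs c) x) l4)
    by (intros; apply N; intros; now apply A4).
  intros x.
  (* Each half of the column over x is crossed by cells of one quarter. *)
  assert (Lo : forall y y', x0 <= x <= x0 + s ->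
     y0 <= y <= y0 + 2 * s -> y0 <= y' <= y0 + 2 * s ->
     Rabs (psi (h x y) - psi (h x y')) <=
     lsum (fun c => o (cw c) (cr c) * ind (cx c) (cx c + cs c) x) l1 +
     lsum (fun c => o (cw c) (cr c) * ind (cx c) (cx c + cs c) x) l2).
  { intros y y' Hx Hy Hy'; specialize (P1 x); specialize (P2 x).
    destruct (Rle_dec x (x0 + s / 2)).
    - specialize (D1 x y y' ltac:(lra) ltac:(lra) ltac:(lra)); lra.
    - specialize (D2 x y y' ltac:(lra) ltac:(lra) ltac:(lra)); lra. }
  assert (Hi : forall y y', x0 <= x <= x0 + s ->
     y0 + 2 * s <= y <= y0 + 4 * s -> y0 + 2 * s <= y' <= y0 + 4 * s ->
     Rabs (psi (h x y) - psi (h x y')) <=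
     lsum (fun c => o (cw c) (cr c) * ind (cx c) (cx c + cs c) x) l3 +
     lsum (fun c => o (cw c) (cr c) * ind (cx c) (cx c + cs c) x) l4).
  { intros y y' Hx Hy Hy'; specialize (P3 x); specialize (P4 x).
    destruct (Rle_dec x (x0 + s / 2)).
    - specialize (D3 x y y' ltac:(lra) ltac:(lra) ltac:(lra)); lra.
    - specialize (D4 x y y' ltac:(lra) ltac:(lra) ltac:(lra)); lra. }
  assert (W : forall y y', x0 <= x <= x0 + s ->
     y0 <= y <= y0 + 4 * s -> y0 <= y' <= y0 + 4 * s -> y <= y' ->
     Rabs (psi (h x y) - psi (h x y')) <=
     lsum (fun c => o (cw c) (cr c) * ind (cx c) (cx c + cs c) x) (l1 ++ l2 ++ l3 ++ l4)).
  { intros y y' Hx Hy Hy' Hle; rewrite !lsum_app.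
    specialize (P1 x); specialize (P2 x); specialize (P3 x); specialize (P4 x).
    destruct (Rle_dec y' (y0 + 2 * s)).
    { specialize (Lo y y' Hx ltac:(lra) ltac:(lra)); lra. }
    destruct (Rle_dec (y0 + 2 * s) y).
    { specialize (Hi y y' Hx ltac:(lra) ltac:(lra)); lra. }
    specialize (Lo y (y0 + 2 * s) Hx ltac:(lra) ltac:(lra)).
    specialize (Hi (y0 + 2 * s) y' Hx ltac:(lra) ltac:(lra)).
    pose proof (Rabs_triang (psi (h x y) - psi (h x (y0 + 2 * s)))
                            (psi (h x (y0 + 2 * s)) - psi (h x y'))) as Tr.
    replace (psi (h x y) - psi (h x (y0 + 2 * s)) + (psi (h x (y0 + 2 * s)) - psi (h x y')))
      with (psi (h x y) - psi (h x y')) in Tr by ring. lra. }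
  intros y y' Hx Hy Hy'; destruct (Rle_dec y y'); [now apply W |].
  rewrite Rabs_minus_sym; apply W; auto; lra.
Qed.

Lemma tiling_exists h psi o eta x0 y0 s :
  0 < s -> 0 < eta ->
  (forall w r, 0 < r <= eta -> 0 <= o w r /\
     forall u u', Cmod (u - w) <= 60 * r -> Cmod (u' - w) <= 60 * r ->
       Rabs (psi u - psi u') <= o w r) ->
  (forall x y, in_tile x0 y0 s x y -> round_at h x y) ->
  exists l, tiling h psi o eta x0 y0 s l.
Proof.
intros Hs Heta Ho Hround.
apply (cousin_tiles (fun x0 y0 s => exists l, tiling h psi o eta x0 y0 s l)); auto.
- intros x y s' Hs' [l1 H1] [l2 H2] [l3 H3] [l4 H4].
  exists (l1 ++ l2 ++ l3 ++ l4); apply tiling_quarters; auto; intros; now apply Ho.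
- intros x y Hxy; destruct (Hround x y Hxy eta Heta) as (delta & Hd & Hdelta).
  exists delta; split; [easy |]; intros x' y' s' Hs' Hin.
  destruct (Hdelta x' y' s' Hs' Hin) as (w & r & Hr & Hout & Hinn).
  exists [Cell x' y' s' w r]; split; [| split; [| split]]; simpl.
  + intros c [<- | []]; simpl; (do 4 (split; [lra |])).
    intros u Hu; destruct (Hinn u Hu) as (a & b & Ha & Hb & E).
    exists a, b; repeat split; auto; try lra.
    unfold iind; repeat destruct (Rlt_dec _ _); lra.
  + intros; lra.
  + ring.
  + intros a b b' Ha Hb Hb'; rewrite ind_in, Rmult_1_r, Rplus_0_r by lra.
    apply Ho; auto; apply Hout; split; auto.
Qed.

(** Length-area: if [psi] oscillated by [1/4] on every vertical segment of the
    tile, the cells would satisfy [s / 4 <= sum of side * osc], which by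
    Cauchy-Schwarz is at most [s * sqrt (1 / 32)]. *)
Lemma vertical_line_small_osc h psi x0 y0 s :
  0 < s -> small_energy psi (1 / 32) ->
  (forall x y, in_tile x0 y0 s x y -> round_at h x y) ->
  (forall x y x' y', in_tile x0 y0 s x y -> in_tile x0 y0 s x' y' ->
     h x y = h x' y' -> x = x' /\ y = y') ->
  exists x, x0 <= x <= x0 + s /\ forall y y',
    y0 <= y <= y0 + 4 * s -> y0 <= y' <= y0 + 4 * s ->
    Rabs (psi (h x y) - psi (h x y')) <= 1 / 4.
Proof.
intros Hs (eta & Heta & o & Ho & Hen) Hround Hinj.
destruct (tiling_exists h psi o eta x0 y0 s) as (l & Hl & Hi & Har & Hosc); auto.
assert (Hdisj : disjoint_discs cw cr l).
{ intros u.
  destruct (classic (exists x y, in_tile x0 y0 s x y /\ h x y = u)) as [(x & y & Hin & E) | Hno].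
  - eapply Rle_trans; [| apply Rle_trans with (1 := Hi x y); apply iind_bounds].
    apply lsum_le; intros c Hc.
    destruct (Rlt_dec _ _) as [Hu |]; [| apply iind_bounds].
    destruct (Hl c Hc) as (_ & _ & _ & _ & K); destruct (K u Hu) as (x' & y' & Hx & Hy & I1 & E').
    destruct (Hinj x y x' y') as [-> ->]; auto; [split; lra | congruence | rewrite I1; lra].
  - apply Rle_trans with (lsum (fun _ : cell => 0 * 0) l); [| rewrite lsum_scal; lra].
    apply lsum_le; intros c Hc; destruct (Rlt_dec _ _) as [Hu |]; [|lra].
    destruct (Hl c Hc) as (_ & _ & _ & _ & K); destruct (K u Hu) as (x' & y' & Hx & Hy & I1 & E').
    exfalso; apply Hno; exists x', y'; split; auto; split; lra. }
specialize (Hen cell cw cr l (fun c Hc => proj1 (Hl c Hc)) Hdisj).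
apply NNPP; intros Hno.
assert (Hbig : forall x, x0 <= x <= x0 + s ->
   1 / 4 <= lsum (fun c => o (cw c) (cr c) * ind (cx c) (cx c + cs c) x) l).
{ intros x Hx; apply Rnot_lt_le; intros Hlt; apply Hno; exists x; split; [easy |].
  intros y y' Hy Hy'; specialize (Hosc x y y' Hx Hy Hy'); lra. }
assert (Hint : s * (1 / 4) <= lsum (fun c => o (cw c) (cr c) * cs c) l).
{ replace (s * (1 / 4)) with (scal ((x0 + s) - x0) (1 / 4))
    by (unfold scal; simpl; unfold mult; simpl; field).
  apply (is_RInt_le (fun _ => 1 / 4)
    (fun x => lsum (fun c => o (cw c) (cr c) * ind (cx c) (cx c + cs c) x) l) x0 (x0 + s));
    [lra | apply @is_RInt_const | | intros; apply Hbig; lra].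
  apply is_RInt_lsum; intros c Hc; destruct (Hl c Hc) as (_ & H1 & H2 & H3 & _).
  replace (o (cw c) (cr c) * cs c)
    with (scal (o (cw c) (cr c)) ((cx c + cs c) - cx c))
    by (unfold scal; simpl; unfold mult; simpl; ring).
  apply @is_RInt_scal, is_RInt_ind; lra. }
assert (Hcs : lsum (fun c => o (cw c) (cr c) * cs c) l <=
              2 * s * lsum (fun c => o (cw c) (cr c) ^ 2) l + / (8 * s) * lsum (fun c => cs c ^ 2) l).
{ rewrite <- !lsum_scal, <- lsum_plus; apply lsum_le; intros c _.
  apply Rminus_le_0.
  replace (2 * s * o (cw c) (cr c) ^ 2 + / (8 * s) * cs c ^ 2 - o (cw c) (cr c) * cs c)
    with (/ (8 * s) * (4 * s * o (cw c) (cr c) - cs c) ^ 2) by (field; lra).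
  apply Rmult_le_pos; [apply Rlt_le, Rinv_0_lt_compat; lra | apply pow2_ge_0]. }
rewrite Har in Hcs.
replace (/ (8 * s) * s ^ 2) with (s / 8) in Hcs by (field; lra).
nra.
Qed.

(** * Conformal maps onto the region above a graph *)

Definition has_cderiv (g : C -> C) (z l : C) : Prop :=
  forall e, 0 < e -> exists d, 0 < d /\ forall z', Cmod (z' - z) < d ->
    Cmod (g z' - g z - l * (z' - z)) <= e * Cmod (z' - z).

Lemma ex_derive_has_cderiv (g : C -> C) (z : C) :
  @ex_derive C_AbsRing C_NormedModule g z -> exists l, has_cderiv g z l.
Proof.
intros [l [_ Hl]]; exists l; intros e He.
specialize (Hl z (fun P HP => HP) (mkposreal e He)).
destruct Hl as [d Hd]; exists d; split; [apply cond_pos |].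
intros z' Hz'; specialize (Hd z' Hz').
change (Cmod (g z' - g z - (z' - z) * l) <= e * Cmod (z' - z)) in Hd.
now rewrite (Cmult_comm l).
Qed.

Definition ccont (g : C -> C) (z : C) : Prop :=
  forall e, 0 < e -> exists d, 0 < d /\ forall z', Cmod (z' - z) < d -> Cmod (g z' - g z) < e.

Lemma has_cderiv_bound g z l : has_cderiv g z l ->
  forall k, Cmod l < k -> exists d, 0 < d /\ forall z', Cmod (z' - z) < d ->
    Cmod (g z' - g z) <= k * Cmod (z' - z).
Proof.
intros H k Hk; destruct (H (k - Cmod l)) as (d & Hd & Hd'); [lra |].
exists d; split; [easy |]; intros z' Hz'.
replace (g z' - g z)%C with ((g z' - g z - l * (z' - z)) + l * (z' - z))%C by ring.
eapply Rle_trans; [apply Cmod_triangle |].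
specialize (Hd' z' Hz'); rewrite Cmod_mult; lra.
Qed.

Lemma has_cderiv_ccont g z l : has_cderiv g z l -> ccont g z.
Proof.
intros H e He.
assert (Hl := Cmod_ge_0 l).
destruct (has_cderiv_bound g z l H (Cmod l + 1)) as (d & Hd & Hb); [lra |].
assert (Hq : 0 < e / (Cmod l + 1)) by (apply Rdiv_lt_0_compat; lra).
exists (Rmin d (e / (Cmod l + 1))); split; [now apply Rmin_pos |].
intros z' Hz'.
assert (Cmod (z' - z) < d) as H1 by (eapply Rlt_le_trans; [apply Hz' | apply Rmin_l]).
assert (Cmod (z' - z) < e / (Cmod l + 1)) as H2 by (eapply Rlt_le_trans; [apply Hz' | apply Rmin_r]).
specialize (Hb z' H1).
apply Rmult_lt_compat_l with (r := Cmod l + 1) in H2; [|lra].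
replace ((Cmod l + 1) * (e / (Cmod l + 1))) with e in H2 by (field; lra). lra.
Qed.

(** The inverse [H] is part of the data, and both maps are differentiable at
    each point without any local uniformity. The derivative of [H] is what shows
    that images of small squares contain discs; the gauge tilings cope with the
    absence of uniformity. *)
Record graph_map (f : R -> R) (G H : C -> C) : Prop := {
  gm_G : forall z, 0 < snd z -> f (fst (G z)) < snd (G z);
  gm_H : forall w, f (fst w) < snd w -> 0 < snd (H w);
  gm_HG : forall z, 0 < snd z -> H (G z) = z;
  gm_GH : forall w, f (fst w) < snd w -> G (H w) = w;
  gm_dG : forall z, 0 < snd z -> exists l, has_cderiv G z l;
  gm_dH : forall w, f (fst w) < snd w -> exists l, has_cderiv H w l;
  gm_cont : forall x e, 0 < e -> exists d, 0 < d /\ forall y, Rabs (y - x) < d -> Rabs (f y - f x) < e;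
  gm_inf : forall K, exists N, forall z, 0 < snd z -> N < Cmod z -> K < Cmod (G z) }.

Lemma region_above_open f :
  (forall x e, 0 < e -> exists d, 0 < d /\ forall y, Rabs (y - x) < d -> Rabs (f y - f x) < e) ->
  forall w : C, f (fst w) < snd w -> exists d, 0 < d /\ forall w', Cmod (w' - w) < d -> f (fst w') < snd w'.
Proof.
intros Hf w Hw; destruct (Hf (fst w) ((snd w - f (fst w)) / 2)) as (d & Hd & Hd'); [lra |].
exists (Rmin d ((snd w - f (fst w)) / 2)); split; [apply Rmin_pos; lra |].
intros w' Hw'.
pose proof (Re_le_Cmod (w' - w)) as H1; pose proof (Im_le_Cmod (w' - w)) as H2.
pose proof (Rmin_l d ((snd w - f (fst w)) / 2)); pose proof (Rmin_r d ((snd w - f (fst w)) / 2)).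
simpl in H1, H2.
assert (Rabs (f (fst w') - f (fst w)) < (snd w - f (fst w)) / 2) as H3.
{ apply Hd'; unfold Rminus; lra. }
apply Rabs_lt_between in H3.
assert (Rabs (snd w' + - snd w) < (snd w - f (fst w)) / 2) as H4 by lra.
apply Rabs_lt_between in H4; lra.
Qed.

(** The chain rule for [H (G z) = z], tested on a small real increment. *)
Lemma inverse_derivatives (G H : C -> C) z l l' :
  (exists d, 0 < d /\ forall z', Cmod (z' - z) < d -> H (G z') = z') ->
  has_cderiv G z l -> has_cderiv H (G z) l' -> (l' * l)%C = 1%C.
Proof.
intros (d0 & Hd0 & Hinv) HG HH.
enough (Cmod (1 - l' * l) <= 0) as E.
{ assert (Cmod (1 - l' * l) = 0) as E0 by (apply Rle_antisym; [easy | apply Cmod_ge_0]).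
  apply Cmod_eq_0 in E0. replace (l' * l)%C with (1 - (1 - l' * l))%C by ring.
  rewrite E0; ring. }
apply Rnot_lt_le; intros Hpos.
set (eps := Cmod (1 - l' * l)) in *.
assert (P1 := Cmod_ge_0 l); assert (P2 := Cmod_ge_0 l').
set (e1 := eps / (4 * (Cmod l' + 1))).
set (e2 := eps / (4 * (Cmod l + 1))).
assert (He1 : 0 < e1) by (apply Rdiv_lt_0_compat; lra).
assert (He2 : 0 < e2) by (apply Rdiv_lt_0_compat; lra).
destruct (HG e1 He1) as (d1 & Hd1 & H1).
destruct (HH e2 He2) as (d2 & Hd2 & H2).
destruct (has_cderiv_bound G z l HG (Cmod l + 1)) as (d3 & Hd3 & H3); [lra |].
destruct (has_cderiv_ccont G z l HG d2 Hd2) as (d4 & Hd4 & H4).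
set (t := Rmin (Rmin d0 d1) (Rmin d3 d4) / 2).
assert (Ht : 0 < t /\ t < d0 /\ t < d1 /\ t < d3 /\ t < d4).
{ unfold t, Rmin; repeat destruct (Rle_dec _ _); lra. }
set (z' := (z + RtoC t)%C).
assert (Ez : (z' - z = RtoC t)%C) by (unfold z'; ring).
assert (Et : Cmod (z' - z) = t) by (rewrite Ez, Cmod_R; apply Rabs_pos_eq; lra).
specialize (H1 z' ltac:(lra)); specialize (H3 z' ltac:(lra)); specialize (H4 z' ltac:(lra)).
specialize (H2 (G z') H4); rewrite (Hinv z') in H2 by lra.
rewrite (Hinv z) in H2.
2: { replace (z - z)%C with (RtoC 0) by ring; rewrite Cmod_0; lra. }
rewrite Et in *; rewrite Ez in *.
assert (E : ((1 - l' * l) * RtoC t =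
  (RtoC t - l' * (G z' - G z)) + l' * (G z' - G z - l * RtoC t))%C) by ring.
apply (f_equal Cmod) in E; rewrite Cmod_mult, Cmod_R, (Rabs_pos_eq t) in E by lra.
pose proof (Cmod_triangle (RtoC t - l' * (G z' - G z)) (l' * (G z' - G z - l * RtoC t))) as T.
rewrite <- E, Cmod_mult in T; fold eps in T.
assert (Cmod l' * e1 <= eps / 4).
{ unfold e1; replace (eps / 4) with ((Cmod l' + 1) * (eps / (4 * (Cmod l' + 1)))) by (field; lra).
  apply Rmult_le_compat_r; [fold e1 |]; lra. }
assert (Q2 : e2 * (Cmod l + 1) = eps / 4) by (unfold e2; field; lra).
assert (Cmod (RtoC t - l' * (G z' - G z)) <= eps / 4 * t).
{ eapply Rle_trans; [apply H2 |].
  apply Rle_trans with (e2 * ((Cmod l + 1) * t)); [apply Rmult_le_compat_l; lra |].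
  right; rewrite <- Rmult_assoc, Q2; ring. }
assert (Cmod l' * Cmod (G z' - G z - l * RtoC t) <= eps / 4 * t).
{ apply Rle_trans with (Cmod l' * (e1 * t)); [apply Rmult_le_compat_l; lra |].
  rewrite <- Rmult_assoc; apply Rmult_le_compat_r; lra. }
nra.
Qed.

Lemma graph_map_round_core f G H : graph_map f G H ->
  forall z : C, 0 < snd z -> forall eta, 0 < eta -> exists delta, 0 < delta /\
  forall (c : C) s, 0 < s <= delta -> Cmod (c - z) <= 5 / 2 * s ->
  exists (w : C) r, 0 < r <= eta /\
    (forall z', Cmod (z' - z) <= 5 * s -> Cmod (G z' - w) <= 60 * r) /\
    (forall u, Cmod (u - w) < r -> Cmod (H u - c) < s / 2 /\ G (H u) = u).
Proof.
intros M z Hz eta Heta.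
assert (Hw := gm_G _ _ _ M z Hz).
destruct (gm_dG _ _ _ M z Hz) as [l Hl].
destruct (gm_dH _ _ _ M (G z) Hw) as [l' Hl'].
assert (Hll : (l' * l)%C = 1%C).
{ apply (inverse_derivatives G H z); auto.
  exists (snd z); split; [easy |]; intros z' Hz'; apply (gm_HG _ _ _ M).
  pose proof (Im_le_Cmod (z' - z)) as I; simpl in I.
  assert (Rabs (snd z' + - snd z) < snd z) as I'%Rabs_lt_between by lra; lra. }
assert (HmM : Cmod l' * Cmod l = 1) by (rewrite <- Cmod_mult, Hll; apply Cmod_1).
assert (Hm : 0 < Cmod l).
{ assert (P := Cmod_ge_0 l). destruct P as [P | P]; [easy |].
  rewrite <- P, Rmult_0_r in HmM; lra. }
set (m := Cmod l) in *.
destruct (has_cderiv_bound G z l Hl (2 * m)) as (d1 & Hd1 & H1); [fold m; lra |].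
destruct (Hl' (/ (22 * m))) as (d2 & Hd2 & H2); [apply Rinv_0_lt_compat; lra |].
destruct (region_above_open f (gm_cont _ _ _ M) (G z) Hw) as (d3 & Hd3 & H3).
set (delta := Rmin (Rmin (d1 / 6) (d2 / (6 * m))) (Rmin (d3 / (6 * m)) (eta / m))).
assert (HA : 0 < d2 / (6 * m)) by (apply Rdiv_lt_0_compat; lra).
assert (HB : 0 < d3 / (6 * m)) by (apply Rdiv_lt_0_compat; lra).
assert (HC : 0 < eta / m) by (apply Rdiv_lt_0_compat; lra).
assert (Hdelta : 0 < delta /\ delta <= d1 / 6 /\ delta <= d2 / (6 * m) /\
                 delta <= d3 / (6 * m) /\ delta <= eta / m).
{ unfold delta, Rmin; repeat destruct (Rle_dec _ _); lra. }
exists delta; split; [easy |]; intros c s [Hs Hsd] Hc.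
assert (S2 : m * s <= d2 / 6).
{ replace (d2 / 6) with (m * (d2 / (6 * m))) by (field; lra). apply Rmult_le_compat_l; lra. }
assert (S3 : m * s <= d3 / 6).
{ replace (d3 / 6) with (m * (d3 / (6 * m))) by (field; lra). apply Rmult_le_compat_l; lra. }
assert (S4 : m * s <= eta).
{ replace eta with (m * (eta / m)) by (field; lra). apply Rmult_le_compat_l; lra. }
assert (ms : 0 < m * s) by (apply Rmult_lt_0_compat; lra).
exists (G z + l * (c - z))%C, (m * s / 4); split; [lra |].
assert (Hlc : Cmod (l * (c - z)) <= 5 / 2 * (m * s)).
{ rewrite Cmod_mult; fold m; nra. }
split.
- intros z' Hz'.
  replace (G z' - (G z + l * (c - z)))%C with ((G z' - G z) + - (l * (c - z)))%C by ring.
  eapply Rle_trans; [apply Cmod_triangle |]; rewrite Cmod_opp.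
  specialize (H1 z' ltac:(lra)). nra.
- intros u Hu.
  assert (Hu1 : Cmod (u - G z) <= 11 / 4 * (m * s)).
  { replace (u - G z)%C with ((u - (G z + l * (c - z))) + l * (c - z))%C by ring.
    eapply Rle_trans; [apply Cmod_triangle | lra]. }
  assert (Hu3 : f (fst u) < snd u) by (apply H3; lra).
  split; [| now apply (gm_GH _ _ _ M)].
  specialize (H2 u ltac:(lra)); rewrite (gm_HG _ _ _ M z Hz) in H2.
  replace (H u - c)%C with ((H u - z - l' * (u - G z)) + l' * (u - (G z + l * (c - z))))%C.
  2: { replace (l' * (u - (G z + l * (c - z))))%C
         with (l' * (u - G z) - (l' * l) * (c - z))%C by ring. rewrite Hll; ring. }
  eapply Rle_lt_trans; [apply Cmod_triangle |]; rewrite (Cmod_mult l').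
  assert (Q : / (22 * m) * (11 / 4 * (m * s)) = s / 8) by (field; lra).
  assert (/ (22 * m) * Cmod (u - G z) <= s / 8).
  { rewrite <- Q; apply Rmult_le_compat_l; [apply Rlt_le, Rinv_0_lt_compat|]; lra. }
  assert (Cmod l' * Cmod (u - (G z + l * (c - z))) <= s / 4).
  { replace (s / 4) with ((Cmod l' * m) * (s / 4)) by (rewrite HmM; ring).
    pose proof (Cmod_ge_0 l'); nra. }
  lra.
Qed.

Lemma graph_map_round f G H : graph_map f G H ->
  forall x y, 0 < y -> round_at (fun x y => G (x, y)) x y.
Proof.
intros M x y Hy eta Heta.
destruct (graph_map_round_core f G H M (x, y) Hy eta Heta) as (delta & Hd & Hdelta).
exists delta; split; [easy |]; intros x0 y0 s Hs [Hx' Hy'].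
destruct (Hdelta (x0 + s / 2, y0 + 2 * s) s Hs) as (w & r & Hr & H1 & H2).
{ eapply Rle_trans; [apply Cmod_le_sum |]; simpl.
  apply Rle_trans with (s / 2 + 2 * s); [|lra].
  apply Rplus_le_compat; apply Rabs_le; lra. }
exists w, r; split; [easy |]; split.
- intros x' y' [Hx1 Hy1]; apply H1.
  eapply Rle_trans; [apply Cmod_le_sum |]; simpl.
  apply Rle_trans with (s + 4 * s); [|lra].
  apply Rplus_le_compat; apply Rabs_le; lra.
- intros u Hu; destruct (H2 u Hu) as [H3 H4].
  pose proof (Re_le_Cmod (H u - (x0 + s / 2, y0 + 2 * s))) as R1.
  pose proof (Im_le_Cmod (H u - (x0 + s / 2, y0 + 2 * s))) as R2.
  simpl in R1, R2.
  assert (Rabs (fst (H u) + - (x0 + s / 2)) < s / 2) as R1'%Rabs_lt_between by lra.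
  assert (Rabs (snd (H u) + - (y0 + 2 * s)) < s / 2) as R2'%Rabs_lt_between by lra.
  exists (fst (H u)), (snd (H u)); rewrite <- surjective_pairing; repeat split; auto; lra.
Qed.

Lemma graph_map_round_swap f G H : graph_map f G H ->
  forall x y, 0 < x -> round_at (fun x y => G (y, x)) x y.
Proof.
intros M x y Hy eta Heta.
destruct (graph_map_round_core f G H M (y, x) Hy eta Heta) as (delta & Hd & Hdelta).
exists delta; split; [easy |]; intros x0 y0 s Hs [Hx' Hy'].
destruct (Hdelta (y0 + 2 * s, x0 + s / 2) s Hs) as (w & r & Hr & H1 & H2).
{ eapply Rle_trans; [apply Cmod_le_sum |]; simpl.
  apply Rle_trans with (2 * s + s / 2); [|lra].
  apply Rplus_le_compat; apply Rabs_le; lra. }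
exists w, r; split; [easy |]; split.
- intros x' y' [Hx1 Hy1]; apply H1.
  eapply Rle_trans; [apply Cmod_le_sum |]; simpl.
  apply Rle_trans with (4 * s + s); [|lra].
  apply Rplus_le_compat; apply Rabs_le; lra.
- intros u Hu; destruct (H2 u Hu) as [H3 H4].
  pose proof (Re_le_Cmod (H u - (y0 + 2 * s, x0 + s / 2))) as R1.
  pose proof (Im_le_Cmod (H u - (y0 + 2 * s, x0 + s / 2))) as R2.
  simpl in R1, R2.
  assert (Rabs (fst (H u) + - (y0 + 2 * s)) < s / 2) as R1'%Rabs_lt_between by lra.
  assert (Rabs (snd (H u) + - (x0 + s / 2)) < s / 2) as R2'%Rabs_lt_between by lra.
  exists (snd (H u)), (fst (H u)); rewrite <- surjective_pairing; repeat split; auto; lra.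
Qed.

Lemma graph_map_injective f G H : graph_map f G H ->
  forall z z', 0 < snd z -> 0 < snd z' -> G z = G z' -> z = z'.
Proof.
intros M z z' Hz Hz' E.
now rewrite <- (gm_HG _ _ _ M z Hz), <- (gm_HG _ _ _ M z' Hz'), E.
Qed.

Lemma graph_map_ccont f G H : graph_map f G H -> forall z, 0 < snd z -> ccont G z.
Proof. intros M z Hz; destruct (gm_dG _ _ _ M z Hz) as [l Hl]; eapply has_cderiv_ccont, Hl. Qed.

Lemma graph_map_ccont_inv f G H : graph_map f G H ->
  forall w, f (fst w) < snd w -> ccont H w.
Proof. intros M w Hw; destruct (gm_dH _ _ _ M w Hw) as [l Hl]; eapply has_cderiv_ccont, Hl. Qed.

Lemma horizontal_line_small_osc f G H psi x0 y0 s : graph_map f G H ->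
  0 < s -> 0 < y0 -> small_energy psi (1 / 32) ->
  exists y, y0 <= y <= y0 + s /\ forall x x',
    x0 <= x <= x0 + 4 * s -> x0 <= x' <= x0 + 4 * s ->
    Rabs (psi (G (x, y)) - psi (G (x', y))) <= 1 / 4.
Proof.
intros M Hs Hy He.
destruct (vertical_line_small_osc (fun x y => G (y, x)) psi y0 x0 s Hs He) as (y & H1 & H2).
- intros x y [Hx _]; apply (graph_map_round_swap f G H M); lra.
- intros x y x' y' [H1 _] [H2 _] E.
  apply (graph_map_injective f G H M) in E; simpl; try lra.
  now injection E.
- exists y; auto.
Qed.

(** Vertical segments that reach the real axis: by compactness of the base, if
    every such segment had large oscillation, then so would their parts above a
    common positive height. *)
Lemma vertical_line_small_osc_boundary f G H psi x0 s : graph_map f G H ->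
  0 < s -> small_energy psi (1 / 32) ->
  (exists L, 0 < L /\ forall u v, Rabs (psi u - psi v) <= L * Cmod (u - v)) ->
  exists x, x0 <= x <= x0 + s /\ forall y y',
    0 < y <= 4 * s -> 0 < y' <= 4 * s ->
    Rabs (psi (G (x, y)) - psi (G (x, y'))) <= 1 / 4.
Proof.
intros M Hs He (L & HL & Hlip); apply NNPP; intros Hno.
assert (Hcont : forall x y, 0 < y -> forall e, 0 < e -> exists d, 0 < d /\
   forall x', Rabs (x' - x) < d -> Rabs (psi (G (x', y)) - psi (G (x, y))) < e).
{ intros x y Hy e He'; destruct (graph_map_ccont f G H M (x, y) Hy (e / L)) as (d & Hd & Hd').
  { apply Rdiv_lt_0_compat; lra. }
  exists d; split; [easy |]; intros x' Hx'; eapply Rle_lt_trans; [apply Hlip |].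
  assert (Cmod ((x', y) - (x, y)) < d) as Hz.
  { replace ((x', y) - (x, y))%C with (RtoC (x' - x))
      by (unfold RtoC, Cminus, Cplus, Copp; simpl; f_equal; ring).
    now rewrite Cmod_R. }
  specialize (Hd' _ Hz); apply Rmult_lt_compat_l with (r := L) in Hd'; [|easy].
  replace (L * (e / L)) with e in Hd' by (field; lra). easy. }
assert (Hgauge : forall x, exists d : posreal, x0 <= x <= x0 + s ->
  forall x', Rabs (x' - x) < d -> exists y y', d <= y <= 4 * s /\ d <= y' <= 4 * s /\
    1 / 4 < Rabs (psi (G (x', y)) - psi (G (x', y')))).
{ intros x; destruct (classic (x0 <= x <= x0 + s)) as [Hx | Hx];
    [| exists (mkposreal 1 Rlt_0_1); easy].
  assert (E : exists y y', 0 < y <= 4 * s /\ 0 < y' <= 4 * s /\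
    1 / 4 < Rabs (psi (G (x, y)) - psi (G (x, y')))).
  { apply NNPP; intros HE; apply Hno; exists x; split; [easy |].
    intros y y' Hy Hy'; apply Rnot_lt_le; intros Hlt; apply HE; exists y, y'; auto. }
  destruct E as (y & y' & Hy & Hy' & HE).
  set (g := (Rabs (psi (G (x, y)) - psi (G (x, y'))) - 1 / 4) / 2).
  destruct (Hcont x y (proj1 Hy) g) as (d1 & Hd1 & C1); [unfold g; lra |].
  destruct (Hcont x y' (proj1 Hy') g) as (d2 & Hd2 & C2); [unfold g; lra |].
  assert (Hd : 0 < Rmin (Rmin d1 d2) (Rmin y y')) by (repeat apply Rmin_pos; lra).
  exists (mkposreal _ Hd); intros _ x' Hx'; simpl in *; exists y, y'.
  assert (B : forall a b c d, Rmin (Rmin a b) (Rmin c d) <= a /\ Rmin (Rmin a b) (Rmin c d) <= b /\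
    Rmin (Rmin a b) (Rmin c d) <= c /\ Rmin (Rmin a b) (Rmin c d) <= d).
  { intros; unfold Rmin; repeat destruct (Rle_dec _ _); lra. }
  destruct (B d1 d2 y y') as (B1 & B2 & B3 & B4).
  split; [lra | split; [lra |]].
  specialize (C1 x' ltac:(lra)); specialize (C2 x' ltac:(lra)).
  unfold g in *; clear -C1 C2.
  unfold Rabs in *; repeat destruct (Rcase_abs _); lra. }
set (delta := fun x => proj1_sig (constructive_indefinite_description _ (Hgauge x))).
assert (Hdelta := fun x => proj2_sig (constructive_indefinite_description _ (Hgauge x))).
change (forall x, x0 <= x <= x0 + s ->
  forall x', Rabs (x' - x) < delta x -> exists y y', delta x <= y <= 4 * s /\
    delta x <= y' <= 4 * s /\ 1 / 4 < Rabs (psi (G (x', y)) - psi (G (x', y')))) in Hdelta.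
destruct (compactness_value_1d x0 (x0 + s) delta) as [eps Heps].
destruct (vertical_line_small_osc (fun x y => G (x, y)) psi x0 eps s Hs He) as (x & Hx & Hosc).
- intros x y [_ Hy]; apply (graph_map_round f G H M); pose proof (cond_pos eps); lra.
- intros x y x' y' [_ H1] [_ H2] E; pose proof (cond_pos eps).
  apply (graph_map_injective f G H M) in E; simpl; try lra.
  now injection E.
- apply (Heps x Hx); intros (t & Ht & Hxt & Het).
  destruct (Hdelta t Ht x Hxt) as (y & y' & Hy & Hy' & Hb).
  pose proof (cond_pos eps).
  specialize (Hosc y y' ltac:(lra) ltac:(lra)); lra.
Qed.

(** * Connecting points above the graph of a Zygmund function *)

Definition rcont (f : R -> R) (x : R) : Prop :=
  forall e, 0 < e -> exists d, 0 < d /\ forall y, Rabs (y - x) < d -> Rabs (f y - f x) < e.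

Lemma rcont_continuity_pt f x : rcont f x -> continuity_pt f x.
Proof.
intros H e He; destruct (H e He) as (d & Hd & Hd').
exists d; split; [easy |]; intros y [_ Hy]; apply Hd', Hy.
Qed.

Lemma continuous_rcont f x : continuous f x -> rcont f x.
Proof.
intros H e He.
destruct (proj1 (filterlim_locally _ _) H (mkposreal e He)) as [d Hd].
exists d; split; [apply cond_pos |]; intros y Hy; apply (Hd y Hy).
Qed.

Lemma rcont_continuous f x : rcont f x -> continuous f x.
Proof.
intros H; apply filterlim_locally; intros e.
destruct (H e (cond_pos e)) as (d & Hd & Hd').
exists (mkposreal d Hd); intros y Hy; apply (Hd' y Hy).
Qed.

Definition zyg (M : R) (f : R -> R) : Prop :=
  (forall x, rcont f x) /\
  forall x h, Rabs (f (x + h) + f (x - h) - 2 * f x) <= M * Rabs h.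

(** A Zygmund function stays close to its chords, at any scale: at a maximum of
    the difference, the second difference that reflects the nearer end point is
    at most minus that maximum. *)
Lemma zyg_below_chord M f a b x : 0 <= M -> zyg M f -> a < b -> a <= x <= b ->
  f x <= f a + (f b - f a) / (b - a) * (x - a) + M * (b - a) / 2.
Proof.
intros HM [Hc Hz] Hab Hx.
set (k := (f b - f a) / (b - a)).
set (g := fun x => f x - (f a + k * (x - a))).
assert (Ha : g a = 0) by (unfold g; ring).
assert (Hb : g b = 0) by (unfold g, k; field; lra).
destruct (continuity_ab_maj g a b) as (c & Hmax & Hcab); [lra | |].
{ intros y _; apply continuity_pt_minus; [now apply rcont_continuity_pt |].
  apply derivable_continuous_pt; reg. }
enough (g c <= M * (b - a) / 2) by (specialize (Hmax x Hx); unfold g in *; lra).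
assert (Hg : forall h, - (M * Rabs h) <= g (c + h) + g (c - h) - 2 * g c).
{ intros h; specialize (Hz c h); apply Rabs_le_between in Hz; unfold g; lra. }
destruct (Rle_dec (g c) 0); [nra |].
(* Reflect the nearer end point in the maximum point c. *)
destruct (Rle_dec (c - a) (b - c)).
- specialize (Hg (c - a)); rewrite Rabs_pos_eq in Hg by lra.
  replace (c - (c - a)) with a in Hg by ring.
  specialize (Hmax (c + (c - a)) ltac:(lra)); nra.
- specialize (Hg (b - c)); rewrite Rabs_pos_eq in Hg by lra.
  replace (c + (b - c)) with b in Hg by ring.
  specialize (Hmax (c - (b - c)) ltac:(lra)); nra.
Qed.

Lemma zyg_opp M f : zyg M f -> zyg M (fun x => - f x).
Proof.
intros [Hc Hz]; split.
- intros x e He; destruct (Hc x e He) as (d & Hd & Hd'); exists d; split; [easy |].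
  intros y Hy; replace (- f y - - f x) with (- (f y - f x)) by ring.
  rewrite Rabs_Ropp; auto.
- intros x h; replace (- f (x + h) + - f (x - h) - 2 * - f x)
    with (- (f (x + h) + f (x - h) - 2 * f x)) by ring.
  rewrite Rabs_Ropp; auto.
Qed.

Lemma zyg_chord M f a b t : 0 <= M -> zyg M f -> 0 <= t <= 1 ->
  Rabs (f ((1 - t) * a + t * b) - ((1 - t) * f a + t * f b)) <= M * Rabs (b - a) / 2.
Proof.
assert (W : forall a b t, 0 <= M -> zyg M f -> 0 <= t <= 1 -> a < b ->
  Rabs (f ((1 - t) * a + t * b) - ((1 - t) * f a + t * f b)) <= M * (b - a) / 2).
{ clear; intros a b t HM Hz Ht Hab.
  assert (Hx : a <= (1 - t) * a + t * b <= b) by nra.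
  pose proof (zyg_below_chord M f a b _ HM Hz Hab Hx) as U.
  pose proof (zyg_below_chord M _ a b _ HM (zyg_opp _ _ Hz) Hab Hx) as L.
  simpl in L.
  replace ((f b - f a) / (b - a) * ((1 - t) * a + t * b - a))
    with (t * (f b - f a)) in U by (field; lra).
  replace ((- f b - - f a) / (b - a) * ((1 - t) * a + t * b - a))
    with (- t * (f b - f a)) in L by (field; lra).
  apply Rabs_le; lra. }
intros HM Hz Ht; destruct (Rtotal_order a b) as [h | [-> | h]].
- rewrite (Rabs_pos_eq (b - a)) by lra; now apply W.
- replace ((1 - t) * b + t * b) with b by ring.
  replace (f b - ((1 - t) * f b + t * f b)) with 0 by ring.
  rewrite Rabs_R0; pose proof (Rabs_pos (b - b)); nra.
- rewrite (Rabs_left (b - a)) by lra.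
  specialize (W b a (1 - t) HM Hz ltac:(lra) ltac:(lra)).
  replace ((1 - (1 - t)) * b + (1 - t) * a) with ((1 - t) * a + t * b) in W by ring.
  replace ((1 - (1 - t)) * f b + (1 - t) * f a) with ((1 - t) * f a + t * f b) in W by ring.
  lra.
Qed.

Lemma zyg_le_max M f a b t : 0 <= M -> zyg M f -> 0 <= t <= 1 ->
  f ((1 - t) * a + t * b) <= Rmax (f a) (f b) + M * Rabs (b - a) / 2.
Proof.
intros HM Hz Ht; pose proof (zyg_chord M f a b t HM Hz Ht) as H%Rabs_le_between.
pose proof (Rmax_l (f a) (f b)); pose proof (Rmax_r (f a) (f b)); nra.
Qed.

Definition ccont_real (q : C -> R) (u : C) : Prop :=
  forall e, 0 < e -> exists d, 0 < d /\ forall v, Cmod (v - u) < d -> Rabs (q v - q u) < e.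

Lemma ccont_real_comp q (g1 g2 : R -> R) t :
  ccont_real q (g1 t, g2 t) -> rcont g1 t -> rcont g2 t -> rcont (fun t => q (g1 t, g2 t)) t.
Proof.
intros Hq C1 C2 e He; destruct (Hq e He) as (d & Hd & Hd').
destruct (C1 (d / 2)) as (d1 & Hd1 & H1); [lra |].
destruct (C2 (d / 2)) as (d2 & Hd2 & H2); [lra |].
exists (Rmin d1 d2); split; [now apply Rmin_pos |]; intros y Hy.
pose proof (Rmin_l d1 d2); pose proof (Rmin_r d1 d2).
apply Hd'; eapply Rle_lt_trans; [apply Cmod_le_sum |]; simpl.
specialize (H1 y ltac:(lra)); specialize (H2 y ltac:(lra)); unfold Rminus in *; lra.
Qed.

(** Connectedness is recorded through its use: functions that change sign have
    zeros. Paths in [D] join their end points by the intermediate value theorem,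
    and transitivity requires no concatenation of paths. *)
Definition joined (D : C -> Prop) (w w' : C) : Prop :=
  forall q : C -> R, (forall u, D u -> ccont_real q u) -> q w * q w' < 0 ->
  exists u, D u /\ q u = 0.

Lemma joined_sym D w w' : joined D w w' -> joined D w' w.
Proof. intros H q Hq Hw; apply H; auto; lra. Qed.

Lemma joined_trans (D : C -> Prop) w w' w'' : D w' ->
  joined D w w' -> joined D w' w'' -> joined D w w''.
Proof.
intros HD H1 H2 q Hq Hw.
destruct (Req_dec (q w') 0) as [E | E]; [now exists w' |].
destruct (Rlt_dec (q w * q w') 0); [now apply H1 |].
apply H2; auto.
apply Rnot_le_lt; intros Hle.
destruct (Rdichotomy _ _ E); destruct (Rlt_dec (q w) 0); destruct (Rlt_dec (q w'') 0); nra.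
Qed.

Lemma joined_path (D : C -> Prop) (g1 g2 : R -> R) a b : a <= b ->
  (forall t, a <= t <= b -> rcont g1 t /\ rcont g2 t /\ D (g1 t, g2 t)) ->
  joined D (g1 a, g2 a) (g1 b, g2 b).
Proof.
intros Hab Hg q Hq Hw.
assert (a < b).
{ destruct Hab as [h | ->]; [easy |]. nra. }
assert (W : forall q : C -> R, (forall u, D u -> ccont_real q u) ->
  q (g1 a, g2 a) < 0 -> 0 < q (g1 b, g2 b) -> exists u, D u /\ q u = 0).
{ clear q Hq Hw; intros q Hq Ha Hb.
  destruct (IVT_interv (fun t => q (g1 t, g2 t)) a b) as (t & Ht & E); auto.
  - intros t Ht; destruct (Hg t Ht) as (C1 & C2 & HD).
    apply rcont_continuity_pt, ccont_real_comp; auto.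
  - exists (g1 t, g2 t); split; [apply Hg, Ht | easy]. }
destruct (Rlt_dec (q (g1 a, g2 a)) 0).
- apply W; auto; nra.
- assert (0 < q (g1 a, g2 a)) by (destruct (Req_dec (q (g1 a, g2 a)) 0) as [E |]; [rewrite E in Hw |]; lra).
  destruct (W (fun u => - q u)) as (u & Hu & E); [| lra | nra |].
  + intros u Hu e He; destruct (Hq u Hu e He) as (d & Hd & Hd').
    exists d; split; auto; intros v Hv.
    replace (- q v - - q u) with (- (q v - q u)) by ring; rewrite Rabs_Ropp; auto.
  + exists u; split; [easy | lra].
Qed.

Lemma rcont_const c t : rcont (fun _ => c) t.
Proof. intros e He; exists 1; split; [lra |]; intros; rewrite Rminus_diag, Rabs_R0; easy. Qed.

Lemma rcont_id t : rcont (fun t => t) t.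
Proof. intros e He; exists e; auto. Qed.

Lemma rcont_plus f g t : rcont f t -> rcont g t -> rcont (fun t => f t + g t) t.
Proof.
intros Hf Hg e He; destruct (Hf (e / 2)) as (d1 & Hd1 & H1); [lra |].
destruct (Hg (e / 2)) as (d2 & Hd2 & H2); [lra |].
exists (Rmin d1 d2); split; [now apply Rmin_pos |]; intros y Hy.
pose proof (Rmin_l d1 d2); pose proof (Rmin_r d1 d2).
specialize (H1 y ltac:(lra)); specialize (H2 y ltac:(lra)).
replace (f y + g y - (f t + g t)) with ((f y - f t) + (g y - g t)) by ring.
eapply Rle_lt_trans; [apply Rabs_triang | lra].
Qed.

Lemma rcont_affine a b t : rcont (fun t => (1 - t) * a + t * b) t.
Proof.
apply continuous_rcont, continuity_pt_filterlim.
apply derivable_continuous_pt; reg.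
Qed.

Lemma joined_segment (D : C -> Prop) x y x' y' :
  (forall t, 0 <= t <= 1 -> D ((1 - t) * x + t * x', (1 - t) * y + t * y')) ->
  joined D (x, y) (x', y').
Proof.
intros H.
pose proof (joined_path D (fun t => (1 - t) * x + t * x')
  (fun t => (1 - t) * y + t * y') 0 1) as P; simpl in P.
replace ((1 - 0) * x + 0 * x') with x in P by ring.
replace ((1 - 0) * y + 0 * y') with y in P by ring.
replace ((1 - 1) * x + 1 * x') with x' in P by ring.
replace ((1 - 1) * y + 1 * y') with y' in P by ring.
apply P; [lra |]; intros t Ht; repeat split; auto; apply rcont_affine.
Qed.

Lemma Cmod_segment (u v p : C) t r : 0 <= t <= 1 ->
  Cmod (u - p) <= r -> Cmod (v - p) <= r ->
  Cmod ((((1 - t) * fst u + t * fst v)%R, ((1 - t) * snd u + t * snd v)%R) - p) <= r.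
Proof.
intros Ht Hu Hv.
replace ((((1 - t) * fst u + t * fst v)%R, ((1 - t) * snd u + t * snd v)%R) - p)%C
  with (RtoC (1 - t) * (u - p) + RtoC t * (v - p))%C.
2: { destruct u, v, p; unfold RtoC, Cminus, Cplus, Copp, Cmult; simpl; f_equal; ring. }
eapply Rle_trans; [apply Cmod_triangle |].
rewrite !Cmod_mult, !Cmod_R, !Rabs_pos_eq by lra; nra.
Qed.

Lemma Cmod_shift_up (u p : C) h : 0 <= h -> Cmod ((fst u, (snd u + h)%R) - p) <= Cmod (u - p) + h.
Proof.
intros Hh.
replace ((fst u, (snd u + h)%R) - p)%C with ((u - p) + (0, h))%C
  by (destruct u, p; unfold Cminus, Cplus, Copp; simpl; f_equal; ring).
eapply Rle_trans; [apply Cmod_triangle |]; apply Rplus_le_compat_l.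
eapply Rle_trans; [apply Cmod_le_sum |]; simpl.
rewrite Rabs_R0, Rabs_pos_eq; lra.
Qed.

(** Go up by the distance from graph to chord, then along a straight segment
    above the chord, then down. *)
Lemma joined_inside M f (w w' p : C) r : 0 <= M -> zyg M f ->
  f (fst w) < snd w -> f (fst w') < snd w' ->
  Cmod (w - p) <= r -> Cmod (w' - p) <= r ->
  joined (fun u => f (fst u) < snd u /\ Cmod (u - p) <= (1 + M) * r) w w'.
Proof.
intros HM Hz Hw Hw' Hr Hr'.
assert (Hr0 : 0 <= r) by (eapply Rle_trans; [apply Cmod_ge_0 | apply Hr]).
set (h := M * r).
assert (Hh : 0 <= h) by (unfold h; nra).
set (D := fun u : C => f (fst u) < snd u /\ Cmod (u - p) <= (1 + M) * r).
assert (Up : forall u : C, f (fst u) < snd u -> Cmod (u - p) <= r ->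
   joined D u (fst u, snd u + h) /\ D (fst u, snd u + h)).
{ intros u Hu Hur.
  assert (E : Cmod ((fst u, (snd u + h)%R) - p) <= (1 + M) * r)
    by (eapply Rle_trans; [now apply Cmod_shift_up | unfold h; lra]).
  split; [| split; simpl; [lra | exact E]].
  rewrite (surjective_pairing u) at 1; apply joined_segment; intros t Ht; split; simpl.
  - replace ((1 - t) * fst u + t * fst u) with (fst u) by ring; nra.
  - apply (Cmod_segment u (fst u, snd u + h)); [easy | unfold h in *; nra | easy]. }
destruct (Up w Hw Hr) as [J1 D1]; destruct (Up w' Hw' Hr') as [J2 D2].
apply joined_trans with (1 := D1); [easy |].
apply joined_trans with (1 := D2); [| now apply joined_sym].
apply joined_segment; intros t Ht; split; simpl.
- pose proof (zyg_chord M f (fst w) (fst w') t HM Hz Ht) as Hc%Rabs_le_between.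
  assert (Rabs (fst w' - fst w) <= 2 * r).
  { pose proof (Cmod_sub_triangle w' p w) as T; rewrite (Cmod_sub_sym p w) in T.
    pose proof (Re_le_Cmod (w' - w)) as Q; simpl in Q.
    unfold Rminus; lra. }
  assert (M * Rabs (fst w' - fst w) / 2 <= h) by (unfold h; nra).
  destruct (Req_dec t 0) as [-> | Ht0]; [nra |].
  nra.
- apply (Cmod_segment (fst w, snd w + h) (fst w', snd w' + h)); [easy | apply D1 | apply D2].
Qed.

Lemma joined_up (D : C -> Prop) (w : C) h : 0 <= h ->
  (forall y, snd w <= y -> D (fst w, y)) -> joined D w (fst w, snd w + h).
Proof.
intros Hh HD; rewrite (surjective_pairing w) at 1; apply joined_segment; intros t Ht.
replace ((1 - t) * fst w + t * fst w) with (fst w) by ring.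
apply HD; nra.
Qed.

(** Outside a disc, one escapes upwards; below the disc, one first moves
    sideways, in the direction in which the graph descends on the scale of the
    disc. *)
Lemma joined_outside_up M f (w p : C) r : 0 <= M -> zyg M f -> 0 < r ->
  f (fst w) < snd w -> (3 * M + 3) * r <= Cmod (w - p) ->
  exists x Y, forall y, Y <= y ->
    joined (fun u => f (fst u) < snd u /\ r < Cmod (u - p)) w (x, y).
Proof.
intros HM Hz Hr Hw Hp.
set (D := fun u : C => f (fst u) < snd u /\ r < Cmod (u - p)).
assert (Away : forall x y, r < Rabs (x - fst p) \/ r < Rabs (y - snd p) -> r < Cmod ((x, y) - p)).
{ intros x y [H | H]; eapply Rlt_le_trans; try exact H;
   [apply (Re_le_Cmod ((x, y) - p)) | apply (Im_le_Cmod ((x, y) - p))]. }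
assert (Ray : forall v : C, f (fst v) < snd v ->
   (forall y, snd v <= y -> r < Cmod ((fst v, y) - p)) ->
   exists Y, forall y, Y <= y -> joined D v (fst v, y)).
{ intros v Hv Ha; exists (snd v); intros y Hy.
  replace y with (snd v + (y - snd v)) by ring; apply joined_up; [lra |].
  intros y' Hy'; split; [simpl; lra | apply Ha, Hy']. }
destruct (Rlt_dec r (Rabs (fst w - fst p))) as [h1 | h1].
{ exists (fst w); apply Ray; auto. }
destruct (Rlt_dec r (snd w - snd p)) as [h2 | h2].
{ exists (fst w); apply Ray; auto; intros y Hy; apply Away; right.
  rewrite Rabs_pos_eq; lra. }
assert (Hlow : snd w <= snd p - (3 * M + 2) * r).
{ pose proof (Cmod_le_sum (w - p)) as T; simpl in T.
  unfold Rminus in h1; apply Rnot_lt_le in h1.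
  assert ((3 * M + 2) * r <= Rabs (snd w + - snd p)) as T' by lra.
  unfold Rabs at 1 in T'; destruct (Rcase_abs _); nra. }
assert (Side : exists s, Rabs s = 3 * r /\ f (fst w + s) <= f (fst w) + 3 / 2 * M * r).
{ pose proof (proj2 Hz (fst w) (3 * r)) as Q%Rabs_le_between.
  rewrite Rabs_pos_eq in Q by lra.
  destruct (Rle_dec (f (fst w + 3 * r)) (f (fst w) + 3 / 2 * M * r)).
  - exists (3 * r); rewrite Rabs_pos_eq; lra.
  - exists (- (3 * r)); rewrite Rabs_Ropp, Rabs_pos_eq by lra; split; [easy |].
    unfold Rminus in Q; lra. }
destruct Side as (s & Hs & Hfs).
set (y1 := snd w + 3 * M * r).
assert (HMr : 0 <= M * r) by nra.
assert (Seg : forall t, 0 <= t <= 1 ->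
  D ((1 - t) * fst w + t * (fst w + s), (1 - t) * y1 + t * y1)).
{ intros t Ht; replace ((1 - t) * y1 + t * y1) with y1 by ring; split; simpl.
  - pose proof (zyg_le_max M f (fst w) (fst w + s) t HM Hz Ht) as Q.
    replace (fst w + s - fst w) with s in Q by ring; rewrite Hs in Q.
    assert (Rmax (f (fst w)) (f (fst w + s)) <= f (fst w) + 3 / 2 * M * r)
      by (apply Rmax_lub; lra).
    unfold y1; lra.
  - apply Away; right; rewrite Rabs_left; unfold y1; lra. }
assert (J1 : joined D w (fst w, y1)).
{ rewrite (surjective_pairing w) at 1; apply joined_segment; intros t Ht; split; simpl.
  - replace ((1 - t) * fst w + t * fst w) with (fst w) by ring; unfold y1; nra.
  - apply Away; right; rewrite Rabs_left; unfold y1; nra. }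
assert (D1 : D (fst w, y1)).
{ specialize (Seg 0 ltac:(lra)).
  replace ((1 - 0) * fst w + 0 * (fst w + s)) with (fst w) in Seg by ring.
  replace ((1 - 0) * y1 + 0 * y1) with y1 in Seg by ring. easy. }
assert (J2 : joined D (fst w, y1) (fst w + s, y1)) by (apply joined_segment, Seg).
assert (D2 : D (fst w + s, y1)).
{ specialize (Seg 1 ltac:(lra)).
  replace ((1 - 1) * fst w + 1 * (fst w + s)) with (fst w + s) in Seg by ring.
  replace ((1 - 1) * y1 + 1 * y1) with y1 in Seg by ring. easy. }
destruct (Ray (fst w + s, y1)) as (Y & HY).
{ apply D2. }
{ intros y _; apply Away; left; simpl.
  apply Rnot_lt_le in h1; unfold Rabs in *; repeat destruct (Rcase_abs _); lra. }
exists (fst w + s), Y; intros y Hy.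
apply joined_trans with (1 := D1); [easy |].
apply joined_trans with (1 := D2); [easy | apply HY, Hy].
Qed.

Lemma joined_outside M f (w w' p : C) r : 0 <= M -> zyg M f -> 0 < r ->
  f (fst w) < snd w -> f (fst w') < snd w' ->
  (3 * M + 3) * r <= Cmod (w - p) -> (3 * M + 3) * r <= Cmod (w' - p) ->
  joined (fun u => f (fst u) < snd u /\ r < Cmod (u - p)) w w'.
Proof.
intros HM Hz Hr Hw Hw' Hp Hp'.
destruct (joined_outside_up M f w p r) as (x & Y & J); auto.
destruct (joined_outside_up M f w' p r) as (x' & Y' & J'); auto.
set (m := Rmax (f x) (f x') + M * Rabs (x' - x) / 2).
set (y := Rmax (Rmax Y Y') (Rmax (m + 1) (snd p + r + 1))).
assert (B : Y <= y /\ Y' <= y /\ m + 1 <= y /\ snd p + r + 1 <= y).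
{ unfold y, Rmax; repeat destruct (Rle_dec _ _); lra. }
assert (Seg : forall t, 0 <= t <= 1 -> (fun u : C => f (fst u) < snd u /\ r < Cmod (u - p))
     ((1 - t) * x + t * x', (1 - t) * y + t * y)).
{ intros t Ht; replace ((1 - t) * y + t * y) with y by ring; split; simpl.
  - pose proof (zyg_le_max M f x x' t HM Hz Ht) as Q; fold m in Q; lra.
  - eapply Rlt_le_trans; [| apply Im_le_Cmod]; simpl; rewrite Rabs_pos_eq; lra. }
apply joined_trans with (x, y); [| apply J; lra |].
- specialize (Seg 0 ltac:(lra)).
  replace ((1 - 0) * x + 0 * x') with x in Seg by ring.
  replace ((1 - 0) * y + 0 * y) with y in Seg by ring. easy.
- apply joined_trans with (x', y); [| | apply joined_sym, J'; lra].
  + specialize (Seg 1 ltac:(lra)).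
    replace ((1 - 1) * x + 1 * x') with x' in Seg by ring.
    replace ((1 - 1) * y + 1 * y) with y in Seg by ring. easy.
  + apply joined_segment, Seg.
Qed.

(** * Crosscuts *)

(** Negative inside the half-strip [a < x < b, y < c], positive outside its
    closure; its zeros in the upper half-plane form a three-sided crosscut. *)
Definition box_fun (a b c : R) (z : C) : R :=
  Rmax (Rmax (a - fst z) (fst z - b)) (snd z - c).

Lemma box_fun_neg a b c z : box_fun a b c z < 0 <-> a < fst z < b /\ snd z < c.
Proof. unfold box_fun, Rmax; repeat destruct (Rle_dec _ _); lra. Qed.

Lemma box_fun_pos a b c z : 0 < box_fun a b c z <-> fst z < a \/ b < fst z \/ c < snd z.
Proof. unfold box_fun, Rmax; repeat destruct (Rle_dec _ _); lra. Qed.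

Lemma box_fun_zero a b c z : box_fun a b c z = 0 <->
  a <= fst z <= b /\ snd z <= c /\ (fst z = a \/ fst z = b \/ snd z = c).
Proof. unfold box_fun, Rmax; repeat destruct (Rle_dec _ _); lra. Qed.

Lemma box_fun_lipschitz a b c z z' : Rabs (box_fun a b c z - box_fun a b c z') <= Cmod (z - z').
Proof.
pose proof (Re_le_Cmod (z - z')) as H1%Rabs_le_between.
pose proof (Im_le_Cmod (z - z')) as H2%Rabs_le_between.
simpl in H1, H2; apply Rabs_le.
unfold box_fun, Rmax; repeat destruct (Rle_dec _ _); lra.
Qed.

Lemma crossing f G H (D : C -> Prop) w w' a b c : graph_map f G H ->
  (forall u, D u -> f (fst u) < snd u) -> joined D w w' ->
  box_fun a b c (H w) < 0 -> 0 < box_fun a b c (H w') ->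
  exists z, 0 < snd z /\ box_fun a b c z = 0 /\ D (G z).
Proof.
intros Gm HD J Hw Hw'.
destruct (J (fun u => box_fun a b c (H u))) as (u & Hu & E).
- intros u Hu e He.
  destruct (graph_map_ccont_inv f G H Gm u (HD u Hu) e He) as (d & Hd & Hd').
  exists d; split; [easy |]; intros v Hv.
  eapply Rle_lt_trans; [apply box_fun_lipschitz | now apply Hd'].
- nra.
- exists (H u); split; [now apply (gm_H _ _ _ Gm), HD | split; [easy |]].
  rewrite (gm_GH _ _ _ Gm) by now apply HD. easy.
Qed.

(** Each of the three sides is chosen by the length-area
    argument, for a cutoff that rises from [0] on the small disc to [1] outside
    the large one. *)
Lemma crosscut : exists Lam, 1 < Lam /\ forall f G H, graph_map f G H ->
  forall t r p R0, 0 < r -> 0 < R0 -> exists r1 r2 r3,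
    r <= r1 <= 2 * r /\ r <= r2 <= 2 * r /\ r <= r3 <= 2 * r /\
    forall z z', 0 < snd z -> 0 < snd z' ->
      box_fun (t - r1) (t + r2) r3 z = 0 -> box_fun (t - r1) (t + r2) r3 z' = 0 ->
      Cmod (G z - p) <= R0 -> Cmod (G z' - p) < Lam * R0.
Proof.
destruct (log_cutoff (1 / 32)) as (Lam & HLam & Hcut); [lra |].
exists Lam; split; [easy |]; intros f G H Gm t r p R0 Hr HR0.
destruct (Hcut p R0 HR0) as (psi & Hin & Hout & Hlip & Hen).
destruct (vertical_line_small_osc_boundary f G H psi (t - 2 * r) r Gm Hr Hen Hlip)
  as (xl & Hxl & Hl).
destruct (vertical_line_small_osc_boundary f G H psi (t + r) r Gm Hr Hen Hlip)
  as (xr & Hxr & Hright).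
destruct (horizontal_line_small_osc f G H psi (t - 2 * r) r r Gm Hr Hr Hen)
  as (yt & Hyt & Ht).
exists (t - xl), (xr - t), yt; repeat split; try lra.
replace (t - (t - xl)) with xl by ring; replace (t + (xr - t)) with xr by ring.
intros z z' Hz Hz' Bz%box_fun_zero Bz'%box_fun_zero Hp.
assert (Near : forall z, 0 < snd z ->
   (xl <= fst z <= xr /\ snd z <= yt /\ (fst z = xl \/ fst z = xr \/ snd z = yt)) ->
   Rabs (psi (G z) - psi (G (xl, yt))) <= 1 / 4 \/
   Rabs (psi (G z) - psi (G (xr, yt))) <= 1 / 4).
{ intros [x y] Hy (Bx & By & [E | [E | E]]); simpl in *; subst.
  - left; apply Hl; lra.
  - right; apply Hright; lra.
  - left; apply Ht; lra. }
apply Rnot_le_lt; intros Hfar.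
specialize (Ht xl xr ltac:(lra) ltac:(lra)).
pose proof (Near z Hz Bz) as N1; pose proof (Near z' Hz' Bz') as N2.
rewrite (Hin _ Hp) in N1; rewrite (Hout _ Hfar) in N2.
revert Ht N1 N2; clear; intros Ht N1 N2.
apply Rabs_le_between in Ht.
destruct N1 as [N1%Rabs_le_between | N1%Rabs_le_between];
destruct N2 as [N2%Rabs_le_between | N2%Rabs_le_between]; lra.
Qed.

Lemma box_image_inside M f G H p r a b c : 0 <= M -> zyg M f -> graph_map f G H -> 0 < r ->
  (forall z, 0 < snd z -> box_fun a b c z = 0 -> Cmod (G z - p) <= r) ->
  forall z, 0 < snd z -> box_fun a b c z < 0 -> Cmod (G z - p) < (3 * M + 3) * r.
Proof.
intros HM Hz Gm Hr Hbox z Hz0 Hzb; apply Rnot_le_lt; intros Hfar.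
destruct (gm_inf _ _ _ Gm ((3 * M + 3) * r + Cmod p)) as [N HN].
set (y := Rmax (Rmax N c) 0 + 1).
assert (Hy : N < y /\ c < y /\ 0 < y) by (unfold y, Rmax; repeat destruct (Rle_dec _ _); lra).
set (z1 := (0, y) : C).
assert (Hz1 : 0 < snd z1) by (simpl; lra).
assert (Hfar1 : (3 * M + 3) * r <= Cmod (G z1 - p)).
{ specialize (HN z1 Hz1).
  pose proof (Im_le_Cmod z1) as I; simpl in I; rewrite Rabs_pos_eq in I by lra.
  pose proof (Cmod_triangle (G z1 - p) p) as T.
  replace (G z1 - p + p)%C with (G z1) in T by ring. specialize (HN ltac:(lra)); lra. }
pose proof (joined_outside M f (G z) (G z1) p r HM Hz Hr
  (gm_G _ _ _ Gm z Hz0) (gm_G _ _ _ Gm z1 Hz1) Hfar Hfar1) as J.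
destruct (crossing f G H _ _ _ a b c Gm (fun u Hu => proj1 Hu) J) as (z2 & Hz2 & B2 & D2).
- now rewrite (gm_HG _ _ _ Gm).
- rewrite (gm_HG _ _ _ Gm) by easy; apply box_fun_pos; simpl; lra.
- specialize (Hbox z2 Hz2 B2); lra.
Qed.

Lemma box_image_outside M f G H p r a b c : 0 <= M -> zyg M f -> graph_map f G H -> 0 < r ->
  (forall z, 0 < snd z -> box_fun a b c z = 0 -> r < Cmod (G z - p)) ->
  forall z z', 0 < snd z -> 0 < snd z' ->
    Cmod (G z - p) <= r / (1 + M) -> Cmod (G z' - p) <= r / (1 + M) ->
    box_fun a b c z < 0 -> 0 < box_fun a b c z' -> False.
Proof.
intros HM Hz Gm Hr Hbox z z' Hz0 Hz0' Hn Hn' Hb Hb'.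
pose proof (joined_inside M f (G z) (G z') p (r / (1 + M)) HM Hz
  (gm_G _ _ _ Gm z Hz0) (gm_G _ _ _ Gm z' Hz0') Hn Hn') as J.
replace ((1 + M) * (r / (1 + M))) with r in J by (field; lra).
destruct (crossing f G H _ _ _ a b c Gm (fun u Hu => proj1 Hu) J) as (z2 & Hz2 & B2 & _ & D2).
- now rewrite (gm_HG _ _ _ Gm).
- now rewrite (gm_HG _ _ _ Gm).
- specialize (Hbox z2 Hz2 B2); lra.
Qed.

(** * Boundary values *)

Lemma graph_map_vertical_cont f G H p x y : graph_map f G H -> 0 < y ->
  rcont (fun y => Cmod (G (x, y) - p)) y.
Proof.
intros Gm Hy e He; destruct (graph_map_ccont f G H Gm (x, y) Hy e He) as (d & Hd & Hd').
exists d; split; [easy |]; intros y' Hy'.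
eapply Rle_lt_trans; [apply Cmod_dist_lipschitz | apply Hd'].
eapply Rle_lt_trans; [apply Cmod_le_sum |]; simpl.
unfold Rminus in Hy'; rewrite Rplus_opp_r, Rabs_R0; lra.
Qed.

Lemma graph_map_bounded M f G H : 0 <= M -> zyg M f -> graph_map f G H ->
  forall N, exists B, forall z, 0 < snd z -> Rabs (fst z) <= N -> snd z <= N -> Cmod (G z) <= B.
Proof.
intros HM Hz Gm N.
destruct (Rlt_dec N 0) as [Hneg | Hpos].
{ exists 0; intros z _ Hx; pose proof (Rabs_pos (fst z)); lra. }
destruct crosscut as (Lam & HLam & Hcc).
set (r := N + 1).
destruct (continuity_ab_maj (fun y => Cmod (G (0, y) - 0)) r (2 * r)) as (ym & Hmax & _).
{ unfold r; lra. }
{ intros y Hy; apply rcont_continuity_pt, (graph_map_vertical_cont f G H); auto.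
  unfold r in Hy; lra. }
set (R0 := Cmod (G (0, ym) - 0) + 1) in *.
assert (HR0 : 0 < R0) by (unfold R0; pose proof (Cmod_ge_0 (G (0, ym) - 0)); lra).
destruct (Hcc f G H Gm 0 r 0 R0) as (r1 & r2 & r3 & H1 & H2 & H3 & Hbox); auto.
{ unfold r; lra. }
exists ((3 * M + 3) * (Lam * R0)); intros z Hz0 Hx Hy.
apply Rlt_le; replace (G z) with (G z - 0)%C by ring.
apply (box_image_inside M f G H 0 (Lam * R0) (0 - r1) (0 + r2) r3); auto; try nra.
- intros z' Hz' B'; apply Rlt_le, (Hbox (0, r3)); auto; simpl.
  + unfold r in *; lra.
  + apply box_fun_zero; simpl; unfold r in *; lra.
  + specialize (Hmax r3 H3); cbv beta in Hmax; unfold R0; lra.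
- apply box_fun_neg; apply Rabs_le_between in Hx; unfold r in *; lra.
Qed.

Definition blim (G : C -> C) (t : R) (p : C) : Prop :=
  forall e, 0 < e -> exists d, 0 < d /\ forall z, 0 < snd z -> Cmod (z - RtoC t) < d ->
    Cmod (G z - p) < e.

Lemma blim_unique G t p q : blim G t p -> blim G t q -> p = q.
Proof.
intros Hp Hq.
assert (E : Cmod (p - q) <= 0).
{ apply Rnot_lt_le; intros Hpos.
  destruct (Hp (Cmod (p - q) / 2)) as (d1 & Hd1 & H1); [lra |].
  destruct (Hq (Cmod (p - q) / 2)) as (d2 & Hd2 & H2); [lra |].
  set (y := Rmin d1 d2 / 2).
  assert (Hy : 0 < y /\ y < d1 /\ y < d2)
    by (unfold y, Rmin; destruct (Rle_dec _ _); lra).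
  assert (Ey : Cmod ((t, y) - RtoC t) <= y).
  { eapply Rle_trans; [apply Cmod_le_sum |]; simpl.
    rewrite Rplus_opp_r, Rabs_R0, Rabs_pos_eq; lra. }
  specialize (H1 (t, y) ltac:(simpl; lra) ltac:(lra)).
  specialize (H2 (t, y) ltac:(simpl; lra) ltac:(lra)).
  pose proof (Cmod_sub_triangle p (G (t, y)) q) as T.
  rewrite (Cmod_sub_sym p (G (t, y))) in T; lra. }
assert (E0 : Cmod (p - q) = 0) by (apply Rle_antisym; [easy | apply Cmod_ge_0]).
apply Cmod_eq_0 in E0; replace p with ((p - q) + q)%C by ring; rewrite E0; ring.
Qed.

Lemma boundary_cluster_point M f G H t : 0 <= M -> zyg M f -> graph_map f G H ->
  exists p, forall e, 0 < e -> exists y, 0 < y < e /\ Cmod (G (t, y) - p) < e.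
Proof.
intros HM Hz Gm; apply NNPP; intros Hno.
destruct (graph_map_bounded M f G H HM Hz Gm (Rabs t + 1)) as [B HB].
assert (Hgap : forall u v, exists d : posreal,
  forall y, 0 < y < 2 * d -> 2 * d <= Cmod (G (t, y) - (u, v))).
{ intros u v; apply NNPP; intros Hn; apply Hno; exists (u, v); intros e He.
  apply NNPP; intros Hn2; apply Hn.
  assert (He2 : 0 < e / 2) by lra; exists (mkposreal _ He2); simpl; intros y Hy.
  apply Rnot_lt_le; intros Hlt; apply Hn2; exists y; split; lra. }
set (delta := fun u v => proj1_sig (constructive_indefinite_description _ (Hgap u v))).
assert (Hdelta : forall u v y, 0 < y < 2 * delta u v -> 2 * delta u v <= Cmod (G (t, y) - (u, v)))
  by exact (fun u v => proj2_sig (constructive_indefinite_description _ (Hgap u v))).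
destruct (compactness_value_2d (- B) B (- B) B delta) as [d Hd].
pose proof (cond_pos d) as Hdpos.
set (y := Rmin d 1 / 2).
assert (Hy : 0 < y /\ y < d /\ y <= 1) by (unfold y, Rmin; destruct (Rle_dec _ _); lra).
assert (HG : Cmod (G (t, y)) <= B).
{ apply HB; simpl; [lra | lra | pose proof (Rabs_pos t); lra]. }
pose proof (Re_le_Cmod (G (t, y))) as R1; pose proof (Im_le_Cmod (G (t, y))) as R2.
assert (Rabs (fst (G (t, y))) <= B) as R1'%Rabs_le_between by lra.
assert (Rabs (snd (G (t, y))) <= B) as R2'%Rabs_le_between by lra.
apply (Hd _ _ R1' R2'); intros (u & v & _ & _ & Hu & Hv & Hduv).
pose proof (cond_pos (delta u v)).
specialize (Hdelta u v y ltac:(lra)).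
pose proof (Cmod_le_sum (G (t, y) - (u, v))) as T; simpl in T.
unfold Rminus in Hu, Hv; lra.
Qed.

(** A crosscut at a cluster point [p] separates a neighbourhood of [t] from a
    far point, and its image misses a small disc or stays in a large one. It
    cannot miss the small disc, which contains values of [G] from both sides,
    so the neighbourhood is mapped close to [p]. *)
Lemma boundary_limit M f G H t : 0 <= M -> zyg M f -> graph_map f G H ->
  exists p, blim G t p.
Proof.
intros HM Hz Gm.
destruct (boundary_cluster_point M f G H t HM Hz Gm) as [p Hp].
destruct crosscut as (Lam & HLam & Hcc).
exists p; intros e He.
set (R2 := e / (3 * M + 3)).
assert (HR2 : 0 < R2) by (apply Rdiv_lt_0_compat; lra).
set (R1 := R2 / Lam).
assert (HR1 : 0 < R1) by (apply Rdiv_lt_0_compat; lra).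
assert (HR12 : Lam * R1 = R2) by (unfold R1; field; lra).
assert (HR1M : 0 < R1 / (1 + M)) by (apply Rdiv_lt_0_compat; lra).
destruct (Hp (R1 / (1 + M)) HR1M) as (y1 & Hy1 & G1).
set (r := y1 / 4).
destruct (Hcc f G H Gm t r p R1) as (r1 & r2 & r3 & B1 & B2 & B3 & Hbox); [unfold r; lra | easy |].
destruct (classic (exists z, 0 < snd z /\ box_fun (t - r1) (t + r2) r3 z = 0 /\
   Cmod (G z - p) <= R1)) as [(z0 & Hz0 & Bz0 & Gz0) | Hmiss].
- exists r; split; [unfold r; lra |]; intros z Hzp Hzd.
  replace e with ((3 * M + 3) * R2) by (unfold R2; field; lra).
  apply (box_image_inside M f G H p R2 (t - r1) (t + r2) r3); auto.
  + intros z' Hz' Bz'; rewrite <- HR12; apply Rlt_le, (Hbox z0); auto.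
  + pose proof (Re_le_Cmod (z - RtoC t)) as Q1; pose proof (Im_le_Cmod (z - RtoC t)) as Q2.
    simpl in Q1, Q2.
    assert (Rabs (fst z + - t) < r) as Q1'%Rabs_lt_between by lra.
    assert (Rabs (snd z + - 0) < r) as Q2'%Rabs_lt_between by lra.
    apply box_fun_neg; lra.
- exfalso.
  destruct (Hp (Rmin r (R1 / (1 + M)))) as (y2 & Hy2 & G2).
  { apply Rmin_pos; unfold r; lra. }
  pose proof (Rmin_l r (R1 / (1 + M))); pose proof (Rmin_r r (R1 / (1 + M))).
  apply (box_image_outside M f G H p R1 (t - r1) (t + r2) r3 HM Hz Gm HR1) with (t, y2) (t, y1);
    simpl; try lra.
  + intros z Hzp Bz; apply Rnot_le_lt; intros Hle; apply Hmiss; exists z; auto.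
  + apply box_fun_neg; simpl; unfold r in *; lra.
  + apply box_fun_pos; simpl; unfold r in *; lra.
Qed.

Lemma blim_on_graph f G H t p : graph_map f G H -> blim G t p -> snd p = f (fst p).
Proof.
intros Gm Hp; destruct (Rtotal_order (snd p) (f (fst p))) as [h | [h | h]]; [| easy |]; exfalso.
- destruct (gm_cont _ _ _ Gm (fst p) ((f (fst p) - snd p) / 2)) as (d & Hd & Hd'); [lra |].
  destruct (Hp (Rmin d ((f (fst p) - snd p) / 2))) as (d2 & Hd2 & H2); [apply Rmin_pos; lra |].
  set (z := (t, d2 / 2) : C).
  assert (Hz : 0 < snd z) by (simpl; lra).
  assert (Ez : Cmod (z - RtoC t) < d2).
  { eapply Rle_lt_trans; [apply Cmod_le_sum |]; simpl.
    rewrite Rplus_opp_r, Rabs_R0, Rabs_pos_eq; lra. }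
  specialize (H2 z Hz Ez).
  pose proof (Rmin_l d ((f (fst p) - snd p) / 2)); pose proof (Rmin_r d ((f (fst p) - snd p) / 2)).
  pose proof (Re_le_Cmod (G z - p)) as Q1; pose proof (Im_le_Cmod (G z - p)) as Q2.
  simpl in Q1, Q2.
  assert (Q3 : Rabs (f (fst (G z)) - f (fst p)) < (f (fst p) - snd p) / 2)
    by (apply Hd'; unfold Rminus; lra).
  apply Rabs_lt_between in Q3; apply Rabs_le_between in Q2.
  pose proof (gm_G _ _ _ Gm z Hz); lra.
- assert (Hu := gm_H _ _ _ Gm p h).
  destruct (graph_map_ccont_inv f G H Gm p h (snd (H p) / 2)) as (d & Hd & Hd'); [lra |].
  destruct (Hp d Hd) as (d2 & Hd2 & H2).
  set (y := Rmin d2 (snd (H p)) / 2).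
  assert (Hy : 0 < y /\ y < d2 /\ y <= snd (H p) / 2)
    by (unfold y, Rmin; destruct (Rle_dec _ _); lra).
  set (z := (t, y) : C).
  assert (Hz : 0 < snd z) by (simpl; lra).
  assert (Ez : Cmod (z - RtoC t) < d2).
  { eapply Rle_lt_trans; [apply Cmod_le_sum |]; simpl.
    rewrite Rplus_opp_r, Rabs_R0, Rabs_pos_eq; lra. }
  specialize (Hd' (G z) (H2 z Hz Ez)); rewrite (gm_HG _ _ _ Gm z Hz) in Hd'.
  pose proof (Im_le_Cmod (z - H p)) as Q; simpl in Q; apply Rabs_le_between in Q; lra.
Qed.

Definition boundary_map (f : R -> R) (G : C -> C) (tau : R -> R) : Prop :=
  forall t, blim G t (graph_param f (tau t)).

Lemma boundary_map_exists M f G H : 0 <= M -> zyg M f -> graph_map f G H ->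
  exists tau, boundary_map f G tau.
Proof.
intros HM Hz Gm.
set (E := fun t => constructive_indefinite_description _ (boundary_limit M f G H t HM Hz Gm)).
exists (fun t => fst (proj1_sig (E t))); intros t.
pose proof (proj2_sig (E t)) as L; simpl in L.
pose proof (blim_on_graph f G H t _ Gm L) as Hg.
replace (graph_param f (fst (proj1_sig (E t)))) with (proj1_sig (E t)); [easy |].
unfold graph_param; rewrite <- Hg; apply surjective_pairing.
Qed.

(** Passing to the limit in [z], the estimate of [blim] at [t] also holds at
    the nearby boundary points. *)
Lemma boundary_map_limit f G tau t e : boundary_map f G tau -> 0 < e ->
  exists d, 0 < d /\
    (forall z, 0 < snd z -> Cmod (z - RtoC t) < d -> Cmod (G z - graph_param f (tau t)) < e) /\
    (forall s, Rabs (s - t) < d -> Cmod (graph_param f (tau s) - graph_param f (tau t)) < e).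
Proof.
intros Ht He; destruct (Ht t (e / 2)) as (d & Hd & Hd'); [lra |].
exists d; split; [easy |]; split.
- intros z Hz Hzd; specialize (Hd' z Hz Hzd); lra.
- intros s Hs; destruct (Ht s (e / 2)) as (d2 & Hd2 & H2); [lra |].
  set (y := Rmin d2 (d - Rabs (s - t)) / 2).
  assert (Hy : 0 < y /\ y < d2 /\ y < d - Rabs (s - t))
    by (unfold y, Rmin; destruct (Rle_dec _ _); lra).
  specialize (H2 (s, y)); specialize (Hd' (s, y)).
  assert (E1 : Cmod ((s, y) - RtoC s) < d2).
  { eapply Rle_lt_trans; [apply Cmod_le_sum |]; simpl.
    rewrite Rplus_opp_r, Rabs_R0, Rabs_pos_eq; lra. }
  assert (E2 : Cmod ((s, y) - RtoC t) < d).
  { eapply Rle_lt_trans; [apply Cmod_le_sum |]; simpl.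
    unfold Rminus in *; rewrite (Rabs_pos_eq (y + - 0)); lra. }
  specialize (H2 ltac:(simpl; lra) E1); specialize (Hd' ltac:(simpl; lra) E2).
  pose proof (Cmod_sub_triangle (graph_param f (tau s)) (G (s, y)) (graph_param f (tau t))) as T.
  rewrite (Cmod_sub_sym _ (G (s, y))) in T; lra.
Qed.

Lemma boundary_map_rcont f G tau t : boundary_map f G tau -> rcont tau t.
Proof.
intros Ht e He; destruct (boundary_map_limit f G tau t e Ht He) as (d & Hd & _ & H2).
exists d; split; [easy |]; intros s Hs; eapply Rle_lt_trans; [| apply (H2 s Hs)].
apply (Re_le_Cmod (graph_param f (tau s) - graph_param f (tau t))).
Qed.

(** * Injectivity of the boundary map *)

Definition gap (f : R -> R) (w : C) : R := snd w - f (fst w).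

Lemma gap_ccont_real f w : rcont f (fst w) -> ccont_real (gap f) w.
Proof.
intros Hf e He; destruct (Hf (e / 2)) as (d & Hd & Hd'); [lra |].
exists (Rmin d (e / 2)); split; [apply Rmin_pos; lra |]; intros v Hv.
pose proof (Rmin_l d (e / 2)); pose proof (Rmin_r d (e / 2)).
pose proof (Re_le_Cmod (v - w)) as R1; pose proof (Im_le_Cmod (v - w)) as R2; simpl in R1, R2.
assert (R3 : Rabs (f (fst v) - f (fst w)) < e / 2) by (apply Hd'; unfold Rminus; lra).
apply Rabs_lt_between in R3; apply Rabs_le_between in R2; unfold gap; apply Rabs_lt_between; lra.
Qed.

Lemma ccont_real_after (q : C -> R) (G : C -> C) z :
  ccont G z -> ccont_real q (G z) -> ccont_real (fun z => q (G z)) z.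
Proof.
intros HG Hq e He; destruct (Hq e He) as (d & Hd & Hd').
destruct (HG d Hd) as (d2 & Hd2 & H2); exists d2; auto.
Qed.

Lemma gap_min_on_path f G H g1 g2 a b : graph_map f G H -> a <= b ->
  (forall t, a <= t <= b -> rcont g1 t /\ rcont g2 t /\ 0 < g2 t) ->
  exists m, 0 < m /\ forall t, a <= t <= b -> m <= gap f (G (g1 t, g2 t)).
Proof.
intros Gm Hab Hg.
destruct (continuity_ab_min (fun t => gap f (G (g1 t, g2 t))) a b Hab) as (c & Hc & Hcab).
- intros t Ht; destruct (Hg t Ht) as (C1 & C2 & Hpos).
  apply rcont_continuity_pt, (ccont_real_comp (fun z => gap f (G z))); auto.
  apply ccont_real_after; [now apply (graph_map_ccont f G H) |].
  apply gap_ccont_real; exact (gm_cont _ _ _ Gm _).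
- exists (gap f (G (g1 c, g2 c))); split; [| exact Hc].
  destruct (Hg c Hcab) as (_ & _ & Hpos).
  pose proof (gm_G _ _ _ Gm (g1 c, g2 c) Hpos); unfold gap; lra.
Qed.

(** If [tau t1 = tau t2 = x0], the image of a crosscut from [t1] to [t2] closes
    up to a loop that meets the graph only above [x0]. From a boundary value
    over any other abscissa one could leave the loop by following the graph, at
    a small constant height, away from [x0]. *)
Lemma boundary_map_constant_between M f G H tau t1 t2 t : 0 <= M -> zyg M f ->
  graph_map f G H -> boundary_map f G tau ->
  t1 < t < t2 -> tau t1 = tau t2 -> tau t = tau t1.
Proof.
intros HM Hz Gm Ht Ht12 E12; apply NNPP; intros Hne.
set (x0 := tau t1) in *.
set (k := Rabs (tau t - x0) / 2).
assert (Hk : 0 < k).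
{ unfold k; assert (0 < Rabs (tau t - x0)) by (apply Rabs_pos_lt; lra); lra. }
assert (Hcf := gm_cont _ _ _ Gm).
assert (Hmin : exists eta, 0 < eta /\ forall z, 0 < snd z -> box_fun t1 t2 1 z = 0 ->
  k <= Rabs (fst (G z) - x0) -> eta <= gap f (G z)).
{ destruct (boundary_map_limit f G tau t1 k Ht Hk) as (d1 & Hd1 & L1 & _).
  destruct (boundary_map_limit f G tau t2 k Ht Hk) as (d2 & Hd2 & L2 & _).
  set (d := Rmin (Rmin d1 d2) 1).
  assert (Hd : 0 < d /\ d <= d1 /\ d <= d2 /\ d <= 1)
    by (unfold d, Rmin; repeat destruct (Rle_dec _ _); lra).
  destruct (gap_min_on_path f G H (fun _ => t1) (fun y => y) d 1 Gm) as (m1 & Hm1 & Q1);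
    [lra | intros s Hs; repeat split; [apply rcont_const | apply rcont_id | lra] |].
  destruct (gap_min_on_path f G H (fun _ => t2) (fun y => y) d 1 Gm) as (m2 & Hm2 & Q2);
    [lra | intros s Hs; repeat split; [apply rcont_const | apply rcont_id | lra] |].
  destruct (gap_min_on_path f G H (fun x => x) (fun _ => 1) t1 t2 Gm) as (m3 & Hm3 & Q3);
    [lra | intros s Hs; repeat split; [apply rcont_id | apply rcont_const | lra] |].
  exists (Rmin (Rmin m1 m2) m3); split; [repeat apply Rmin_pos; lra |].
  assert (B : Rmin (Rmin m1 m2) m3 <= m1 /\ Rmin (Rmin m1 m2) m3 <= m2 /\ Rmin (Rmin m1 m2) m3 <= m3)
    by (unfold Rmin; repeat destruct (Rle_dec _ _); lra).
  intros [x y] Hy (Bx & By & [E | [E | E]])%box_fun_zero Hfar; simpl in *; subst.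
  - destruct (Rle_dec d y); [specialize (Q1 y ltac:(lra)); lra |]; exfalso.
    assert (Ez : Cmod ((t1, y) - RtoC t1) < d1).
    { eapply Rle_lt_trans; [apply Cmod_le_sum |]; simpl.
      rewrite Rplus_opp_r, Rabs_R0, Rabs_pos_eq; lra. }
    specialize (L1 (t1, y) Hy Ez); pose proof (Re_le_Cmod (G (t1, y) - graph_param f (tau t1))) as R1.
    simpl in R1; fold x0 in R1, L1; unfold Rminus in Hfar; lra.
  - destruct (Rle_dec d y); [specialize (Q2 y ltac:(lra)); lra |]; exfalso.
    assert (Ez : Cmod ((t2, y) - RtoC t2) < d2).
    { eapply Rle_lt_trans; [apply Cmod_le_sum |]; simpl.
      rewrite Rplus_opp_r, Rabs_R0, Rabs_pos_eq; lra. }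
    specialize (L2 (t2, y) Hy Ez); pose proof (Re_le_Cmod (G (t2, y) - graph_param f (tau t2))) as R1.
    simpl in R1; rewrite <- E12 in R1, L2; unfold Rminus in Hfar; lra.
  - specialize (Q3 x ltac:(lra)); lra. }
destruct Hmin as (eta & Heta & Hmin).
(* A starting point for the walk: its own height above the graph is below the
   minimal height eta of the crosscut away from x0. *)
assert (Hstart : exists z, 0 < snd z /\ box_fun t1 t2 1 z < 0 /\
  k < Rabs (fst (G z) - x0) /\ gap f (G z) < eta).
{ destruct (gap_ccont_real f (graph_param f (tau t)) (Hcf _) eta Heta) as (d1 & Hd1 & H1).
  destruct (Ht t (Rmin d1 k)) as (d2 & Hd2 & H2); [now apply Rmin_pos |].
  set (y := Rmin d2 1 / 2).
  assert (Hy : 0 < y /\ y < d2 /\ y < 1) by (unfold y, Rmin; destruct (Rle_dec _ _); lra).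
  assert (Ez : Cmod ((t, y) - RtoC t) < d2).
  { eapply Rle_lt_trans; [apply Cmod_le_sum |]; simpl.
    rewrite Rplus_opp_r, Rabs_R0, Rabs_pos_eq; lra. }
  specialize (H2 (t, y) ltac:(simpl; lra) Ez).
  pose proof (Rmin_l d1 k); pose proof (Rmin_r d1 k).
  exists (t, y); simpl; repeat split; [lra | | |].
  - apply box_fun_neg; simpl; lra.
  - pose proof (Re_le_Cmod (G (t, y) - graph_param f (tau t))) as R1; simpl in R1.
    assert (R2 : Rabs (fst (G (t, y)) + - tau t) < k) by lra.
    assert (R3 : Rabs (tau t - x0) = 2 * k) by (unfold k; field).
    revert R2 R3; clear -Hk; unfold Rabs; repeat destruct (Rcase_abs _); lra.
  - specialize (H1 (G (t, y)) ltac:(lra)); apply Rabs_lt_between in H1.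
    assert (E0 : gap f (graph_param f (tau t)) = 0) by (unfold gap; simpl; ring).
    lra. }
destruct Hstart as (z & Hz0 & Bz & Hfar & Hgap).
set (g := gap f (G z)) in *; set (a := fst (G z)) in *.
assert (Hg : 0 < g) by (pose proof (gm_G _ _ _ Gm z Hz0); unfold g, gap; lra).
set (D := fun u : C => k <= Rabs (fst u - x0) /\ gap f u = g).
destruct (graph_map_bounded M f G H HM Hz Gm (Rmax (Rabs t1) (Rmax (Rabs t2) 1))) as [B HB].
set (X := Rmax B (Rabs a) + Rabs x0 + k + 1).
assert (HX : B < X /\ Rabs a < X /\ Rabs x0 + k < X).
{ pose proof (Rabs_pos x0); pose proof (Rabs_pos a).
  unfold X, Rmax; destruct (Rle_dec _ _); lra. }
assert (EGz : G z = (a, f a + g)).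
{ rewrite (surjective_pairing (G z)); unfold g, gap, a; f_equal; ring. }
assert (J : exists x, X = Rabs x /\ joined D (G z) (x, f x + g)).
{ rewrite EGz; destruct HX as (_ & HXa & HXx); apply Rabs_lt_between in HXa.
  assert (Hx0 := Rle_abs x0); assert (Hx0' := Rle_abs (- x0)); rewrite Rabs_Ropp in Hx0'.
  destruct (Rle_dec x0 a) as [Hax | Hax].
  - exists X; split; [rewrite Rabs_pos_eq; lra |].
    rewrite Rabs_pos_eq in Hfar by lra.
    apply (joined_path D (fun s => s) (fun s => f s + g) a X); [lra |].
    intros s Hs; repeat split; simpl; try apply rcont_id.
    + apply rcont_plus; [exact (Hcf s) | apply rcont_const].
    + rewrite Rabs_pos_eq; lra.
    + unfold gap; simpl; ring.
  - exists (- X); split; [rewrite Rabs_Ropp, Rabs_pos_eq; lra |].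
    rewrite Rabs_left in Hfar by lra.
    apply joined_sym, (joined_path D (fun s => s) (fun s => f s + g) (- X) a); [lra |].
    intros s Hs; repeat split; simpl; try apply rcont_id.
    + apply rcont_plus; [exact (Hcf s) | apply rcont_const].
    + rewrite Rabs_left; lra.
    + unfold gap; simpl; ring. }
destruct J as (x & Hx & J).
assert (HDO : forall u, D u -> f (fst u) < snd u) by (intros u [_ Hu]; unfold gap in Hu; lra).
assert (Hend : f (fst (x, f x + g)) < snd (x, f x + g)) by (simpl; lra).
destruct (crossing f G H D (G z) (x, f x + g) t1 t2 1 Gm HDO J) as (z' & Hz' & Bz' & Hk' & Hg').
- now rewrite (gm_HG _ _ _ Gm).
- apply Rnot_le_lt; intros Hle.
  assert (Hin : t1 <= fst (H (x, f x + g)) <= t2 /\ snd (H (x, f x + g)) <= 1).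
  { revert Hle; unfold box_fun, Rmax; repeat destruct (Rle_dec _ _); lra. }
  specialize (HB (H (x, f x + g)) (gm_H _ _ _ Gm _ Hend)).
  rewrite (gm_GH _ _ _ Gm _ Hend) in HB.
  pose proof (Re_le_Cmod (x, f x + g)) as R1; simpl in R1.
  pose proof (Rmax_l (Rabs t1) (Rmax (Rabs t2) 1)); pose proof (Rmax_r (Rabs t1) (Rmax (Rabs t2) 1)).
  pose proof (Rmax_l (Rabs t2) 1); pose proof (Rmax_r (Rabs t2) 1).
  assert (Q : Rabs (fst (H (x, f x + g))) <= Rmax (Rabs t1) (Rmax (Rabs t2) 1)).
  { pose proof (Rle_abs t2); pose proof (Rle_abs (- t1)); rewrite Rabs_Ropp in *.
    apply Rabs_le; lra. }
  specialize (HB Q ltac:(lra)); lra.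
- specialize (Hmin z' Hz' Bz' Hk'); lra.
Qed.

(** Every vertical segment over an interval of constancy would run into the
    single point [p], so that a cutoff around [p] would have full oscillation on
    all of them. *)
Lemma boundary_map_not_constant f G H tau t1 t2 : graph_map f G H -> boundary_map f G tau ->
  t1 < t2 -> exists t, t1 <= t <= t2 /\ tau t <> tau t1.
Proof.
intros Gm Ht H12; apply NNPP; intros Hno.
assert (Hc : forall t, t1 <= t <= t2 -> tau t = tau t1).
{ intros t Hti; apply NNPP; intros Hn; apply Hno; exists t; auto. }
set (p := graph_param f (tau t1)); set (s := t2 - t1).
destruct (log_cutoff (1 / 32)) as (Lam & HLam & Hcut); [lra |].
assert (Hm : exists m, 0 < m /\ forall x, t1 <= x <= t2 -> m <= Cmod (G (x, s) - p)).
{ destruct (continuity_ab_min (fun x => Cmod (G (x, s) - p)) t1 t2) as (c & Hmin & Hcab); [lra | |].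
  - intros x _; apply rcont_continuity_pt.
    apply (ccont_real_comp (fun z => Cmod (G z - p)) (fun x => x) (fun _ => s));
      [| apply rcont_id | apply rcont_const].
    intros e He; destruct (graph_map_ccont f G H Gm (x, s) ltac:(unfold s; simpl; lra) e He)
      as (d & Hd & Hd').
    exists d; split; [easy |]; intros v Hv.
    eapply Rle_lt_trans; [apply Cmod_dist_lipschitz | now apply Hd'].
  - exists (Cmod (G (c, s) - p)); split; [| exact Hmin].
    apply Cmod_gt_0; intros E.
    assert (Ep : G (c, s) = p).
    { replace (G (c, s)) with ((G (c, s) - p) + p)%C by ring; rewrite E; ring. }
    pose proof (gm_G _ _ _ Gm (c, s) ltac:(unfold s; simpl; lra)) as Q.
    rewrite Ep in Q; simpl in Q; lra. }
destruct Hm as (m & Hm & Hmin).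
set (R0 := m / Lam).
assert (HR0 : 0 < R0) by (apply Rdiv_lt_0_compat; lra).
assert (HLR : Lam * R0 = m) by (unfold R0; field; lra).
destruct (Hcut p R0 HR0) as (psi & Hin & Hout & Hlip & Hen).
destruct (vertical_line_small_osc_boundary f G H psi t1 s Gm) as (x & Hx & Hosc); auto;
  [unfold s; lra |].
assert (Hx' : t1 <= x <= t2) by (unfold s in Hx; lra).
pose proof (Ht x) as L; rewrite (Hc x Hx') in L; fold p in L.
destruct (L R0 HR0) as (d & Hd & Hd').
set (y := Rmin d s / 2).
assert (Hy : 0 < y /\ y < d /\ y < s)
  by (unfold y, s, Rmin; destruct (Rle_dec _ _); lra).
assert (Ez : Cmod ((x, y) - RtoC x) < d).
{ eapply Rle_lt_trans; [apply Cmod_le_sum |]; simpl.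
  rewrite Rplus_opp_r, Rabs_R0, Rabs_pos_eq; lra. }
specialize (Hd' (x, y) ltac:(simpl; lra) Ez).
specialize (Hosc y s ltac:(lra) ltac:(lra)).
rewrite Hin, Hout in Hosc; [| rewrite HLR; auto | lra].
apply Rabs_le_between in Hosc; lra.
Qed.

Lemma boundary_map_injective M f G H tau : 0 <= M -> zyg M f ->
  graph_map f G H -> boundary_map f G tau -> forall t1 t2, tau t1 = tau t2 -> t1 = t2.
Proof.
intros HM Hz Gm Ht.
assert (W : forall t1 t2, t1 < t2 -> tau t1 <> tau t2).
{ intros t1 t2 H12 E.
  destruct (boundary_map_not_constant f G H tau t1 t2 Gm Ht H12) as (t & Hti & Hn); apply Hn.
  destruct (Req_dec t t1) as [-> | N1]; [easy |].
  destruct (Req_dec t t2) as [-> | N2]; [easy |].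
  apply (boundary_map_constant_between M f G H tau t1 t2 t); auto; lra. }
intros t1 t2 E; destruct (Rtotal_order t1 t2) as [h | [h | h]]; [| easy |]; exfalso.
- now apply (W t1 t2).
- now apply (W t2 t1).
Qed.

(** * Orientation *)

Definition cis (a : R) : C := (cos a, sin a).

Lemma cis_plus a b : cis (a + b) = (cis a * cis b)%C.
Proof. unfold cis, Cmult; simpl; rewrite cos_plus, sin_plus; f_equal; ring. Qed.

Definition turns (a b : C) (th : R) : Prop := exists k, 0 < k /\ a = (RtoC k * b * cis th)%C.

Lemma turns_refl a : turns a a 0.
Proof.
exists 1; split; [lra |]; unfold cis; rewrite cos_0, sin_0.
replace (1, 0) with (RtoC 1) by easy; ring.
Qed.

Lemma turns_trans a b c th ph : turns a b th -> turns b c ph -> turns a c (th + ph).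
Proof.
intros (k & Hk & ->) (m & Hm & ->); exists (k * m); split; [nra |].
rewrite cis_plus, RtoC_mult; ring.
Qed.

Lemma turns_sym a b th : turns a b th -> turns b a (- th).
Proof.
intros (k & Hk & ->); exists (/ k); split; [now apply Rinv_0_lt_compat |].
transitivity (RtoC (/ k * k) * b * (cis th * cis (- th)))%C.
- rewrite <- cis_plus, Rplus_opp_r, Rinv_l by lra.
  unfold cis; rewrite cos_0, sin_0; replace (1, 0) with (RtoC 1) by easy; ring.
- rewrite RtoC_mult; ring.
Qed.

Lemma turns_mult a b c d th ph : turns a b th -> turns c d ph -> turns (a * c) (b * d) (th + ph).
Proof.
intros (k & Hk & ->) (m & Hm & ->); exists (k * m); split; [nra |].
rewrite cis_plus, RtoC_mult; ring.
Qed.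

Lemma turns_cos a b th ph : a <> RtoC 0 -> turns a b th -> turns a b ph -> cos (th - ph) = 1.
Proof.
intros Ha H1 H2; assert (H3 := turns_trans _ _ _ _ _ H1 (turns_sym _ _ _ H2)).
fold (th - ph) in H3; destruct H3 as (k & Hk & E).
assert (E1 : (RtoC 1 = RtoC k * cis (th - ph))%C).
{ rewrite <- (Cinv_r a Ha); rewrite E at 1.
  transitivity (RtoC k * cis (th - ph) * (a * / a))%C; [ring |].
  rewrite (Cinv_r a Ha); ring. }
unfold cis, Cmult, RtoC in E1; simpl in E1; injection E1 as E2 E3.
assert (S0 : sin (th - ph) = 0) by (apply Rmult_eq_reg_l with k; lra).
pose proof (sin2_cos2 (th - ph)) as S; rewrite S0 in S; unfold Rsqr in S.
assert (0 < cos (th - ph)) by (apply Rmult_lt_reg_l with k; lra). nra.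
Qed.

Lemma turns_path_constant a b g s t : a <> RtoC 0 -> s <= t ->
  (forall u, s <= u <= t -> rcont g u /\ turns a b (g u)) -> g s = g t.
Proof.
intros Ha Hst Hg.
assert (W : forall g : R -> R, (forall u, s <= u <= t -> rcont g u) ->
   (forall u, s <= u <= t -> cos (g u - g s) = 1) -> ~ g s < g t).
{ clear g Hg; intros g Hc Hcos Hlt.
  assert (Hs : s < t) by (destruct Hst as [h | ->]; [easy | lra]).
  set (v := Rmin (g s + 1) (g t)).
  assert (Hv : g s < v <= g t /\ v <= g s + 1)
    by (unfold v, Rmin; destruct (Rle_dec _ _); lra).
  destruct (f_interv_is_interv g s t v) as (u & Hu & E).
  - easy.
  - lra.
  - intros x Hx; apply rcont_continuity_pt; auto.
  - specialize (Hcos u Hu); rewrite E in Hcos.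
    pose proof PI2_1.
    assert (cos (v - g s) < cos 0) by (apply cos_decreasing_1; lra).
    rewrite cos_0 in *; lra. }
assert (Hcos : forall u, s <= u <= t -> cos (g u - g s) = 1).
{ intros u Hu; apply (turns_cos a b); [easy | apply Hg; lra | apply Hg; lra]. }
destruct (Rtotal_order (g s) (g t)) as [h | [h | h]]; [exfalso | easy | exfalso].
- apply (W g); auto; intros; now apply Hg.
- apply (W (fun u => - g u)); [| | lra].
  + intros u Hu e He; destruct (proj1 (Hg u Hu) e He) as (d & Hd & Hd').
    exists d; split; [easy |]; intros y Hy.
    replace (- g y - - g u) with (- (g y - g u)) by ring; rewrite Rabs_Ropp; auto.
  + intros u Hu; replace (- g u - - g s) with (- (g u - g s)) by ring.
    rewrite cos_neg; auto.
Qed.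

Lemma continuity_pt_rcont f x : continuity_pt f x -> rcont f x.
Proof. intros H; apply continuous_rcont, continuity_pt_filterlim, H. Qed.

Lemma rcont_comp_atan g t : rcont g t -> rcont (fun t => atan (g t)) t.
Proof.
intros H; apply continuity_pt_rcont, (continuity_pt_comp g atan);
  [now apply rcont_continuity_pt |].
apply derivable_continuous_pt, derivable_pt_atan.
Qed.

(** The half-angle formula for the argument in [(-PI/2, 3PI/2)]. *)
Definition arg_down (w : C) : R := PI / 2 - 2 * atan (fst w / (Cmod w + snd w)).

(** The argument in [(-3PI/2, PI/2)]; it agrees with [arg_down] in the right
    half-plane and is smaller by [2 PI] in the left one. *)
Definition arg_up (w : C) : R := - arg_down (fst w, - snd w).

Definition off_down (w : C) : Prop := fst w <> 0 \/ 0 < snd w.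
Definition off_up (w : C) : Prop := fst w <> 0 \/ snd w < 0.

Lemma Cmod_sqr (w : C) : Cmod w * Cmod w = fst w * fst w + snd w * snd w.
Proof. unfold Cmod; rewrite sqrt_sqrt; [ring |]; pose proof (pow2_ge_0 (fst w)); pose proof (pow2_ge_0 (snd w)); lra. Qed.

Lemma off_down_pos w : off_down w -> 0 < Cmod w + snd w.
Proof.
intros Hw; assert (M := Cmod_sqr w); assert (P := Cmod_ge_0 w).
destruct (Rlt_dec 0 (snd w)); [lra |].
destruct Hw as [Hw | Hw]; [| lra].
apply Rnot_le_lt; intros Hle.
assert (0 < fst w * fst w) by (destruct (Rdichotomy _ _ Hw); nra). nra.
Qed.

Lemma turns_arg_down w : off_down w -> turns w 1 (arg_down w).
Proof.
intros Hw; assert (M := Cmod_sqr w); assert (P := off_down_pos w Hw).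
set (m := Cmod w) in *.
assert (Hm : 0 < m).
{ assert (P0 := Cmod_ge_0 w); fold m in P0.
  destruct P0 as [h | h]; [easy |]; rewrite <- h in *; nra. }
exists m; split; [easy |].
unfold arg_down, cis; fold m.
set (u := fst w / (m + snd w)).
rewrite cos_shift, sin_shift, sin_2a, cos_2a, cos_atan, sin_atan.
assert (Hu : 0 < 1 + u²) by (pose proof (Rle_0_sqr u); lra).
assert (S : sqrt (1 + u²) * sqrt (1 + u²) = 1 + u²) by (apply sqrt_sqrt; lra).
assert (S0 : 0 < sqrt (1 + u²)) by (apply sqrt_lt_R0; lra).
set (k := sqrt (1 + u²)) in *.
replace (2 * (u / k) * (1 / k)) with (2 * u / (k * k)) by (field; lra).
replace (1 / k * (1 / k) - u / k * (u / k)) with ((1 - u²) / (k * k))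
  by (unfold Rsqr; field; lra).
rewrite S.
assert (E : 1 + u² = 2 * m / (m + snd w)).
{ unfold u, Rsqr; apply Rmult_eq_reg_r with ((m + snd w) * (m + snd w)); [| nra].
  field_simplify; [| lra | lra]. nra. }
assert (E1 : 2 * u / (1 + u²) = fst w / m) by (rewrite E; unfold u; field; lra).
assert (E2 : (1 - u²) / (1 + u²) = snd w / m).
{ replace (1 - u²) with (2 - (1 + u²)) by ring; rewrite E; field; lra. }
rewrite E1, E2; rewrite (surjective_pairing w) at 1.
unfold Cmult, RtoC; simpl; f_equal; field; lra.
Qed.

Lemma turns_arg_up w : off_up w -> turns w 1 (arg_up w).
Proof.
intros Hw.
destruct (turns_arg_down (fst w, - snd w)) as (k & Hk & E).
{ destruct Hw as [h | h]; [left | right]; simpl; [easy | lra]. }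
exists k; split; [easy |].
unfold arg_up, cis; rewrite cos_neg, sin_neg.
unfold cis, Cmult, RtoC in *; simpl in *; injection E as E1 E2.
apply injective_projections; simpl; lra.
Qed.

Lemma rcont_arg_down g1 g2 t : rcont g1 t -> rcont g2 t -> off_down (g1 t, g2 t) ->
  rcont (fun t => arg_down (g1 t, g2 t)) t.
Proof.
intros C1 C2 Hoff; assert (P := off_down_pos _ Hoff).
apply rcont_continuity_pt in C1; apply rcont_continuity_pt in C2.
apply continuity_pt_rcont; unfold arg_down; simpl in *.
apply continuity_pt_minus; [now apply continuity_pt_const |].
apply continuity_pt_mult; [now apply continuity_pt_const |].
apply (continuity_pt_comp (fun t => g1 t / (Cmod (g1 t, g2 t) + g2 t)) atan);
  [| apply derivable_continuous_pt, derivable_pt_atan].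
apply continuity_pt_div; [easy | | lra].
apply continuity_pt_plus; [| easy].
apply (continuity_pt_comp (fun t => g1 t ^ 2 + g2 t ^ 2) sqrt).
- simpl; repeat (apply continuity_pt_plus || apply continuity_pt_mult || easy);
    now apply continuity_pt_const.
- apply continuity_pt_sqrt; pose proof (pow2_ge_0 (g1 t)); pose proof (pow2_ge_0 (g2 t)); lra.
Qed.

Lemma rcont_opp g t : rcont g t -> rcont (fun t => - g t) t.
Proof.
intros H e He; destruct (H e He) as (d & Hd & Hd'); exists d; split; [easy |]; intros y Hy.
replace (- g y - - g t) with (- (g y - g t)) by ring; rewrite Rabs_Ropp; auto.
Qed.

Lemma rcont_arg_up g1 g2 t : rcont g1 t -> rcont g2 t -> off_up (g1 t, g2 t) ->
  rcont (fun t => arg_up (g1 t, g2 t)) t.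
Proof.
intros C1 C2 Hoff; unfold arg_up; simpl; apply rcont_opp.
apply (rcont_arg_down g1 (fun t => - g2 t)); [easy | now apply rcont_opp |].
destruct Hoff as [h | h]; [left | right]; simpl in *; [easy | lra].
Qed.

Lemma arg_inverse x y m : x <> 0 -> 0 < m -> m * m = x * x + y * y ->
  x / (m - y) = / (x / (m + y)).
Proof.
intros Hx Hm E.
assert (Hxx : 0 < x * x) by (destruct (Rdichotomy _ _ Hx); nra).
assert (0 < m + y) by (apply Rnot_le_lt; intros h; nra).
assert (0 < m - y) by (apply Rnot_le_lt; intros h; nra).
rewrite Rinv_div; apply Rmult_eq_reg_r with (x * (m - y)); [| nra].
field_simplify; [| lra | lra]. nra.
Qed.

Lemma arg_right w : 0 < fst w -> arg_up w = arg_down w.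
Proof.
intros Hx; unfold arg_up, arg_down; simpl.
assert (M := Cmod_sqr w); set (m := Cmod w) in *.
assert (Em : Cmod (fst w, - snd w) = m).
{ unfold m, Cmod; simpl; f_equal; ring. }
rewrite Em.
assert (Hm : 0 < m) by (assert (P := Cmod_ge_0 w); fold m in P; destruct P as [h | h]; [easy | nra]).
change (m + - snd w) with (m - snd w).
rewrite (arg_inverse (fst w) (snd w) m) by lra.
rewrite atan_inv; [lra |]; apply Rdiv_lt_0_compat; [easy |].
apply Rnot_le_lt; intros h; nra.
Qed.

Lemma arg_left w : fst w < 0 -> arg_up w = arg_down w - 2 * PI.
Proof.
intros Hx; unfold arg_up, arg_down; simpl.
assert (M := Cmod_sqr w); set (m := Cmod w) in *.
assert (Em : Cmod (fst w, - snd w) = m).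
{ unfold m, Cmod; simpl; f_equal; ring. }
rewrite Em.
assert (Hm : 0 < m) by (assert (P := Cmod_ge_0 w); fold m in P; destruct P as [h | h]; [easy | nra]).
change (m + - snd w) with (m - snd w).
rewrite (arg_inverse (fst w) (snd w) m) by lra.
assert (Hp : 0 < m + snd w) by (apply Rnot_le_lt; intros h; nra).
replace (fst w / (m + snd w)) with (- (- fst w / (m + snd w))) by (field; lra).
rewrite Rinv_opp, !atan_opp, atan_inv; [lra |].
apply Rdiv_lt_0_compat; lra.
Qed.

Definition turn_angle (a b : C) : R :=
  atan ((snd a * fst b - fst a * snd b) / (fst a * fst b + snd a * snd b)).

Lemma turns_turn_angle a b : b <> RtoC 0 -> 0 < fst a * fst b + snd a * snd b ->
  turns a b (turn_angle a b).
Proof.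
intros Hb HS; unfold turn_angle.
set (S := fst a * fst b + snd a * snd b) in *.
set (T := snd a * fst b - fst a * snd b).
set (B := fst b * fst b + snd b * snd b).
assert (HB : 0 < B) by (unfold B; rewrite <- Cmod_sqr; assert (0 < Cmod b) by (now apply Cmod_gt_0); nra).
assert (Hq : 0 < 1 + (T / S)²) by (pose proof (Rle_0_sqr (T / S)); lra).
assert (Hs : 0 < sqrt (1 + (T / S)²)) by now apply sqrt_lt_R0.
exists (S * sqrt (1 + (T / S)²) / B); split; [apply Rdiv_lt_0_compat; nra |].
unfold cis; rewrite cos_atan, sin_atan.
set (k := sqrt (1 + (T / S)²)) in *.
rewrite (surjective_pairing a) at 1.
unfold Cmult, RtoC; simpl; f_equal;
  apply Rmult_eq_reg_r with B; try lra; field_simplify; try lra; unfold B, T, S; field; lra.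
Qed.

Lemma rcont_turn_angle a1 a2 b1 b2 t :
  rcont a1 t -> rcont a2 t -> rcont b1 t -> rcont b2 t ->
  a1 t * b1 t + a2 t * b2 t <> 0 ->
  rcont (fun t => turn_angle (a1 t, a2 t) (b1 t, b2 t)) t.
Proof.
intros A1%rcont_continuity_pt A2%rcont_continuity_pt B1%rcont_continuity_pt
  B2%rcont_continuity_pt Hne.
unfold turn_angle; simpl; apply rcont_comp_atan, continuity_pt_rcont.
apply continuity_pt_div; [| | easy].
- apply continuity_pt_minus; now apply continuity_pt_mult.
- apply continuity_pt_plus; now apply continuity_pt_mult.
Qed.

Lemma ccont_fst q z : ccont q z -> ccont_real (fun z => fst (q z)) z.
Proof.
intros H e He; destruct (H e He) as (d & Hd & Hd'); exists d; split; [easy |]; intros v Hv.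
eapply Rle_lt_trans; [apply (Re_le_Cmod (q v - q z)) | auto].
Qed.

Lemma ccont_snd q z : ccont q z -> ccont_real (fun z => snd (q z)) z.
Proof.
intros H e He; destruct (H e He) as (d & Hd & Hd'); exists d; split; [easy |]; intros v Hv.
eapply Rle_lt_trans; [apply (Im_le_Cmod (q v - q z)) | auto].
Qed.

Lemma small_relative_steps (q : C -> C) B : (forall z, ccont q z) -> (forall z, q z <> RtoC 0) ->
  exists d, 0 < d /\ forall u v, Cmod u <= B -> Cmod (v - u) < d -> Cmod (q v - q u) < Cmod (q u).
Proof.
intros Hc Hn.
assert (Hg : forall x y, exists d : posreal, forall v, Cmod (v - (x, y)) < 3 * d ->
   Cmod (q v - q (x, y)) < Cmod (q (x, y)) / 4).
{ intros x y; assert (P : 0 < Cmod (q (x, y))) by now apply Cmod_gt_0.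
  destruct (Hc (x, y) (Cmod (q (x, y)) / 4)) as (d & Hd & Hd'); [lra |].
  assert (Hd3 : 0 < d / 3) by lra; exists (mkposreal _ Hd3); simpl; intros v Hv; apply Hd'; lra. }
set (delta := fun x y => proj1_sig (constructive_indefinite_description _ (Hg x y))).
assert (Hdelta : forall x y v, Cmod (v - (x, y)) < 3 * delta x y ->
   Cmod (q v - q (x, y)) < Cmod (q (x, y)) / 4)
  by exact (fun x y => proj2_sig (constructive_indefinite_description _ (Hg x y))).
destruct (compactness_value_2d (- B) B (- B) B delta) as [d Hd].
exists d; split; [apply cond_pos |]; intros u v Hu Hv.
pose proof (Re_le_Cmod u) as R1; pose proof (Im_le_Cmod u) as R2.
assert (Rabs (fst u) <= B) as R1'%Rabs_le_between by lra.
assert (Rabs (snd u) <= B) as R2'%Rabs_le_between by lra.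
apply Rnot_le_lt; intros Hle; apply (Hd _ _ R1' R2'); intros (x & y & _ & _ & Hx & Hy & Hdxy).
assert (Hu' : Cmod (u - (x, y)) < 2 * delta x y).
{ pose proof (Cmod_le_sum (u - (x, y))) as T; simpl in T; unfold Rminus in Hx, Hy; lra. }
pose proof (Cmod_sub_triangle v u (x, y)) as T1.
pose proof (Hdelta x y u ltac:(pose proof (cond_pos (delta x y)); lra)) as Q1.
pose proof (Hdelta x y v ltac:(lra)) as Q2.
pose proof (Cmod_sub_triangle (q v) (q (x, y)) (q u)) as T2.
rewrite (Cmod_sub_sym (q (x, y)) (q u)) in T2.
pose proof (Cmod_triangle (q (x, y) - q u) (q u)) as T3.
replace (q (x, y) - q u + q u)%C with (q (x, y)) in T3 by ring.
rewrite (Cmod_sub_sym (q (x, y)) (q u)) in T3.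
pose proof (Cmod_ge_0 (q (x, y))); lra.
Qed.

Lemma small_step_positive (a b : C) : Cmod (a - b) < Cmod b -> 0 < fst a * fst b + snd a * snd b.
Proof.
intros H; pose proof (Cmod_sqr (a - b)) as E1; pose proof (Cmod_sqr b) as E2; simpl in E1.
assert (Cmod (a - b) * Cmod (a - b) < Cmod b * Cmod b)
  by (apply Rmult_le_0_lt_compat; auto using Cmod_ge_0).
pose proof (Rle_0_sqr (fst a)); pose proof (Rle_0_sqr (snd a)); unfold Rsqr in *; lra.
Qed.

(** A continuous function without zeros has a continuous argument on a disc: add
    up the small turns along each radius. *)
Lemma continuous_argument (q : C -> C) z0 Rad : (forall z, ccont q z) -> (forall z, q z <> RtoC 0) ->
  0 < Rad -> exists th : C -> R,
    (forall z, Cmod (z - z0) < Rad -> turns (q z) (q z0) (th z)) /\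
    (forall g1 g2 t, rcont g1 t -> rcont g2 t -> Cmod ((g1 t, g2 t) - z0) < Rad ->
       rcont (fun t => th (g1 t, g2 t)) t).
Proof.
intros Hc Hn HRad.
destruct (small_relative_steps q (Cmod z0 + Rad) Hc Hn) as (d & Hd & Hstep).
destruct (nfloor_ex (Rad / d)) as [n0 [_ Hn0]]; [apply Rlt_le, Rdiv_lt_0_compat; lra |].
set (n := S n0).
assert (Hnn : Rad / d < INR n) by (unfold n; rewrite S_INR; lra).
assert (Hn1 : 1 <= INR n) by (apply (le_INR 1); unfold n; lia).
clearbody n.
assert (HRn : Rad / INR n < d).
{ apply Rmult_lt_compat_r with (r := d / INR n) in Hnn; [| apply Rdiv_lt_0_compat; lra].
  replace (Rad / d * (d / INR n)) with (Rad / INR n) in Hnn by (field; lra).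
  replace (INR n * (d / INR n)) with d in Hnn by (field; lra). easy. }
set (pt := fun (z : C) (j : nat) =>
  ((1 - INR j / INR n) * fst z0 + INR j / INR n * fst z,
   (1 - INR j / INR n) * snd z0 + INR j / INR n * snd z) : C).
assert (Ept : forall z j, (pt z j - z0 = RtoC (INR j / INR n) * (z - z0))%C).
{ intros z j; unfold pt; destruct z, z0; unfold Cminus, Cplus, Copp, Cmult, RtoC; simpl.
  f_equal; ring. }
assert (Hpos : forall z j, Cmod (z - z0) < Rad -> (j < n)%nat ->
  0 < fst (q (pt z (S j))) * fst (q (pt z j)) + snd (q (pt z (S j))) * snd (q (pt z j))).
{ intros z j Hz Hj; apply small_step_positive, Hstep.
  - pose proof (Cmod_triangle (pt z j - z0) z0) as T.
    replace (pt z j - z0 + z0)%C with (pt z j) in T by ring.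
    rewrite Ept, Cmod_mult, Cmod_R in T.
    assert (Hj' : INR j <= INR n) by (apply le_INR; lia).
    assert (0 <= INR j / INR n <= 1).
    { pose proof (pos_INR j); split; [apply Rdiv_le_0_compat; lra |].
      apply Rmult_le_reg_r with (INR n); [lra |]; field_simplify; lra. }
    rewrite Rabs_pos_eq in T by lra. pose proof (Cmod_ge_0 (z - z0)); nra.
  - replace (pt z (S j) - pt z j)%C with ((pt z (S j) - z0) - (pt z j - z0))%C by ring.
    rewrite !Ept, S_INR.
    replace (RtoC ((INR j + 1) / INR n) * (z - z0) - RtoC (INR j / INR n) * (z - z0))%C
      with (RtoC (/ INR n) * (z - z0))%C.
    2: { replace ((INR j + 1) / INR n) with (INR j / INR n + / INR n) by (field; lra).
         rewrite RtoC_plus; ring. }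
    rewrite Cmod_mult, Cmod_R, Rabs_pos_eq by (apply Rlt_le, Rinv_0_lt_compat; lra).
    eapply Rle_lt_trans; [| apply HRn]; unfold Rdiv; rewrite Rmult_comm.
    apply Rmult_le_compat_r; [apply Rlt_le, Rinv_0_lt_compat; lra | lra]. }
set (th := fun m z => lsum (fun j => turn_angle (q (pt z (S j))) (q (pt z j))) (seq 0 m)).
exists (th n); split.
- intros z Hz.
  assert (E0 : pt z 0%nat = z0).
  { unfold pt; change (INR 0) with 0; apply injective_projections; simpl fst; simpl snd; field; lra. }
  assert (En : pt z n = z).
  { unfold pt; apply injective_projections; simpl fst; simpl snd; field; lra. }
  assert (G : forall m, (m <= n)%nat -> turns (q (pt z m)) (q (pt z 0%nat)) (th m z)).
  { induction m as [|m IH]; intros Hm; [apply turns_refl |].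
    unfold th; rewrite seq_S, lsum_app; simpl; rewrite Rplus_0_r, Rplus_comm.
    apply turns_trans with (q (pt z m)); [| apply IH; lia].
    apply turns_turn_angle; [apply Hn | apply Hpos; [easy | lia]]. }
  specialize (G n (Nat.le_refl n)); rewrite En, E0 in G; exact G.
- intros g1 g2 t C1 C2 Hz.
  assert (Caff : forall (g : R -> R) a l, rcont g t -> rcont (fun t => (1 - l) * a + l * g t) t).
  { intros g a l Cg%rcont_continuity_pt; apply continuity_pt_rcont.
    apply continuity_pt_plus; [now apply continuity_pt_const |].
    apply continuity_pt_mult; [now apply continuity_pt_const | easy]. }
  assert (Cq1 : forall j, rcont (fun t => fst (q (pt (g1 t, g2 t) j))) t).
  { intros j; unfold pt; simpl.
    apply (ccont_real_comp (fun z => fst (q z))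
      (fun t => (1 - INR j / INR n) * fst z0 + INR j / INR n * g1 t)
      (fun t => (1 - INR j / INR n) * snd z0 + INR j / INR n * g2 t));
      [apply ccont_fst, Hc | now apply Caff | now apply Caff]. }
  assert (Cq2 : forall j, rcont (fun t => snd (q (pt (g1 t, g2 t) j))) t).
  { intros j; unfold pt; simpl.
    apply (ccont_real_comp (fun z => snd (q z))
      (fun t => (1 - INR j / INR n) * fst z0 + INR j / INR n * g1 t)
      (fun t => (1 - INR j / INR n) * snd z0 + INR j / INR n * g2 t));
      [apply ccont_snd, Hc | now apply Caff | now apply Caff]. }
  assert (G : forall m, (m <= n)%nat -> rcont (fun t => th m (g1 t, g2 t)) t).
  { induction m as [|m IH]; intros Hm; [exact (rcont_const 0 t) |].
    assert (E : rcont (fun t => th m (g1 t, g2 t) +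
       turn_angle (q (pt (g1 t, g2 t) (S m))) (q (pt (g1 t, g2 t) m))) t).
    { apply rcont_plus; [apply IH; lia |].
      apply (rcont_turn_angle (fun t => fst (q (pt (g1 t, g2 t) (S m))))
        (fun t => snd (q (pt (g1 t, g2 t) (S m))))
        (fun t => fst (q (pt (g1 t, g2 t) m))) (fun t => snd (q (pt (g1 t, g2 t) m))));
        auto; apply Rgt_not_eq, Hpos; [easy | lia]. }
    intros e He; destruct (E e He) as (d' & Hd' & Hd'').
    exists d'; split; [easy |]; intros y Hy; specialize (Hd'' y Hy).
    unfold th in *; rewrite !seq_S, !lsum_app; simpl; rewrite !Rplus_0_r; exact Hd''. }
  apply G; lia.
Qed.

(** The boundary values are prolonged into the lower half-plane, so that the
    argument function below can be built on whole discs and no continuity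
    relative to a closed half-plane is involved. *)
Definition prolong (f : R -> R) (G : C -> C) (tau : R -> R) (z : C) : C :=
  if Rlt_dec 0 (snd z) then G z else graph_param f (tau (fst z)).

Lemma prolong_pos f G tau z : 0 < snd z -> prolong f G tau z = G z.
Proof. intros; unfold prolong; destruct (Rlt_dec _ _); easy. Qed.

Lemma prolong_neg f G tau z : snd z <= 0 -> prolong f G tau z = graph_param f (tau (fst z)).
Proof. intros; unfold prolong; destruct (Rlt_dec _ _); [lra | easy]. Qed.

Lemma prolong_ccont f G H tau z : graph_map f G H -> boundary_map f G tau ->
  ccont (prolong f G tau) z.
Proof.
intros Gm Ht e He; destruct (Rlt_dec 0 (snd z)) as [Hz | Hz].
- destruct (graph_map_ccont f G H Gm z Hz e He) as (d & Hd & Hd').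
  exists (Rmin d (snd z)); split; [now apply Rmin_pos |]; intros v Hv.
  pose proof (Rmin_l d (snd z)); pose proof (Rmin_r d (snd z)).
  pose proof (Im_le_Cmod (v - z)) as R1; simpl in R1; apply Rabs_le_between in R1.
  rewrite !prolong_pos by lra; apply Hd'; lra.
- rewrite prolong_neg by lra.
  destruct (boundary_map_limit f G tau (fst z) e Ht He) as (d & Hd & L1 & L2).
  set (d' := if Rlt_dec (snd z) 0 then Rmin d (- snd z) else d).
  assert (Hd' : 0 < d' /\ d' <= d /\ (snd z < 0 -> d' <= - snd z))
    by (unfold d', Rmin; repeat destruct (Rlt_dec _ _); repeat destruct (Rle_dec _ _); lra).
  exists d'; split; [easy |]; intros v Hv.
  pose proof (Re_le_Cmod (v - z)) as R1; simpl in R1.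
  pose proof (Im_le_Cmod (v - z)) as R2; simpl in R2; apply Rabs_le_between in R2.
  destruct (Rlt_dec 0 (snd v)) as [Hv0 | Hv0].
  + assert (Ez : snd z = 0) by (destruct (Rlt_dec (snd z) 0); lra).
    rewrite prolong_pos by easy; apply L1; [easy |].
    replace (RtoC (fst z)) with z by (unfold RtoC; rewrite (surjective_pairing z), Ez; easy).
    lra.
  + rewrite prolong_neg by lra; apply L2; unfold Rminus; lra.
Qed.

Lemma boundary_map_at_infinity f G H tau : graph_map f G H -> boundary_map f G tau ->
  forall K, exists N, forall z, 0 <= snd z -> N < Cmod z -> K < Cmod (prolong f G tau z).
Proof.
intros Gm Ht K; destruct (gm_inf _ _ _ Gm (K + 1)) as [N HN].
exists N; intros z Hz HzN.
destruct (Rlt_dec 0 (snd z)) as [h | h].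
{ rewrite prolong_pos by easy; specialize (HN z h HzN); lra. }
assert (Ez : z = RtoC (fst z)) by (unfold RtoC; rewrite (surjective_pairing z) at 1; f_equal; lra).
rewrite prolong_neg by lra.
destruct (Ht (fst z) 1 Rlt_0_1) as (d & Hd & Hd').
set (y := Rmin d (Cmod z - N) / 2).
assert (Hy : 0 < y /\ y < d /\ y < Cmod z - N)
  by (unfold y, Rmin; destruct (Rle_dec _ _); lra).
assert (E1 : Cmod ((fst z, y) - RtoC (fst z)) < d).
{ eapply Rle_lt_trans; [apply Cmod_le_sum |]; simpl.
  rewrite Rplus_opp_r, Rabs_R0, Rabs_pos_eq; lra. }
specialize (Hd' (fst z, y) ltac:(simpl; lra) E1).
assert (E2 : N < Cmod (fst z, y)).
{ eapply Rlt_le_trans; [apply HzN |].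
  rewrite Ez at 1; unfold Cmod, RtoC; simpl; apply sqrt_le_1_alt; nra. }
specialize (HN (fst z, y) ltac:(simpl; lra) E2).
pose proof (Cmod_triangle (G (fst z, y) - graph_param f (tau (fst z))) (graph_param f (tau (fst z)))) as T.
replace (G (fst z, y) - graph_param f (tau (fst z)) + graph_param f (tau (fst z)))%C
  with (G (fst z, y)) in T by ring.
lra.
Qed.

(** [(G - w0) / (z - z0)] has no zeros, hence a continuous argument, so [G - w0]
    and [z - z0] have the same winding along the boundary of a large box. That
    of [z - z0] is one; the bottom side is mapped into the graph, away from the
    upward ray from [w0], and the other sides away from the downward ray, so
    that of [G - w0] is one only if [G] sends the bottom side from left to
    right. *)
Lemma boundary_map_orientation f G H tau : graph_map f G H -> boundary_map f G tau ->
  exists c r0, forall r, r0 < r -> c < tau r /\ tau (- r) < c.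
Proof.
intros Gm Ht.
set (z0 := (0, 1) : C); set (w0 := G z0).
assert (Hz0 : 0 < snd z0) by (simpl; lra).
assert (Hw0 := gm_G _ _ _ Gm z0 Hz0); fold w0 in Hw0.
destruct (gm_dG _ _ _ Gm z0 Hz0) as [l Hl].
set (P := prolong f G tau).
assert (HP : forall z, ccont P z) by (intros; now apply (prolong_ccont f G H)).
assert (HPgraph : forall z, snd z <= 0 -> snd (P z) = f (fst (P z))).
{ intros z Hz; unfold P; rewrite prolong_neg by easy; easy. }
assert (HPabove : forall z, f (fst (P z)) <= snd (P z)).
{ intros z; destruct (Rlt_dec 0 (snd z)).
  - unfold P; rewrite prolong_pos by easy; apply Rlt_le, (gm_G _ _ _ Gm); easy.
  - right; symmetry; apply HPgraph; lra. }
assert (HPne : forall z, z <> z0 -> P z <> w0).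
{ intros z Hz E; destruct (Rlt_dec 0 (snd z)) as [h | h].
  - apply Hz; unfold P in E; rewrite prolong_pos in E by easy.
    now apply (graph_map_injective f G H Gm).
  - specialize (HPgraph z ltac:(lra)); rewrite E in HPgraph; lra. }
assert (Hl0 : l <> RtoC 0).
{ intros El.
  destruct (gm_dH _ _ _ Gm w0 Hw0) as [l' Hl'].
  assert (Hll : (l' * l)%C = 1%C).
  { apply (inverse_derivatives G H z0); auto.
    exists 1; split; [lra |]; intros z Hz; apply (gm_HG _ _ _ Gm).
    pose proof (Im_le_Cmod (z - z0)) as I; simpl in I; apply Rabs_le_between in I; lra. }
  rewrite El, Cmult_0_r in Hll; injection Hll; lra. }
assert (Hsub : forall a b : C, a <> b -> (a - b)%C <> RtoC 0).
{ intros a b Hab E; apply Hab; replace a with ((a - b) + b)%C by ring; rewrite E; ring. }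
set (q := fun z => if excluded_middle_informative (z = z0) then l else ((P z - w0) / (z - z0))%C).
assert (Hq : forall z, (P z - w0 = (z - z0) * q z)%C).
{ intros z; unfold q; destruct (excluded_middle_informative _) as [-> | h].
  - unfold P; rewrite prolong_pos by easy; fold w0; ring.
  - field; now apply Hsub. }
assert (Hqn : forall z, q z <> RtoC 0).
{ intros z E; destruct (excluded_middle_informative (z = z0)) as [h | h].
  - unfold q in E; destruct (excluded_middle_informative _); [now apply Hl0 | easy].
  - apply (Hsub (P z) w0); [now apply HPne |]; rewrite Hq, E; ring. }
assert (Hqc : forall z, ccont q z).
{ intros z; destruct (excluded_middle_informative (z = z0)) as [-> | h].
  - intros e He; destruct (Hl (e / 2)) as (d & Hd & Hd'); [lra |].
    exists (Rmin d 1); split; [apply Rmin_pos; lra |]; intros v Hv.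
    pose proof (Rmin_l d 1); pose proof (Rmin_r d 1).
    destruct (excluded_middle_informative (v = z0)) as [-> | hv].
    { replace (q z0 - q z0)%C with (RtoC 0) by ring; rewrite Cmod_0; easy. }
    assert (Hv0 : 0 < Cmod (v - z0)) by now apply Cmod_gt_0, Hsub.
    specialize (Hd' v ltac:(lra)).
    pose proof (Im_le_Cmod (v - z0)) as I; simpl in I; apply Rabs_le_between in I.
    assert (Eq0 : q z0 = l) by (unfold q; destruct (excluded_middle_informative _); easy).
    fold w0 in Hd'.
    replace (G v - w0 - l * (v - z0))%C with ((v - z0) * (q v - q z0))%C in Hd'.
    2: { rewrite Eq0, <- (prolong_pos f G tau v) by lra; fold P; rewrite Hq; ring. }
    rewrite Cmod_mult in Hd'. nra.
  - intros e He.
    assert (Hz1 : 0 < Cmod (z - z0)) by now apply Cmod_gt_0, Hsub.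
    set (m := Cmod (z - z0)) in *.
    assert (Qz := Cmod_ge_0 (q z)).
    set (e1 := e * m / 4).
    assert (He1 : 0 < e1) by (unfold e1; nra).
    destruct (HP z e1 He1) as (d & Hd & Hd').
    set (d2 := e1 / (Cmod (q z) + 1)).
    assert (Hd2 : 0 < d2) by (apply Rdiv_lt_0_compat; lra).
    exists (Rmin (Rmin d (m / 2)) d2); split; [repeat apply Rmin_pos; lra |]; intros v Hv.
    assert (B : Cmod (v - z) < d /\ Cmod (v - z) < m / 2 /\ Cmod (v - z) < d2).
    { revert Hv; unfold Rmin; repeat destruct (Rle_dec _ _); lra. }
    specialize (Hd' v (proj1 B)).
    assert (Hm : m / 2 <= Cmod (v - z0)).
    { pose proof (Cmod_sub_triangle z v z0) as T; rewrite (Cmod_sub_sym z v) in T; fold m in T; lra. }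
    assert (E : ((v - z0) * (q v - q z) = (P v - P z) - (v - z) * q z)%C).
    { replace (P v - P z)%C with ((P v - w0) - (P z - w0))%C by ring; rewrite !Hq; ring. }
    apply (f_equal Cmod) in E; rewrite Cmod_mult in E.
    pose proof (Cmod_triangle (P v - P z) (- ((v - z) * q z))) as T.
    rewrite Cmod_opp, Cmod_mult in T.
    change (P v - P z + - ((v - z) * q z))%C with (P v - P z - (v - z) * q z)%C in T.
    assert (Cmod (v - z) * Cmod (q z) <= e1).
    { apply Rle_trans with (d2 * (Cmod (q z) + 1)); [pose proof (Cmod_ge_0 (v - z)); nra |].
      unfold d2; right; field; lra. }
    assert (Cmod (v - z0) * Cmod (q v - q z) < 2 * e1) by lra.
    apply Rnot_le_lt; intros Hle; unfold e1 in *; nra. }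
set (B0 := Rabs (fst w0) + Rabs (snd w0) + Rabs (f (fst w0))).
destruct (boundary_map_at_infinity f G H tau Gm Ht B0) as [N HN]; fold P in HN.
assert (Hfar : forall z, 0 <= snd z -> N < Cmod z -> off_down (P z - w0)).
{ intros z Hz HzN; specialize (HN z Hz HzN); specialize (HPabove z).
  destruct (Req_dec (fst (P z)) (fst w0)) as [E | E]; [right | left; simpl; lra].
  simpl; apply Rnot_le_lt; intros Hle.
  pose proof (Cmod_le_sum (P z)) as T; rewrite E in *.
  assert (Rabs (snd (P z)) <= Rabs (snd w0) + Rabs (f (fst w0))).
  { pose proof (Rle_abs (snd w0)); pose proof (Rle_abs (- f (fst w0))); rewrite Rabs_Ropp in *.
    pose proof (Rabs_pos (snd w0)); pose proof (Rabs_pos (f (fst w0))).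
    apply Rabs_le; lra. }
  unfold B0 in HN; lra. }
exists (fst w0), (Rmax N 1); intros r Hr.
assert (Hr' : N < r /\ 1 < r) by (revert Hr; unfold Rmax; destruct (Rle_dec _ _); lra).
destruct (continuous_argument q z0 (3 * r + 3) Hqc Hqn) as (th & Hth & Hthc); [lra |].
(* Along any path on which a branch of the argument is available for both
   G - w0 and z - z0, the three arguments differ by a constant. *)
assert (Key : forall (off : C -> Prop) (arg : C -> R),
  (forall w, off w -> turns w 1 (arg w)) ->
  (forall g1 g2 t, rcont g1 t -> rcont g2 t -> off (g1 t, g2 t) ->
     rcont (fun t => arg (g1 t, g2 t)) t) ->
  forall g1 g2 a b, a <= b ->
  (forall t, a <= t <= b -> rcont g1 t /\ rcont g2 t /\
     Rabs (g1 t) <= r /\ 0 <= g2 t <= r /\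
     off ((g1 t, g2 t) - z0)%C /\ off (P (g1 t, g2 t) - w0)%C) ->
  arg (P (g1 a, g2 a) - w0)%C - arg ((g1 a, g2 a) - z0)%C - th (g1 a, g2 a) =
  arg (P (g1 b, g2 b) - w0)%C - arg ((g1 b, g2 b) - z0)%C - th (g1 b, g2 b)).
{ intros off arg Hturn Hcont g1 g2 a b Hab Hg.
  set (Phi := fun t => arg (P (g1 t, g2 t) - w0)%C - arg ((g1 t, g2 t) - z0)%C - th (g1 t, g2 t)).
  change (Phi a = Phi b).
  apply (turns_path_constant (q z0) 1); [apply Hqn | easy |].
  intros t Hti; destruct (Hg t Hti) as (C1 & C2 & Hb1 & Hb2 & O1 & O2).
  assert (Hnear : Cmod ((g1 t, g2 t) - z0) < 3 * r + 3).
  { eapply Rle_lt_trans; [apply Cmod_le_sum |]; simpl.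
    apply Rabs_le_between in Hb1.
    assert (Rabs (g1 t + - 0) <= r) by (apply Rabs_le; lra).
    assert (Rabs (g2 t + - (1)) <= r + 1) by (apply Rabs_le; lra). lra. }
  split.
  - unfold Phi; unfold Rminus; repeat apply rcont_plus; try apply rcont_opp.
    + apply (Hcont (fun t => fst (P (g1 t, g2 t)) + - fst w0)
                   (fun t => snd (P (g1 t, g2 t)) + - snd w0)); [| | exact O2].
      * apply rcont_plus; [| apply rcont_const].
        apply (ccont_real_comp (fun z => fst (P z))); auto; apply ccont_fst, HP.
      * apply rcont_plus; [| apply rcont_const].
        apply (ccont_real_comp (fun z => snd (P z))); auto; apply ccont_snd, HP.
    + apply (Hcont (fun t => g1 t + - 0) (fun t => g2 t + - (1))); [| | exact O1];
        apply rcont_plus; auto; apply rcont_const.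
    + now apply Hthc.
  - specialize (Hth (g1 t, g2 t) Hnear).
    assert (T1 := Hturn _ O2); assert (T2 := Hturn _ O1).
    (* q z0, (z - z0) q z0, (z - z0) q z = P z - w0, 1 *)
    assert (T3 := turns_mult _ _ _ _ _ _ T2 (turns_refl (q z0))).
    assert (T4 := turns_mult _ _ _ _ _ _ (turns_refl ((g1 t, g2 t) - z0)%C) Hth).
    rewrite <- Hq in T4.
    replace (1 * q z0)%C with (q z0) in T3 by ring.
    assert (T6 := turns_trans _ _ _ _ _ (turns_sym _ _ _ T3)
                    (turns_trans _ _ _ _ _ (turns_sym _ _ _ T4) T1)).
    unfold Phi; match type of T6 with turns _ _ ?x => replace x with
      (arg (P (g1 t, g2 t) - w0)%C - arg ((g1 t, g2 t) - z0)%C - th (g1 t, g2 t)) in T6 by ring end.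
    exact T6. }
assert (HNr : forall x y, (x = r \/ x = - r \/ y = r) -> N < Cmod (x, y)).
{ intros x y Hxy; destruct Hxy as [-> | [-> | ->]].
  - eapply Rlt_le_trans; [| apply (Re_le_Cmod (r, y))]; simpl; rewrite Rabs_pos_eq; lra.
  - eapply Rlt_le_trans; [| apply (Re_le_Cmod (- r, y))]; simpl.
    rewrite Rabs_Ropp, Rabs_pos_eq; lra.
  - eapply Rlt_le_trans; [| apply (Im_le_Cmod (x, r))]; simpl; rewrite Rabs_pos_eq; lra. }
assert (KU := Key off_up arg_up turns_arg_up rcont_arg_up (fun t => t) (fun _ => 0) (- r) r ltac:(lra)).
assert (KR := Key off_down arg_down turns_arg_down rcont_arg_down (fun _ => r) (fun t => t) 0 r ltac:(lra)).
assert (KT := Key off_down arg_down turns_arg_down rcont_arg_down (fun t => t) (fun _ => r) (- r) r ltac:(lra)).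
assert (KL := Key off_down arg_down turns_arg_down rcont_arg_down (fun _ => - r) (fun t => t) 0 r ltac:(lra)).
simpl in KU, KR, KT, KL.
assert (Rr : Rabs r = r) by (apply Rabs_pos_eq; lra).
assert (Rnr : Rabs (- r) = r) by (rewrite Rabs_Ropp; easy).
lapply KU; clear KU; [intros KU |].
2: { intros t Hti; repeat split; try apply rcont_id; try apply rcont_const; try lra.
     - apply Rabs_le; lra.
     - right; simpl; lra.
     - destruct (Req_dec (fst (P (t, 0))) (fst w0)) as [E | E]; [right | left; simpl; lra].
       specialize (HPgraph (t, 0) ltac:(simpl; lra)); rewrite E in HPgraph; simpl; lra. }
lapply KR; clear KR; [intros KR |].
2: { intros t Hti; repeat split; try apply rcont_id; try apply rcont_const; try lra.
     - left; simpl; lra.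
     - apply Hfar; [simpl; lra | apply HNr; auto]. }
lapply KT; clear KT; [intros KT |].
2: { intros t Hti; repeat split; try apply rcont_id; try apply rcont_const; try lra.
     - apply Rabs_le; lra.
     - right; simpl; lra.
     - apply Hfar; [simpl; lra | apply HNr; auto]. }
lapply KL; clear KL; [intros KL |].
2: { intros t Hti; repeat split; try apply rcont_id; try apply rcont_const; try lra.
     - left; simpl; lra.
     - apply Hfar; [simpl; lra | apply HNr; auto]. }
assert (Ar : arg_up ((r, 0) - z0)%C = arg_down ((r, 0) - z0)%C) by (apply arg_right; simpl; lra).
assert (Al : arg_up (((- r)%R, 0) - z0)%C = arg_down (((- r)%R, 0) - z0)%C - 2 * PI)
  by (apply arg_left; simpl; lra).
assert (Hcorner : forall x, Rabs x = r -> fst (P (x, 0) - w0)%C <> 0).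
{ intros x Hx E.
  assert (O : off_down (P (x, 0) - w0)%C).
  { apply Hfar; [simpl; lra |]; eapply Rlt_le_trans; [| apply (Re_le_Cmod (x, 0))]; simpl; lra. }
  destruct O as [O | O]; [easy |].
  specialize (HPgraph (x, 0) ltac:(simpl; lra)).
  simpl in E, O; replace (fst (P (x, 0))) with (fst w0) in HPgraph by lra; lra. }
assert (HPI := PI_RGT_0).
assert (Ep : forall x, P (x, 0) = graph_param f (tau x))
  by (intros x; unfold P; rewrite prolong_neg by (simpl; lra); easy).
pose proof (Hcorner r Rr) as Cr; pose proof (Hcorner (- r) Rnr) as Cl.
destruct (Rdichotomy _ _ Cr) as [Sr | Sr]; destruct (Rdichotomy _ _ Cl) as [Sl | Sl].
- exfalso; pose proof (arg_left _ Sr); pose proof (arg_left _ Sl); lra.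
- exfalso; pose proof (arg_left _ Sr); pose proof (arg_right _ Sl); lra.
- rewrite !Ep in *; simpl in Sr, Sl; lra.
- exfalso; pose proof (arg_right _ Sr); pose proof (arg_right _ Sl); lra.
Qed.

(** * The boundary map is an increasing homeomorphism *)

Lemma zyg_bounded M f V : 0 <= M -> zyg M f ->
  exists B, forall x, Rabs x <= V -> Rabs (f x) <= B.
Proof.
intros HM Hz; exists (Rabs (f (- V)) + Rabs (f V) + M * V); intros x Hx.
destruct (Req_dec V 0) as [-> | HV].
{ assert (x = 0) as ->.
  { apply Rabs_le_between in Hx; lra. }
  pose proof (Rabs_pos (f (- 0))); lra. }
assert (0 < V) by (pose proof (Rabs_pos x); lra).
apply Rabs_le_between in Hx.
set (t := (x + V) / (2 * V)).
assert (Ht : 0 <= t <= 1).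
{ unfold t; split; [apply Rdiv_le_0_compat; lra |].
  apply Rmult_le_reg_r with (2 * V); [lra |]; field_simplify; lra. }
pose proof (zyg_chord M f (- V) V t HM Hz Ht) as Q.
replace ((1 - t) * - V + t * V) with x in Q by (unfold t; field; lra).
rewrite (Rabs_pos_eq (V - - V)) in Q by lra.
apply Rabs_le_between in Q.
pose proof (Rle_abs (f (- V))); pose proof (Rle_abs (f V)).
pose proof (Rle_abs (- f (- V))); pose proof (Rle_abs (- f V)); rewrite !Rabs_Ropp in *.
apply Rabs_le; nra.
Qed.

Lemma boundary_map_limits M f G H tau : 0 <= M -> zyg M f ->
  graph_map f G H -> boundary_map f G tau ->
  forall V, exists T, forall t, T < t -> V < tau t /\ tau (- t) < - V.
Proof.
intros HM Hz Gm Ht V.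
destruct (boundary_map_orientation f G H tau Gm Ht) as (c & r0 & Hc).
set (W := Rabs V + Rabs c).
destruct (zyg_bounded M f W HM Hz) as [B HB].
destruct (boundary_map_at_infinity f G H tau Gm Ht (W + B)) as [N HN].
assert (Far : forall t, N < Rabs t -> W < Rabs (tau t)).
{ intros t HtN; apply Rnot_le_lt; intros Hle.
  specialize (HN (t, 0) ltac:(simpl; lra)).
  pose proof (Re_le_Cmod (t, 0)) as R1; simpl in R1; specialize (HN ltac:(lra)).
  rewrite prolong_neg in HN by (simpl; lra).
  pose proof (Cmod_le_sum (graph_param f (tau (fst (t, 0))))) as T; simpl in T, HN.
  specialize (HB _ Hle); lra. }
exists (Rmax (Rabs N) (Rmax r0 0)); intros t Htt.
assert (Q : N < t /\ r0 < t /\ 0 < t).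
{ pose proof (Rle_abs N); revert Htt; unfold Rmax; repeat destruct (Rle_dec _ _); lra. }
destruct (Hc t (proj1 (proj2 Q))) as [C1 C2].
assert (F1 : W < Rabs (tau t)) by (apply Far; rewrite Rabs_pos_eq; lra).
assert (F2 : W < Rabs (tau (- t))) by (apply Far; rewrite Rabs_Ropp, Rabs_pos_eq; lra).
pose proof (Rle_abs V); pose proof (Rle_abs c); pose proof (Rle_abs (- c)).
rewrite Rabs_Ropp in *; pose proof (Rabs_pos V); pose proof (Rabs_pos c).
unfold W, Rabs at 3 in F1; unfold W, Rabs at 3 in F2.
destruct (Rcase_abs (tau t)); destruct (Rcase_abs (tau (- t))); lra.
Qed.

Lemma boundary_map_increasing M f G H tau : 0 <= M -> zyg M f ->
  graph_map f G H -> boundary_map f G tau -> forall t t', t < t' -> tau t < tau t'.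
Proof.
intros HM Hz Gm Ht t t' Htt; apply Rnot_le_lt; intros Hle.
destruct (boundary_map_limits M f G H tau HM Hz Gm Ht (tau t)) as [T HT].
set (b := Rmax T t' + 1).
assert (Hb : T < b /\ t' < b) by (unfold b, Rmax; destruct (Rle_dec _ _); lra).
destruct (HT b (proj1 Hb)) as [Hgt _].
destruct (f_interv_is_interv tau t' b (tau t)) as (u & Hu & E); [lra | lra | |].
- intros x _; apply rcont_continuity_pt, (boundary_map_rcont f G); easy.
- apply (boundary_map_injective M f G H tau HM Hz Gm Ht) in E; lra.
Qed.

Lemma boundary_map_surjective M f G H tau : 0 <= M -> zyg M f ->
  graph_map f G H -> boundary_map f G tau -> forall y, exists t, tau t = y.
Proof.
intros HM Hz Gm Ht y.
destruct (boundary_map_limits M f G H tau HM Hz Gm Ht (Rabs y)) as [T HT].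
set (b := Rmax T 0 + 1).
assert (Hb : T < b /\ 0 < b) by (unfold b, Rmax; destruct (Rle_dec _ _); lra).
destruct (HT b (proj1 Hb)) as [H1 H2].
pose proof (Rle_abs y); pose proof (Rle_abs (- y)); rewrite Rabs_Ropp in *.
destruct (f_interv_is_interv tau (- b) b y) as (u & Hu & E); [lra | lra | |].
- intros x _; apply rcont_continuity_pt, (boundary_map_rcont f G); easy.
- now exists u.
Qed.

(** * Quasisymmetry *)

Lemma zyg_halving M f x s k : 0 <= M -> zyg M f ->
  2 ^ k * Rabs (f (x + s / 2 ^ k) - f x) <= Rabs (f (x + s) - f x) + INR k * (M * Rabs s / 2).
Proof.
intros HM [_ Hz]; induction k as [|k IH].
- simpl; rewrite Rdiv_1_r; lra.
- assert (P : 0 < 2 ^ k) by (apply pow_lt; lra).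
  set (u := s / 2 ^ k) in *.
  assert (E : s / 2 ^ S k = u / 2) by (unfold u; simpl; field; lra).
  rewrite E, S_INR.
  assert (Hu : Rabs u = Rabs s / 2 ^ k).
  { unfold u, Rdiv; rewrite Rabs_mult, (Rabs_pos_eq (/ 2 ^ k)); [easy |].
    apply Rlt_le, Rinv_0_lt_compat, P. }
  pose proof (Hz (x + u / 2) (u / 2)) as Q.
  replace (x + u / 2 + u / 2) with (x + u) in Q by field.
  replace (x + u / 2 - u / 2) with x in Q by field.
  unfold Rdiv at 2 in Q; rewrite Rabs_mult, (Rabs_pos_eq (/ 2)) in Q by lra.
  assert (Q2 : 2 * Rabs (f (x + u / 2) - f x) <= Rabs (f (x + u) - f x) + M * Rabs u / 2).
  { unfold Rabs in *; repeat destruct (Rcase_abs _); lra. }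
  assert (Q3 : 2 ^ k * (M * Rabs u) = M * Rabs s) by (rewrite Hu; field; lra).
  apply Rmult_le_compat_l with (r := 2 ^ k) in Q2; [| lra].
  simpl pow; lra.
Qed.

(** The graph parametrization contracts small scales by an almost linear factor;
    the slope at scale [s / 2 ^ k] can exceed that at scale [s] by a multiple of
    [k] only. *)
Lemma graph_param_scales M f x y s k : 0 <= M -> zyg M f ->
  Rabs (y - x) <= Rabs s / 2 ^ k ->
  2 ^ k * Cmod (graph_param f y - graph_param f x) <=
  (2 + (INR k + 2) * M) * Cmod (graph_param f (x + s) - graph_param f x).
Proof.
intros HM Hz Hy.
assert (P : 0 < 2 ^ k) by (apply pow_lt; lra).
set (D := Cmod (graph_param f (x + s) - graph_param f x)).
assert (D1 : Rabs s <= D).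
{ replace s with (fst (graph_param f (x + s) - graph_param f x)%C) by (simpl; ring).
  apply Re_le_Cmod. }
assert (D2 : Rabs (f (x + s) - f x) <= D)
  by apply (Im_le_Cmod (graph_param f (x + s) - graph_param f x)).
set (u := s / 2 ^ k).
assert (Hu : Rabs u = Rabs s / 2 ^ k).
{ unfold u, Rdiv; rewrite Rabs_mult, (Rabs_pos_eq (/ 2 ^ k)); [easy |].
  apply Rlt_le, Rinv_0_lt_compat, P. }
pose proof (zyg_halving M f x s k HM Hz) as Hk; fold u in Hk.
assert (Hus : 2 ^ k * Rabs u = Rabs s) by (rewrite Hu; field; lra).
assert (Hyu : 2 ^ k * Rabs (y - x) <= Rabs s) by (rewrite <- Hus, Hu; apply Rmult_le_compat_l; lra).
assert (Hf : Rabs (f y - f x) <= Rabs (f (x + u) - f x) + 3 / 2 * M * Rabs u).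
{ destruct (Req_dec u 0) as [U0 | U0].
  { rewrite <- Hu, U0, Rabs_R0 in Hy.
    assert (y = x) as -> by (pose proof (Rabs_pos (y - x)); apply Rabs_le_between in Hy; lra).
    rewrite Rminus_diag, Rabs_R0; pose proof (Rabs_pos (f (x + u) - f x)).
    pose proof (Rabs_pos u); nra. }
  set (lam := (y - x) / u).
  assert (Hlam : Rabs lam <= 1).
  { unfold lam, Rdiv; rewrite Rabs_mult, Rabs_inv.
    assert (0 < Rabs u) by now apply Rabs_pos_lt.
    apply Rmult_le_reg_r with (Rabs u); [easy |].
    rewrite Rmult_assoc, Rinv_l, Rmult_1_r, Rmult_1_l by lra; lra. }
  apply Rabs_le_between in Hlam.
  pose proof (Rabs_pos u) as Pu.
  pose proof (Rabs_pos (f (x + u) - f x)) as Pf.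
  destruct (Rle_dec 0 lam) as [h | h].
  - pose proof (zyg_chord M f x (x + u) lam HM Hz ltac:(lra)) as Q.
    replace ((1 - lam) * x + lam * (x + u)) with y in Q by (unfold lam; field; easy).
    replace (x + u - x) with u in Q by ring.
    replace (f y - ((1 - lam) * f x + lam * f (x + u)))
      with ((f y - f x) - lam * (f (x + u) - f x)) in Q by ring.
    pose proof (Rabs_triang (f y - f x - lam * (f (x + u) - f x)) (lam * (f (x + u) - f x))) as T.
    replace (f y - f x - lam * (f (x + u) - f x) + lam * (f (x + u) - f x)) with (f y - f x) in T by ring.
    rewrite Rabs_mult, (Rabs_pos_eq lam) in T by lra.
    assert (lam * Rabs (f (x + u) - f x) <= Rabs (f (x + u) - f x)) by nra.
    assert (0 <= M * Rabs u) by nra. lra.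
  - pose proof (zyg_chord M f x (x - u) (- lam) HM Hz ltac:(lra)) as Q.
    replace ((1 - - lam) * x + - lam * (x - u)) with y in Q by (unfold lam; field; easy).
    replace (x - u - x) with (- u) in Q by ring; rewrite Rabs_Ropp in Q.
    replace (f y - ((1 - - lam) * f x + - lam * f (x - u)))
      with ((f y - f x) - (- lam) * (f (x - u) - f x)) in Q by ring.
    pose proof (Rabs_triang (f y - f x - (- lam) * (f (x - u) - f x)) ((- lam) * (f (x - u) - f x))) as T.
    replace (f y - f x - - lam * (f (x - u) - f x) + - lam * (f (x - u) - f x)) with (f y - f x) in T by ring.
    rewrite Rabs_mult, (Rabs_pos_eq (- lam)) in T by lra.
    pose proof (proj2 Hz x u) as Z.
    assert (Rabs (f (x - u) - f x) <= Rabs (f (x + u) - f x) + M * Rabs u).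
    { unfold Rabs in *; repeat destruct (Rcase_abs _); lra. }
    pose proof (Rabs_pos (f (x - u) - f x)).
    assert (- lam * Rabs (f (x - u) - f x) <= Rabs (f (x - u) - f x)) by nra. lra. }
pose proof (Cmod_le_sum (graph_param f y - graph_param f x)) as T; simpl in T.
fold (y - x) (f y - f x) in T.
apply Rmult_le_compat_l with (r := 2 ^ k) in T; [| lra].
apply Rmult_le_compat_l with (r := 2 ^ k) in Hf; [| lra].
assert (Q3 : 2 ^ k * (3 / 2 * M * Rabs u) = 3 / 2 * (M * Rabs s)) by (rewrite <- Hus; ring).
assert (MD : M * Rabs s <= M * D) by (apply Rmult_le_compat_l; lra).
assert (Pk := pos_INR k).
assert (MkD : INR k * (M * Rabs s / 2) <= INR k * (M * D)).
{ apply Rmult_le_compat_l; [easy |]; pose proof (Rabs_pos s); nra. }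
assert (0 <= M * D) by (pose proof (Rabs_pos s); nra).
lra.
Qed.

Lemma linear_lt_pow2 a b : exists k, a + b * INR k < 2 ^ k.
Proof.
assert (B : forall m, INR m + 1 <= 2 ^ m).
{ induction m as [|m IH]; [simpl; lra |]; rewrite S_INR; simpl; pose proof (pos_INR m); lra. }
destruct (nfloor_ex (Rabs a + 2 * Rabs b)) as [m [_ Hm]].
{ pose proof (Rabs_pos a); pose proof (Rabs_pos b); lra. }
exists (m + m)%nat; rewrite pow_add, plus_INR.
specialize (B m); pose proof (pos_INR m); pose proof (Rle_abs a); pose proof (Rle_abs b).
pose proof (Rabs_pos a); pose proof (Rabs_pos b).
assert ((INR m + 1) * (INR m + 1) <= 2 ^ m * 2 ^ m) by nra.
assert ((Rabs a + 2 * Rabs b) * (INR m + 1) < (INR m + 1) * (INR m + 1))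
  by (apply Rmult_lt_compat_r; lra).
nra.
Qed.

(** The feet are not on the crosscut, but are approached along its vertical
    sides, so the crosscut estimate passes to the limit there. *)
Lemma crosscut_feet f G tau p R0 Lam a b c : boundary_map f G tau -> 0 < c -> a < b ->
  (forall z z', 0 < snd z -> 0 < snd z' -> box_fun a b c z = 0 -> box_fun a b c z' = 0 ->
     Cmod (G z - p) <= R0 -> Cmod (G z' - p) < Lam * R0) ->
  forall s s', s = a \/ s = b -> s' = a \/ s' = b ->
  Cmod (graph_param f (tau s) - p) < R0 ->
  Cmod (graph_param f (tau s') - p) <= Lam * R0.
Proof.
intros Ht Hc Hab Hbox s s' Hs Hs' Hn; apply Rnot_lt_le; intros Hf.
assert (App : forall s e, (s = a \/ s = b) -> 0 < e -> exists z, 0 < snd z /\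
   box_fun a b c z = 0 /\ Cmod (G z - graph_param f (tau s)) < e).
{ clear -Ht Hc Hab; intros s e Hs He; destruct (Ht s e He) as (d & Hd & Hd').
  set (y := Rmin d c / 2).
  assert (Hy : 0 < y /\ y < d /\ y < c) by (unfold y, Rmin; destruct (Rle_dec _ _); lra).
  exists (s, y); simpl; split; [lra | split].
  - apply box_fun_zero; simpl; lra.
  - apply Hd'; [simpl; lra |].
    eapply Rle_lt_trans; [apply Cmod_le_sum |]; simpl.
    rewrite Rplus_opp_r, Rabs_R0, Rabs_pos_eq; lra. }
destruct (App s (R0 - Cmod (graph_param f (tau s) - p)) Hs) as (z & Hz & Bz & Az); [lra |].
destruct (App s' (Cmod (graph_param f (tau s') - p) - Lam * R0) Hs') as (z' & Hz' & Bz' & Az'); [lra |].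
pose proof (Cmod_sub_triangle (G z) (graph_param f (tau s)) p) as T1.
pose proof (Cmod_sub_triangle (graph_param f (tau s')) (G z') p) as T2.
rewrite (Cmod_sub_sym _ (G z')) in T2.
specialize (Hbox z z' Hz Hz' Bz Bz' ltac:(lra)); lra.
Qed.

(** If [phi x - phi (x - t)] were twice [phi (x + K t) - phi x], some crosscut
    around [phi x] would have its left foot mapped over [(x - t, x)] and its
    right foot beyond [x + K t], at distances from [graph_param f x] whose ratio
    exceeds what [crosscut] allows. *)
Lemma welding_one_sided_doubling M f G H tau phi : 0 <= M -> zyg M f ->
  graph_map f G H -> boundary_map f G tau ->
  (forall t t', t < t' -> tau t < tau t') -> (forall x, tau (phi x) = x) ->
  exists k, forall x t, 0 < t ->
    phi x - phi (x - t) < 2 * (phi (x + 2 ^ k * t) - phi x) /\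
    phi (x + t) - phi x < 2 * (phi x - phi (x - 2 ^ k * t)).
Proof.
intros HM Hz Gm Ht Hinc Hphi.
assert (Hle : forall t t', tau t <= tau t' -> t <= t').
{ intros t t' h; apply Rnot_lt_le; intros h'; specialize (Hinc _ _ h'); lra. }
assert (Hlt : forall t t', tau t < tau t' -> t < t').
{ intros t t' h; apply Rnot_le_lt; intros [h' | ->]; [specialize (Hinc _ _ h') |]; lra. }
assert (Htau_le : forall t t', t <= t' -> tau t <= tau t').
{ intros t t' [h | ->]; [left; now apply Hinc | lra]. }
destruct crosscut as (Lam & HLam & Hcc).
set (C0 := 2 + 2 * M).
set (L := 2 * C0 * Lam).
assert (HL : 0 < L) by (unfold L, C0; nra).
destruct (linear_lt_pow2 (L * (2 + 2 * M)) (L * M)) as [k Hk].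
exists k; intros x t Htp.
assert (P : 0 < 2 ^ k) by (apply pow_lt; lra).
set (Fx := graph_param f x).
(* s = 2 ^ k t or - 2 ^ k t is the far displacement. *)
assert (Key : forall s, Rabs s = 2 ^ k * t -> exists R0, 0 < R0 /\
   (forall y, Rabs (y - x) <= t -> Cmod (graph_param f y - Fx) < R0) /\
   (forall y, Rabs s <= Rabs (y - x) -> Lam * R0 < Cmod (graph_param f y - Fx))).
{ intros s Hs.
  set (D := Cmod (graph_param f (x + s) - Fx)).
  assert (HD : 0 < D).
  { apply Rlt_le_trans with (Rabs s); [rewrite Hs; nra |].
    replace s with (fst (graph_param f (x + s) - Fx)%C) by (simpl; ring).
    apply Re_le_Cmod. }
  exists (D / L); split; [now apply Rdiv_lt_0_compat |]; split.
  - intros y Hy.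
    assert (Hy' : Rabs (y - x) <= Rabs s / 2 ^ k) by (rewrite Hs; field_simplify; lra).
    pose proof (graph_param_scales M f x y s k HM Hz Hy') as Q; fold Fx D in Q.
    apply Rmult_lt_reg_l with (2 ^ k * L); [nra |].
    replace (2 ^ k * L * (D / L)) with (2 ^ k * D) by (field; lra).
    apply Rle_lt_trans with (L * ((2 + (INR k + 2) * M) * D)); [nra |].
    replace (L * ((2 + (INR k + 2) * M) * D))
      with ((L * (2 + 2 * M) + L * M * INR k) * D) by ring.
    apply Rmult_lt_compat_r; lra.
  - intros y Hy.
    pose proof (graph_param_scales M f x (x + s) (y - x) 0 HM Hz) as Q.
    replace (x + s - x) with s in Q by ring; replace (x + (y - x)) with y in Q by ring.
    simpl in Q; rewrite Rdiv_1_r in Q; specialize (Q Hy).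
    fold Fx D in Q; rewrite Rmult_1_l, Rplus_0_l in Q; fold C0 in Q.
    assert (E : Lam * (D / L) = D / (2 * C0)) by (unfold L, C0; field; lra).
    rewrite E; apply Rmult_lt_reg_l with (2 * C0); [unfold C0; lra |].
    replace (2 * C0 * (D / (2 * C0))) with D by (unfold C0; field; lra). lra. }
assert (Hkt : 0 < 2 ^ k * t) by nra.
assert (Ltx : phi (x - t) < phi x) by (apply Hlt; rewrite !Hphi; lra).
assert (Lxt : phi x < phi (x + t)) by (apply Hlt; rewrite !Hphi; lra).
assert (LKx : phi (x - 2 ^ k * t) < phi x) by (apply Hlt; rewrite !Hphi; lra).
assert (LxK : phi x < phi (x + 2 ^ k * t)) by (apply Hlt; rewrite !Hphi; lra).
split; apply Rnot_le_lt; intros Hbad.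
- destruct (Key (2 ^ k * t)) as (R0 & HR0 & Hnear & Hfar); [apply Rabs_pos_eq; lra |].
  set (r := phi (x + 2 ^ k * t) - phi x) in *.
  destruct (Hcc f G H Gm (phi x) r Fx R0) as (r1 & r2 & r3 & B1 & B2 & B3 & Hbox);
    [unfold r; lra | easy |].
  pose proof (crosscut_feet f G tau Fx R0 Lam (phi x - r1) (phi x + r2) r3 Ht
    ltac:(unfold r in *; lra) ltac:(unfold r in *; lra) Hbox
    (phi x - r1) (phi x + r2) (or_introl eq_refl) (or_intror eq_refl)) as Q.
  assert (T1 : x - t <= tau (phi x - r1)) by (rewrite <- Hphi at 1; apply Htau_le; unfold r in *; lra).
  assert (T2 : tau (phi x - r1) <= x) by (rewrite <- (Hphi x) at 2; apply Htau_le; unfold r in *; lra).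
  assert (T3 : x + 2 ^ k * t <= tau (phi x + r2)) by (rewrite <- Hphi at 1; apply Htau_le; unfold r in *; lra).
  specialize (Q (Hnear (tau (phi x - r1)) ltac:(apply Rabs_le; lra))).
  specialize (Hfar (tau (phi x + r2))); rewrite !Rabs_pos_eq in Hfar by lra.
  specialize (Hfar ltac:(lra)); lra.
- destruct (Key (- (2 ^ k * t))) as (R0 & HR0 & Hnear & Hfar);
    [rewrite Rabs_Ropp; apply Rabs_pos_eq; lra |].
  set (r := phi x - phi (x - 2 ^ k * t)) in *.
  destruct (Hcc f G H Gm (phi x) r Fx R0) as (r1 & r2 & r3 & B1 & B2 & B3 & Hbox);
    [unfold r; lra | easy |].
  pose proof (crosscut_feet f G tau Fx R0 Lam (phi x - r1) (phi x + r2) r3 Ht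
    ltac:(unfold r in *; lra) ltac:(unfold r in *; lra) Hbox
    (phi x + r2) (phi x - r1) (or_intror eq_refl) (or_introl eq_refl)) as Q.
  assert (T1 : tau (phi x + r2) <= x + t) by (rewrite <- (Hphi (x + t)); apply Htau_le; unfold r in *; lra).
  assert (T2 : x <= tau (phi x + r2)) by (rewrite <- (Hphi x) at 1; apply Htau_le; unfold r in *; lra).
  assert (T3 : tau (phi x - r1) <= x - 2 ^ k * t)
    by (rewrite <- (Hphi (x - 2 ^ k * t)); apply Htau_le; unfold r in *; lra).
  specialize (Q (Hnear (tau (phi x + r2)) ltac:(apply Rabs_le; lra))).
  specialize (Hfar (tau (phi x - r1))); rewrite Rabs_Ropp in Hfar.
  rewrite Rabs_pos_eq, Rabs_left in Hfar by lra.
  specialize (Hfar ltac:(lra)); lra.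
Qed.

(** Doubling with a shrunken neighbour implies doubling: cut [x, x + t] into
    [K] pieces; each piece is controlled by the [K] pieces to its left. *)
Lemma chained_doubling (g : R -> R) K x t : (0 < K)%nat -> 0 < t ->
  (forall x y, x < y -> g x < g y) ->
  (forall x t, 0 < t -> g (x + t) - g x < 2 * (g x - g (x - INR K * t))) ->
  g (x + t) - g (x - t) <= 3 ^ K * (g x - g (x - t)).
Proof.
intros HK Htp Hinc Hd.
assert (HK' : 0 < INR K) by now apply lt_0_INR.
set (s := t / INR K).
assert (Hs : 0 < s) by now apply Rdiv_lt_0_compat.
assert (HKs : INR K * s = t) by (unfold s; field; lra).
assert (Hx : g (x - t) < g x) by (apply Hinc; lra).
assert (G : forall j, g (x + INR j * s) - g (x - t) <= 3 ^ j * (g x - g (x - t))).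
{ induction j as [|j IH].
  - simpl; rewrite Rmult_0_l, Rplus_0_r; lra.
  - specialize (Hd (x + INR j * s) s Hs); rewrite HKs in Hd.
    replace (x + INR j * s + s) with (x + INR (S j) * s) in Hd by (rewrite S_INR; ring).
    assert (g (x - t) <= g (x + INR j * s - t)).
    { destruct (Req_dec (INR j * s) 0) as [E | E]; [rewrite E, Rplus_0_r; lra |].
      left; apply Hinc; pose proof (pos_INR j); nra. }
    simpl pow; lra. }
specialize (G K); rewrite HKs in G; exact G.
Qed.

Lemma inverse_increasing_continuous tau phi : (forall t t', t < t' -> tau t < tau t') ->
  (forall x, tau (phi x) = x) -> forall x, continuous phi x.
Proof.
intros Hinc Hphi x; apply rcont_continuous; intros e He.
assert (Hlt : forall t t', tau t < tau t' -> t < t').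
{ intros t t' h; apply Rnot_le_lt; intros [h' | ->]; [specialize (Hinc _ _ h') |]; lra. }
pose proof (Hinc (phi x - e / 2) (phi x) ltac:(lra)) as H1.
pose proof (Hinc (phi x) (phi x + e / 2) ltac:(lra)) as H2.
rewrite Hphi in H1, H2.
exists (Rmin (x - tau (phi x - e / 2)) (tau (phi x + e / 2) - x)); split; [apply Rmin_pos; lra |].
intros y Hy.
pose proof (Rmin_l (x - tau (phi x - e / 2)) (tau (phi x + e / 2) - x)).
pose proof (Rmin_r (x - tau (phi x - e / 2)) (tau (phi x + e / 2) - x)).
apply Rabs_lt_between in Hy.
assert (phi x - e / 2 < phi y) by (apply Hlt; rewrite Hphi; lra).
assert (phi y < phi x + e / 2) by (apply Hlt; rewrite Hphi; lra).
apply Rabs_lt_between; lra.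
Qed.

Lemma graph_map_welding M f G H : 0 <= M -> zyg M f -> graph_map f G H ->
  exists tau phi, boundary_map f G tau /\
    (forall x, tau (phi x) = x) /\ (forall t, phi (tau t) = t) /\ quasisymmetric phi.
Proof.
intros HM Hz Gm.
destruct (boundary_map_exists M f G H HM Hz Gm) as [tau Ht].
assert (Hinc := boundary_map_increasing M f G H tau HM Hz Gm Ht).
set (E := fun y => constructive_indefinite_description _
   (boundary_map_surjective M f G H tau HM Hz Gm Ht y)).
set (phi := fun y => proj1_sig (E y)).
assert (Hphi : forall x, tau (phi x) = x) by (intros x; apply (proj2_sig (E x))).
assert (Hphi' : forall t, phi (tau t) = t).
{ intros t; apply (boundary_map_injective M f G H tau HM Hz Gm Ht), Hphi. }
assert (Hpinc : forall x y, x < y -> phi x < phi y).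
{ intros x y Hxy; apply Rnot_le_lt; intros [h | h].
  - specialize (Hinc _ _ h); rewrite !Hphi in Hinc; lra.
  - apply (f_equal tau) in h; rewrite !Hphi in h; lra. }
exists tau, phi; repeat split; auto.
- exact (inverse_increasing_continuous tau phi Hinc Hphi).
- exists tau; repeat split; auto.
  intros t; apply rcont_continuous, (boundary_map_rcont f G tau t Ht).
- destruct (welding_one_sided_doubling M f G H tau phi HM Hz Gm Ht Hinc Hphi) as [k Hk].
  set (K := (2 ^ k)%nat).
  assert (EK : INR K = 2 ^ k) by (unfold K; rewrite pow_INR; easy).
  assert (HK : (0 < K)%nat) by (apply INR_lt; rewrite EK; simpl; apply pow_lt; lra).
  exists (3 ^ K); split; [apply pow_R1_Rle; lra |]; intros x t Htp.
  assert (H3 : 0 < 3 ^ K) by (apply pow_lt; lra).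
  assert (L1 : phi (x - t) < phi x) by (apply Hpinc; lra).
  assert (L2 : phi x < phi (x + t)) by (apply Hpinc; lra).
  assert (Up := chained_doubling phi K x t HK Htp Hpinc).
  lapply Up; clear Up; [intros Up |].
  2: { intros y s Hs; rewrite EK; apply (Hk y s Hs). }
  (* The mirror image of phi has the same doubling property. *)
  assert (Lo := chained_doubling (fun y => - phi (- y)) K (- x) t HK Htp).
  lapply Lo; clear Lo; [intros Lo | intros a b Hab; apply Ropp_lt_contravar, Hpinc; lra].
  lapply Lo; clear Lo; [intros Lo |].
  2: { intros y s Hs; rewrite EK; destruct (Hk (- y) s Hs) as [Q _].
       replace (- (y + s)) with (- y - s) by ring.
       replace (- (y - 2 ^ k * s)) with (- y + 2 ^ k * s) by ring. lra. }
  replace (- (- x + t)) with (x - t) in Lo by ring.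
  replace (- (- x - t)) with (x + t) in Lo by ring.
  rewrite Ropp_involutive in Lo.
  split.
  + apply Rmult_le_reg_r with (3 ^ K * (phi x - phi (x - t))); [nra |].
    field_simplify; [| lra | lra]; nra.
  + apply Rmult_le_reg_r with (phi x - phi (x - t)); [lra |].
    field_simplify; [| lra]; nra.
Qed.

(** * The two sides of the graph *)

Lemma zygmund_zyg f : zygmund f -> exists M, 0 <= M /\ zyg M f.
Proof.
intros [Hc [M HM]]; exists (Rmax M 0); split; [apply Rmax_r |].
split; [intros x; apply continuous_rcont, Hc |]; intros x h.
destruct (Req_dec h 0) as [-> | Hh].
- replace (f (x + 0) + f (x - 0) - 2 * f x) with 0 by (rewrite Rplus_0_r, Rminus_0_r; ring).
  rewrite Rabs_R0; lra.
- specialize (HM x h Hh); assert (P : 0 < Rabs h) by now apply Rabs_pos_lt.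
  apply Rmult_le_compat_r with (r := Rabs h) in HM; [| lra].
  unfold Rdiv in HM; rewrite Rmult_assoc, Rinv_l, Rmult_1_r in HM by lra.
  pose proof (Rmax_l M 0); nra.
Qed.

Lemma conformal_above_graph_map f G : (forall x, rcont f x) ->
  conformal (half_plane above) (graph_domain f above) G ->
  fixes_infinity (half_plane above) G -> exists H, graph_map f G H.
Proof.
intros Hf (HG & HGV & H & HH & HHU & HHG & HGH) Hinf; exists H; split; auto.
- intros z Hz; apply ex_derive_has_cderiv, HG, Hz.
- intros w Hw; apply ex_derive_has_cderiv, HH, Hw.
Qed.

Definition reflect (G : C -> C) (z : C) : C := Cconj (G (Cconj z)).

Lemma Cconj_invol z : Cconj (Cconj z) = z.
Proof. unfold Cconj; apply injective_projections; simpl; ring. Qed.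

Lemma Cconj_sub a b : (Cconj a - Cconj b)%C = Cconj (a - b).
Proof. unfold Cconj; apply injective_projections; simpl; ring. Qed.

Lemma has_cderiv_reflect g z l : has_cderiv g (Cconj z) l -> has_cderiv (reflect g) z (Cconj l).
Proof.
intros H e He; destruct (H e He) as (d & Hd & Hd'); exists d; split; [easy |]; intros z' Hz'.
assert (E : Cmod (Cconj z' - Cconj z) = Cmod (z' - z)) by now rewrite Cconj_sub, Cmod_conj.
specialize (Hd' (Cconj z') ltac:(lra)); rewrite E in Hd'.
rewrite <- (Cmod_conj (_ - _ - _)) in Hd'; unfold reflect.
replace (Cconj (g (Cconj z')) - Cconj (g (Cconj z)) - Cconj l * (z' - z))%C
  with (Cconj (g (Cconj z') - g (Cconj z) - l * (Cconj z' - Cconj z))); [easy |].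
unfold Cconj; apply injective_projections; simpl; ring.
Qed.

Lemma conformal_below_graph_map f G : (forall x, rcont f x) ->
  conformal (half_plane below) (graph_domain f below) G ->
  fixes_infinity (half_plane below) G -> exists H, graph_map (fun x => - f x) (reflect G) H.
Proof.
intros Hf (HG & HGV & H & HH & HHU & HHG & HGH) Hinf; exists (reflect H).
assert (U : forall z : C, 0 < snd z -> half_plane below (Cconj z)).
{ intros z Hz; unfold half_plane, Im; simpl; lra. }
assert (V : forall w : C, - f (fst w) < snd w -> graph_domain f below (Cconj w)).
{ intros w Hw; unfold graph_domain, Re, Im; simpl; lra. }
split.
- intros z Hz; specialize (HGV _ (U z Hz)); unfold graph_domain, Re, Im in HGV.
  unfold reflect; simpl; lra.
- intros w Hw; specialize (HHU _ (V w Hw)); unfold half_plane, Im in HHU.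
  unfold reflect; simpl; lra.
- intros z Hz; unfold reflect; rewrite Cconj_invol, HHG, Cconj_invol; auto.
- intros w Hw; unfold reflect; rewrite Cconj_invol, HGH, Cconj_invol; auto.
- intros z Hz; destruct (ex_derive_has_cderiv G (Cconj z)) as [l Hl]; [apply HG, U, Hz |].
  exists (Cconj l); now apply has_cderiv_reflect.
- intros w Hw; destruct (ex_derive_has_cderiv H (Cconj w)) as [l Hl]; [apply HH, V, Hw |].
  exists (Cconj l); now apply has_cderiv_reflect.
- intros x; apply rcont_opp, Hf.
- intros K; destruct (Hinf K) as [N HN]; exists N; intros z Hz HzN.
  unfold reflect; rewrite Cmod_conj; apply HN; [now apply U | now rewrite Cmod_conj].
Qed.

(** An estimate form of the filter limit in [closure_extension], convertible to
    [blim] when [U] is the upper half-plane. *)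
Definition lim_within (U : C -> Prop) (G : C -> C) (t : R) (p : C) : Prop :=
  forall e, 0 < e -> exists d, 0 < d /\ forall z, U z -> Cmod (z - RtoC t) < d ->
    Cmod (G z - p) < e.

Lemma lim_within_filterlim U G t p :
  lim_within U G t p <-> filterlim G (within U (locally (RtoC t))) (locally p).
Proof.
split.
- intros H P [e HP].
  destruct (H e (cond_pos e)) as (d & Hd & Hd').
  assert (Hd2 : 0 < d / 2) by lra.
  exists (mkposreal _ Hd2); intros z [Hz1 Hz2] HU; apply HP.
  change (Rabs (fst z - t) < d / 2) in Hz1; change (Rabs (snd z - 0) < d / 2) in Hz2.
  assert (B : Cmod (G z - p) < e).
  { apply Hd'; [easy |]; eapply Rle_lt_trans; [apply Cmod_le_sum |]; simpl.
    unfold Rminus in *; lra. }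
  split; [change (Rabs (fst (G z) - fst p) < e) | change (Rabs (snd (G z) - snd p) < e)];
    eapply Rle_lt_trans; try apply B;
    [apply (Re_le_Cmod (G z - p)) | apply (Im_le_Cmod (G z - p))].
- intros H e He.
  assert (He2 : 0 < e / 2) by lra.
  destruct (H (ball p (mkposreal _ He2))) as [d Hd]; [now exists (mkposreal _ He2) |].
  exists d; split; [apply cond_pos |]; intros z HU Hz.
  destruct (Hd z) as [H1 H2]; [split | easy |].
  + change (Rabs (fst z - t) < d); eapply Rle_lt_trans; [apply (Re_le_Cmod (z - RtoC t)) | easy].
  + change (Rabs (snd z - 0) < d); eapply Rle_lt_trans; [apply (Im_le_Cmod (z - RtoC t)) | easy].
  + change (Rabs (fst (G z) - fst p) < e / 2) in H1.
    change (Rabs (snd (G z) - snd p) < e / 2) in H2.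
    eapply Rle_lt_trans; [apply Cmod_le_sum |]; simpl; unfold Rminus in *; lra.
Qed.

Lemma lim_within_reflect G t p :
  lim_within (half_plane below) G t p <-> blim (reflect G) t (Cconj p).
Proof.
assert (E : forall z, Cmod (Cconj z - RtoC t) = Cmod (z - RtoC t)).
{ intros z; rewrite <- (Cmod_conj (z - RtoC t)), <- Cconj_sub; do 2 f_equal.
  unfold Cconj, RtoC; simpl; f_equal; ring. }
assert (E2 : forall z, Cmod (reflect G z - Cconj p) = Cmod (G (Cconj z) - p)).
{ intros z; unfold reflect; now rewrite Cconj_sub, Cmod_conj. }
split; intros H e He; destruct (H e He) as (d & Hd & Hd'); exists d; split; auto; intros z Hz Hzd.
- rewrite E2; apply Hd'; [unfold half_plane, Im; simpl; lra | now rewrite E].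
- rewrite <- (Cconj_invol z), <- E2; apply Hd'; [| now rewrite E].
  unfold half_plane, Im in Hz; simpl; lra.
Qed.

(** It remains to identify the choices made by [epsilon]: boundary limits are
    unique, and so is the point of the real line with a given limit. *)
Lemma graph_welding_eq f s G tau phi :
  (forall t, lim_within (half_plane s) G t (graph_param f (tau t))) ->
  (forall t p q, lim_within (half_plane s) G t p -> lim_within (half_plane s) G t q -> p = q) ->
  (forall x, tau (phi x) = x) -> (forall t, phi (tau t) = t) ->
  graph_welding f s G = phi.
Proof.
intros Hlim Huniq H1 H2; apply functional_extensionality; intros x.
assert (Ext : forall t, closure_extension (half_plane s) G (RtoC t) = graph_param f (tau t)).
{ intros t; apply (Huniq t); [| apply Hlim]; apply lim_within_filterlim.
  unfold closure_extension; apply epsilon_spec.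
  exists (graph_param f (tau t)); apply lim_within_filterlim, Hlim. }
assert (E : closure_extension (half_plane s) G (RtoC (graph_welding f s G x)) = graph_param f x).
{ unfold graph_welding; apply (epsilon_spec (inhabits 0)
    (fun t => closure_extension (half_plane s) G (RtoC t) = graph_param f x)).
  exists (phi x); now rewrite Ext, H1. }
rewrite Ext in E; apply (f_equal fst) in E; simpl in E.
now rewrite <- (H2 (graph_welding f s G x)), E.
Qed.

Theorem theorem5p3 (f : R -> R) (s : side) (G : C -> C) :
  zygmund f ->
  conformal (half_plane s) (graph_domain f s) G ->
  fixes_infinity (half_plane s) G ->
  quasisymmetric (graph_welding f s G).
Proof.
intros Hf HG Hinf; destruct (zygmund_zyg f Hf) as (M & HM & Hz).
destruct s.
- destruct (conformal_above_graph_map f G (proj1 Hz) HG Hinf) as [H Gm].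
  destruct (graph_map_welding M f G H HM Hz Gm) as (tau & phi & Ht & H1 & H2 & Hqs).
  rewrite (graph_welding_eq f above G tau phi); auto.
  intros t p q Hp Hq; apply (blim_unique G t); assumption.
- destruct (conformal_below_graph_map f G (proj1 Hz) HG Hinf) as [H Gm].
  destruct (graph_map_welding M _ _ H HM (zyg_opp M f Hz) Gm) as (tau & phi & Ht & H1 & H2 & Hqs).
  rewrite (graph_welding_eq f below G tau phi); auto.
  + intros t; apply lim_within_reflect, (Ht t).
  + intros t p q Hp%lim_within_reflect Hq%lim_within_reflect.
    rewrite <- (Cconj_invol p), <- (Cconj_invol q); f_equal; now apply (blim_unique (reflect G) t).
Qed.
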